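(* Let $\mathcal{C}$ be a simplicial complex on a finite ground set. The following are equivalent: (1) $\mathcal{C}$ is unimodular; (2) $\mathcal{C}$ is $\beta$-avoiding; (3) $\mathcal{C}$ is nuclear.
   Context: A simplicial complex $\mathcal{C}$ on a finite ground set $V$ is a family of subsets of $V$ closed under taking subsets (the void complex $\{\}$ and the irrelevant complex $\{\emptyset\}$ are allowed). Elements of $V$ lying in no face are called ghost vertices. Facets are inclusion-maximal faces. Two complexes are isomorphic if there is a bijection of ground sets carrying faces onto faces; all equalities of complexes below are up to isomorphism. For $\mathbf{d}=(d_v)_{v\in V}$ with all $d_v\ge 2$, $\mathcal{A}_{\mathcal{C},\mathbf{d}}$ is the $0/1$ matrix whose columns are indexed by $\mathbf{i}\in\prod_{v\in V}[d_v]$ and whose rows are indexed by pairs $(F,\mathbf{e})$ with $F$ a facet of $\mathcal{C}$ and $\mathbf{e}\in\prod_{v\in F}[d_v]$; the entry is $1$ iff $\mathbf{e}=\mathbf{i}|_F$. Write $\mathcal{A}_{\mathcal{C}}=\mathcal{A}_{\mathcal{C},\mathbf{2}}$ (all $d_v=2$). An integer matrix $A$ is unimodular if every circuit of $A$ (a nonzero integer vector $u\in\ker A$ with relatively prime entries such that no nonzero kernel vector has support strictly contained in that of $u$) has all entries in $\{0,1,-1\}$; equivalently, if $\operatorname{rank}A=d$ and $A$ has $d$ rows, all $d\times d$ minors lie in $\{0,\pm\lambda\}$ for some $\lambda$. $\mathcal{C}$ is unimodular if $\mathcal{A}_{\mathcal{C}}$ is. Operations: for $W\subseteq V$, the induced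 subcomplex is $\{F\in\mathcal{C}:F\subseteq W\}$ on ground set $W$; $\mathcal{C}\setminus S$ denotes the induced subcomplex on $V\setminus S$. For a face $S$, $\operatorname{link}_S(\mathcal{C})=\{F\setminus S: F\in\mathcal{C}, S\subseteq F\}$ on ground set $V\setminus S$. A minor of $\mathcal{C}$ is any $\operatorname{link}_R(\mathcal{C}\setminus S)$ with $S,R\subseteq V$ disjoint and $R$ a face of $\mathcal{C}$. The Alexander dual is $\mathcal{C}^*=\{S\subseteq V: V\setminus S\notin\mathcal{C}\}$ on $V$. $\Delta_k$ ($k\ge0$) is the complex on a $(k+1)$-set with that set as its only facet; $\Delta_{-1}=\{\emptyset\}$ and $\Delta_{-2}=\{\}$ on the empty ground set. $\partial\Delta_n$ is the complex of all proper subsets of an $(n+1)$-set. $\sqcup$ denotes disjoint union (ground sets and faces). $D_{m,n}=(\Delta_m\sqcup\Delta_n)^*$. $\operatorname{cone}^p(\mathcal{C})$ is the complex on $V\cup\{u_1,\dots,u_p\}$ (new vertices) with facets $F\cup\{u_1,\dots,u_p\}$, $F$ a facet of $\mathcal{C}$. $G(\mathcal{C})$ is $\mathcal{C}$ on ground set $V\cup\{w\}$ with $w$ a new (ghost) vertex. For $\mathcal{C}$ on $[n]$, the Lawrence lifting $\Lambda(\mathcal{C})$ is the complex on $[n+1]$ with facets $[n]$ and $F\cup\{n+1\}$, $F$ a facet of $\mathcal{C}$. $\beta$-avoiding: $\mathcal{C}$ has no minor isomorphic to any of: $P_4$ (ground set $\{1,2,3,4\}$, facets $12,23,34$); $O_6$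 (ground set $\{1,\dots,6\}$, faces the subsets containing none of the pairs $\{1,2\},\{3,4\},\{5,6\}$) or its Alexander dual $O_6^*$; $J_1$ (on $\{1,\dots,5\}$, facets $12,15,234,345$) or $J_1^*$ (on $\{1,\dots,5\}$, facets $134,235,245$); $J_2$ (on $\{1,\dots,5\}$, facets $12,235,34,145$); $\partial\Delta_n\sqcup\{v\}$ for $n\ge1$ (i.e. $\partial\Delta_n$ disjoint union with a single vertex complex $\Delta_0$). Nuclear: $\mathcal{C}$ is nuclear if it is (isomorphic to) one of: $\Lambda(\mathcal{D})$ with $\mathcal{D}$ nuclear; $G(\mathcal{D})$ with $\mathcal{D}$ nuclear; $\operatorname{cone}^p(\Delta_m\sqcup\Delta_n)$ with $p,m,n\ge0$; $\operatorname{cone}^p(D_{m,n})$ with $p\ge0$, $m,n\ge1$; $\Delta_k$ with $k\ge-2$. *)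

(* Defs.v *)
From mathcomp Require Import all_boot all_order all_algebra.
Unset Implicit Arguments. Unset Printing Implicit Defensive.
Import GRing.Theory Num.Theory.

(* A simplicial complex with an explicit finite ground set V (a subset of an
   ambient finite type T; elements of V in no face are ghost vertices) and
   its family of faces. *)
Record scx := SCx { sT : finType; sV : {set sT}; sF : {set {set sT}} }.

(* well-formedness: faces lie in V and the family is closed under subsets
   (void complex allowed) *)
Definition wf (K : scx) : Prop :=
  (forall F : {set sT K}, F \in sF K -> F \subset sV K) /\
  (forall F G : {set sT K}, F \in sF K -> G \subset F -> G \in sF K).

Definition iso (K L : scx) : Prop :=
  exists f : sT K -> sT L,
    {in sV K &, injective f} /\ f @: sV K = sV L /\
    (forall F : {set sT K}, F \in sF K -> F \subset sV K) /\
    (forall G : {set sT L}, G \in sF L -> G \subset sV L) /\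
    (forall S : {set sT K}, S \subset sV K -> (S \in sF K) = (f @: S \in sF L)).

Definition facet (K : scx) (F : {set sT K}) : bool :=
  (F \in sF K) && [forall G : {set sT K}, (G \in sF K) ==> (F \subset G) ==> (G == F)].

(* The matrix A_C (all d_v = 2): columns indexed by i in {0,1}^V, encoded as
   the subset I = i^{-1}(1) of V; rows indexed by (F, e) with F a facet and
   e in {0,1}^F, encoded as E = e^{-1}(1) subset of F; entry 1 iff
   i|_F = e, i.e. I :&: F = E.  (A u)_(F,E) is: *)
Definition Amul (K : scx) (u : {set sT K} -> int) (F E : {set sT K}) : int :=
  (\sum_(I : {set sT K} | I \subset sV K) (if I :&: F == E then u I else 0))%R.

Definition in_ker (K : scx) (u : {set sT K} -> int) : Prop :=
  (forall I : {set sT K}, ~~ (I \subset sV K) -> u I = 0%R) /\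
  (forall F E : {set sT K}, facet K F -> E \subset F -> Amul K u F E = 0%R).

Definition nonzero (K : scx) (u : {set sT K} -> int) : Prop :=
  exists I, u I != 0%R.

Definition circuit (K : scx) (u : {set sT K} -> int) : Prop :=
  [/\ in_ker K u, nonzero K u,
      (\big[gcdn/0%N]_(I : {set sT K} | I \subset sV K) absz (u I))%N = 1%N
    & ~ (exists w : {set sT K} -> int,
           [/\ in_ker K w, nonzero K w,
               (forall I, u I = 0%R -> w I = 0%R)
             & exists I, u I != 0%R /\ w I = 0%R])].

Definition unimodular (K : scx) : Prop :=
  forall u, circuit K u -> forall I, u I \in [:: 0%R; 1%R; (-1)%R].

Definition minor (K : scx) (S R : {set sT K}) : scx :=
  @SCx (sT K) (sV K :\: S :\: R)
    [set F :\: R | F : {set sT K} in [set F : {set sT K} | (F \in sF K) && (R \subset F) && [disjoint F & S]]].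

Definition is_minor_of (M K : scx) : Prop :=
  exists S R : {set sT K},
    [/\ S \subset sV K, R \subset sV K, [disjoint S & R], R \in sF K
      & iso (minor K S R) M].

Definition adual (K : scx) : scx :=
  @SCx (sT K) (sV K) [set S : {set sT K} | (S \subset sV K) && (sV K :\: S \notin sF K)].

Definition dunion (K L : scx) : scx :=
  @SCx (sT K + sT L)%type (inl @: sV K :|: inr @: sV L)
    ([set inl @: F | F : {set sT K} in sF K] :|: [set inr @: G | G : {set sT L} in sF L]).

Definition simplex (k : nat) : scx :=
  @SCx 'I_k.+1 setT setT.
(* Delta_{-1} = {emptyset} and Delta_{-2} = {} on the empty ground set *)
Definition irrelevant : scx := @SCx 'I_0 set0 [set set0].
Definition void : scx := @SCx 'I_0 set0 set0.

(* cone^p: new vertices u_1..u_p (the inl part); faces = subsets of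
   F cup {u_1..u_p} for facets F, i.e. U cup G with G a face *)
Definition cone (p : nat) (K : scx) : scx :=
  @SCx ('I_p + sT K)%type (inl @: [set: 'I_p] :|: inr @: sV K)
    [set S : {set ('I_p + sT K)%type} | [exists U : {set 'I_p}, exists G : {set sT K},
               (G \in sF K) &&
               (S == inl @: U :|: inr @: G)]].

Definition ghost (K : scx) : scx :=
  @SCx (option (sT K)) (Some @: sV K :|: [set None]) [set Some @: G | G : {set sT K} in sF K].

(* Lawrence lifting: facets V and F cup {new}; the new vertex is None *)
Definition lawrence (K : scx) : scx :=
  @SCx (option (sT K)) (Some @: sV K :|: [set None])
    ([set S : {set option (sT K)} | S \subset Some @: sV K] :|:
     [set None |: (Some @: G) | G : {set sT K} in sF K]).

Definition Dmn (m n : nat) : scx := adual (dunion (simplex m) (simplex n)).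

Inductive nuclear : scx -> Prop :=
| nuc_lawrence D L : nuclear D -> iso (lawrence D) L -> nuclear L
| nuc_ghost D L : nuclear D -> iso (ghost D) L -> nuclear L
| nuc_cone_disj p m n L :
    iso (cone p (dunion (simplex m) (simplex n))) L -> nuclear L
| nuc_cone_D p m n L : (1 <= m)%N -> (1 <= n)%N ->
    iso (cone p (Dmn m n)) L -> nuclear L
| nuc_simplex k L : iso (simplex k) L -> nuclear L
| nuc_irrelevant L : iso irrelevant L -> nuclear L
| nuc_void L : iso void L -> nuclear L.

(* ---------- forbidden minors (vertices renumbered 1..n -> 0..n-1) ---------- *)

Definition vs (n : nat) (l : seq nat) : {set 'I_n} := [set x : 'I_n | val x \in l].

Definition of_facets (n : nat) (fs : seq (seq nat)) : scx :=
  @SCx 'I_n setT [set S : {set 'I_n} | has (fun l => S \subset vs n l) fs].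

Definition P4 : scx := of_facets 4 [:: [:: 0; 1]; [:: 1; 2]; [:: 2; 3]]%N.

Definition O6 : scx :=
  @SCx 'I_6 setT
    [set S : {set 'I_6} | ~~ (vs 6 [:: 0; 1]%N \subset S) &&
                          ~~ (vs 6 [:: 2; 3]%N \subset S) &&
                          ~~ (vs 6 [:: 4; 5]%N \subset S)].

Definition J1 : scx :=
  of_facets 5 [:: [:: 0; 1]; [:: 0; 4]; [:: 1; 2; 3]; [:: 2; 3; 4]]%N.

Definition J1s : scx :=
  of_facets 5 [:: [:: 0; 2; 3]; [:: 1; 2; 4]; [:: 1; 3; 4]]%N.

Definition J2 : scx :=
  of_facets 5 [:: [:: 0; 1]; [:: 1; 2; 4]; [:: 2; 3]; [:: 0; 3; 4]]%N.

Definition bdry_plus_pt (n : nat) : scx :=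
  @SCx 'I_n.+2 setT
    ([set S : {set 'I_n.+2} | (S \subset vs n.+2 (iota 0 n.+1)) &&
                              (S != vs n.+2 (iota 0 n.+1))] :|:
     [set set0; vs n.+2 [:: n.+1]]).

Definition beta_avoiding (K : scx) : Prop :=
  ~ is_minor_of P4 K /\ ~ is_minor_of O6 K /\ ~ is_minor_of (adual O6) K /\
  ~ is_minor_of J1 K /\ ~ is_minor_of J1s K /\ ~ is_minor_of J2 K /\
  (forall n, (1 <= n)%N -> ~ is_minor_of (bdry_plus_pt n) K).

(* Main.v *)
(* A complex K on V is encoded by its monotone non-face predicate f, [f S = (S \notin sF K)]; the
   minor link_R(K \ S') is then the function [S |-> f (S :|: R)] on a smaller ground set.

   Beta-avoiding implies nuclear.  A critical f (beta-avoiding, all proper minors of the expected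
   shape, itself not) has no ghost, Lawrence or irrelevant vertex.  If some vertex z lies in no
   two-element non-face, then the deletion and the link of z are known shapes: each of them is
   "S contains X or Y" or "S meets X and Y", or else the deletion has a Lawrence vertex w, in which
   case one more link (at w, or at a vertex on the side of w) is examined.  Every combination either
   contains a forbidden minor or makes f itself a known shape.  Otherwise the graph of two-element
   non-faces has no no_isolated_vertex vertex, no triangle and no induced path on four vertices; an induced
   pair of disjoint edges leads to O6 or J1 or to D_{1,1}, and without such a pair the graph is
   complete bipartite and K is a disjoint union of two simplices.

   Unimodularity is equivalent to: below the support of every nonzero kernel vector there is a
   nonzero kernel vector with entries 0, 1, -1.  This passes through the nuclear constructions
   (alternating cycles for two disjoint simplices, thresholding f(i) + g(j) for D_{m,n}), and its
   failure passes from a minor to the complex: extend by zero for deletions and with the sign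
   (-1)^|I cap R| for links.  Each forbidden complex has a kernel vector with an entry 2 whose
   support carries only its multiples. *)
Require Import Defs.
From mathcomp Require Import all_boot all_order all_algebra zify ring.
Set Implicit Arguments.
Unset Strict Implicit.
Import Order.TTheory GRing.Theory Num.Theory.

(** * Forbidden minors of monotone functions *)

(** The ambient type never changes in the combinatorial half: a minor is again a function on subsets
    of the same type, with a smaller ground set and a shifted argument, so the induction on #|W|
    meets no isomorphism. The difficulty is that the shapes known for the deletion and the link of z
    come with unrelated sets. What ties them together is monotonicity: a non-face of the deletion is
    a non-face of the link, and each such comparison restricts how the two pairs of sets can
    overlap.

    In the linear half, minimality of support behaves badly under extension and projection of kernel
    vectors. The pair [good]/[bad] avoids it: both speak of all kernel vectors below a given one, so
    each nuclear construction only has to lift a vector and each minor only has to slice one.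
    Circuits occur in just two lemmas, which link the pair to [unimodular]. *)

Definition mono (T : finType) (f : {set T} -> bool) : Prop :=
  forall A B : {set T}, A \subset B -> f A -> f B.

Inductive forbidden : scx -> Prop :=
| forbP4 : forbidden P4
| forbO6 : forbidden O6
| forbO6s : forbidden (adual O6)
| forbJ1 : forbidden J1
| forbJ1s : forbidden J1s
| forbJ2 : forbidden J2
| forbBd n : (1 <= n)%N -> forbidden (bdry_plus_pt n).

(** The deleted set stays implicit: it is whatever of [W] lies outside [R] and the image of [h].
    That [R] is a face is the instance [S = set0], as every forbidden complex contains the empty
    face. *)
Definition realizes (T : finType) (f : {set T} -> bool) (W : {set T}) (M : scx) : Prop :=
  exists (h : sT M -> T) (R : {set T}),
    [/\ injective h, forall i, h i \in W :\: R, R \subset W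
      & forall S : {set sT M}, f (h @: S :|: R) = (S \notin sF M)].

Definition avoids (T : finType) (f : {set T} -> bool) (W : {set T}) : Prop :=
  forall M, forbidden M -> ~ realizes f W M.

Lemma avoids_minor (T : finType) (f : {set T} -> bool) (W W' R' : {set T}) :
  W' \subset W -> R' \subset W -> [disjoint W' & R'] ->
  avoids f W -> avoids (fun S => f (S :|: R')) W'.
Proof.
move=> sW sR dR av M FM [h [R [hi hW RW hE]]]; apply: (av M FM).
exists h, (R :|: R'); split=> //.
- move=> i; have /setDP[iW iR] := hW i.
  by rewrite !inE negb_or iR (subsetP sW) // (disjointFr dR iW).
- by rewrite subUset (subset_trans RW sW).
- by move=> S; rewrite setUA hE.
Qed.

(** With bare naturals as indices, a claim about all subsets of 'I_n becomes a propositional formula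
    in the atoms [memn S 0], [memn S 1], ..., which [facets_tac] decides by cases. *)
Definition memn n (S : {set 'I_n}) (i : nat) : bool := [exists j : 'I_n, (val j == i) && (j \in S)].

Lemma memnE n (S : {set 'I_n}) (i : 'I_n) : memn S i = (i \in S).
Proof.
apply/existsP/idP => [[j /andP[/eqP/val_inj->]]//|iS].
by exists i; rewrite eqxx.
Qed.

Lemma vs_subE n (S : {set 'I_n}) l :
  all (fun i => i < n) l -> (vs n l \subset S) = all (memn S) l.
Proof.
move=> /allP ln; apply/subsetP/allP => [H i il|H i].
  have := H (Ordinal (ln _ il)); rewrite inE /= => /(_ il).
  by rewrite -memnE.
by rewrite inE => /H; rewrite memnE.
Qed.

Lemma sub_vsE n (S : {set 'I_n}) l :
  (S \subset vs n l) = all (fun i => memn S i ==> (i \in l)) (iota 0 n).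
Proof.
apply/subsetP/allP => [H i|H i iS].
  rewrite mem_iota /= add0n => lin; apply/implyP=> iS.
  by have := H (Ordinal lin); rewrite -memnE inE => /(_ iS).
have := H i; rewrite mem_iota /= add0n ltn_ord => /(_ isT)/implyP.
by rewrite memnE inE; apply.
Qed.

Lemma memnC n (S : {set 'I_n}) i : i < n -> memn (~: S) i = ~~ memn S i.
Proof. by move=> lin; rewrite !(memnE _ (Ordinal lin)) inE. Qed.

(** * Recognising the forbidden complexes by facets and minimal non-faces *)

Section Patterns.
Variables (T : finType) (f : {set T} -> bool) (W : {set T}).
Hypotheses (fm : mono f) (av : avoids f W).

(* By monotonicity it suffices to test f on the facets fs and the minimal non-faces ns. *)
Lemma avoids_seq n (F : {set {set 'I_n}}) (fs ns : seq (seq nat)) (x0 : T) (s : seq T)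
    (R : {set T}) :
  forbidden (@SCx 'I_n setT F) ->
  (forall S, S \notin F -> has (fun l => vs n l \subset S) ns) ->
  (forall S, S \in F -> has (fun l => S \subset vs n l) fs) ->
  all (all (fun i => i < n)) (fs ++ ns) ->
  size s = n -> uniq s -> all (mem (W :\: R)) s -> R \subset W ->
  all (fun l => f ([set:: [seq nth x0 s i | i <- l]] :|: R)) ns ->
  all (fun l => ~~ f ([set:: [seq nth x0 s i | i <- l]] :|: R)) fs -> False.
Proof.
move=> FM nsP fsP; rewrite all_cat => /andP[fl nl] sn us /allP sW RW fN fF.
have E l : all (fun i => i < n) l ->
    [set nth x0 s (val i) | i in vs n l] = [set:: [seq nth x0 s i | i <- l]].
  move=> /allP ln; apply/setP=> x; rewrite inE; apply/imsetP/mapP => [[i]|[i il ->]].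
    by rewrite inE => il ->; exists (val i).
  by exists (Ordinal (ln _ il)); rewrite // inE.
apply: (av FM); exists (fun i : 'I_n => nth x0 s (val i)), R; split=> //.
- by move=> i j /eqP; rewrite nth_uniq ?sn ?ltn_ord // => /eqP/val_inj.
- by move=> i; apply: (sW (nth x0 s i)); apply: mem_nth; rewrite sn ltn_ord.
move=> S /=; case: (boolP (S \in F)) => [SF|SF] /=.
  have /hasP[l lfs Sl] := fsP S SF; apply/negbTE.
  apply: contra (allP fF l lfs); apply: fm; apply: setSU.
  by rewrite -E ?(allP fl) // imsetS.
have /hasP[l lfs Sl] := nsP S SF.
apply: fm (allP fN l lfs); apply: setSU.
by rewrite -E ?(allP nl) // imsetS.
Qed.

Ltac facets_tac := let S := fresh "S" in
  move=> S; rewrite !inE /= ?subsetT ?setTD ?sub_vsE ?vs_subE //= ?memnC //;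
  repeat match goal with |- context [memn ?S ?i] => case: (memn S i) => //= end.

(* The two-element non-faces form the path c - a - d - b. *)
Lemma noP4 a b c d R :
  uniq [:: a; b; c; d] -> all (mem (W :\: R)) [:: a; b; c; d] -> R \subset W ->
  f ([set:: [:: a; c]] :|: R) -> f ([set:: [:: b; d]] :|: R) -> f ([set:: [:: a; d]] :|: R) ->
  ~~ f ([set:: [:: a; b]] :|: R) -> ~~ f ([set:: [:: b; c]] :|: R) ->
  ~~ f ([set:: [:: c; d]] :|: R) -> False.
Proof.
move=> us sW RW f1 f2 f3 g1 g2 g3.
by apply: (@avoids_seq 4 _ [:: [:: 0; 1]; [:: 1; 2]; [:: 2; 3]]
  [:: [:: 0; 2]; [:: 1; 3]; [:: 0; 3]] a [:: a; b; c; d] R forbP4);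
  rewrite /= ?f1 ?f2 ?f3 ?g1 ?g2 ?g3 //; facets_tac.
Qed.

Lemma noJ1 a b c d e R :
  uniq [:: a; b; c; d; e] -> all (mem (W :\: R)) [:: a; b; c; d; e] -> R \subset W ->
  f ([set:: [:: a; c]] :|: R) -> f ([set:: [:: a; d]] :|: R) -> f ([set:: [:: b; e]] :|: R) ->
  ~~ f ([set:: [:: a; b]] :|: R) -> ~~ f ([set:: [:: a; e]] :|: R) ->
  ~~ f ([set:: [:: b; c; d]] :|: R) -> ~~ f ([set:: [:: c; d; e]] :|: R) -> False.
Proof.
move=> us sW RW f1 f2 f3 g1 g2 g3 g4.
by apply: (@avoids_seq 5 _ [:: [:: 0; 1]; [:: 0; 4]; [:: 1; 2; 3]; [:: 2; 3; 4]]
  [:: [:: 0; 2]; [:: 0; 3]; [:: 1; 4]] a [:: a; b; c; d; e] R forbJ1);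
  rewrite /= ?f1 ?f2 ?f3 ?g1 ?g2 ?g3 ?g4 //; facets_tac.
Qed.

Lemma noJ1s a b c d e R :
  uniq [:: a; b; c; d; e] -> all (mem (W :\: R)) [:: a; b; c; d; e] -> R \subset W ->
  f ([set:: [:: a; b]] :|: R) -> f ([set:: [:: a; e]] :|: R) ->
  f ([set:: [:: b; c; d]] :|: R) -> f ([set:: [:: c; d; e]] :|: R) ->
  ~~ f ([set:: [:: a; c; d]] :|: R) -> ~~ f ([set:: [:: b; c; e]] :|: R) ->
  ~~ f ([set:: [:: b; d; e]] :|: R) -> False.
Proof.
move=> us sW RW f1 f2 f3 f4 g1 g2 g3.
by apply: (@avoids_seq 5 _ [:: [:: 0; 2; 3]; [:: 1; 2; 4]; [:: 1; 3; 4]]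
  [:: [:: 0; 1]; [:: 0; 4]; [:: 1; 2; 3]; [:: 2; 3; 4]] a [:: a; b; c; d; e] R forbJ1s);
  rewrite /= ?f1 ?f2 ?f3 ?f4 ?g1 ?g2 ?g3 //; facets_tac.
Qed.

Lemma noJ2 a b c d e R :
  uniq [:: a; b; c; d; e] -> all (mem (W :\: R)) [:: a; b; c; d; e] -> R \subset W ->
  f ([set:: [:: a; c]] :|: R) -> f ([set:: [:: b; d]] :|: R) ->
  f ([set:: [:: a; b; e]] :|: R) -> f ([set:: [:: c; d; e]] :|: R) ->
  ~~ f ([set:: [:: a; b]] :|: R) -> ~~ f ([set:: [:: b; c; e]] :|: R) ->
  ~~ f ([set:: [:: c; d]] :|: R) -> ~~ f ([set:: [:: a; d; e]] :|: R) -> False.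
Proof.
move=> us sW RW f1 f2 f3 f4 g1 g2 g3 g4.
by apply: (@avoids_seq 5 _ [:: [:: 0; 1]; [:: 1; 2; 4]; [:: 2; 3]; [:: 0; 3; 4]]
  [:: [:: 0; 2]; [:: 1; 3]; [:: 0; 1; 4]; [:: 2; 3; 4]] a [:: a; b; c; d; e] R forbJ2);
  rewrite /= ?f1 ?f2 ?f3 ?f4 ?g1 ?g2 ?g3 ?g4 //; facets_tac.
Qed.

Lemma noO6 a b c d e k R :
  uniq [:: a; b; c; d; e; k] -> all (mem (W :\: R)) [:: a; b; c; d; e; k] -> R \subset W ->
  f ([set:: [:: a; b]] :|: R) -> f ([set:: [:: c; d]] :|: R) -> f ([set:: [:: e; k]] :|: R) ->
  (forall x y z, x \in [:: a; b] -> y \in [:: c; d] -> z \in [:: e; k] ->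
     ~~ f ([set:: [:: x; y; z]] :|: R)) -> False.
Proof.
move=> us sW RW f1 f2 f3 g.
by apply: (@avoids_seq 6 _ [:: [:: 0; 2; 4]; [:: 0; 2; 5]; [:: 0; 3; 4]; [:: 0; 3; 5]; [:: 1; 2; 4]; [:: 1; 2; 5]; [:: 1; 3; 4]; [:: 1; 3; 5]]
  [:: [:: 0; 1]; [:: 2; 3]; [:: 4; 5]] a [:: a; b; c; d; e; k] R forbO6);
  rewrite /= ?f1 ?f2 ?f3 ?g //= ?inE ?eqxx ?orbT //; facets_tac.
Qed.

Lemma noO6s a b c d e k R :
  uniq [:: a; b; c; d; e; k] -> all (mem (W :\: R)) [:: a; b; c; d; e; k] -> R \subset W ->
  (forall x y z, x \in [:: a; b] -> y \in [:: c; d] -> z \in [:: e; k] ->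
     f ([set:: [:: x; y; z]] :|: R)) ->
  ~~ f ([set:: [:: a; b; c; d]] :|: R) -> ~~ f ([set:: [:: c; d; e; k]] :|: R) ->
  ~~ f ([set:: [:: a; b; e; k]] :|: R) -> False.
Proof.
move=> us sW RW g f1 f2 f3.
by apply: (@avoids_seq 6 _ [:: [:: 0; 1; 2; 3]; [:: 2; 3; 4; 5]; [:: 0; 1; 4; 5]]
  [:: [:: 0; 2; 4]; [:: 0; 2; 5]; [:: 0; 3; 4]; [:: 0; 3; 5]; [:: 1; 2; 4]; [:: 1; 2; 5]; [:: 1; 3; 4]; [:: 1; 3; 5]]
  a [:: a; b; c; d; e; k] R forbO6s);
  rewrite /= ?f1 ?f2 ?f3 ?g //= ?inE ?eqxx ?orbT //; facets_tac.
Qed.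

(** In the link of [R], the set [Q] spans the boundary of a simplex and [v] is the extra point. The
    dimension is arbitrary, so the index lists are treated symbolically instead of by
    [facets_tac]. *)
Lemma noBd (Q R : {set T}) v :
  1 < #|Q| -> v \notin Q -> v \in W :\: R -> Q \subset W :\: R -> R \subset W ->
  f (Q :|: R) -> (forall q, q \in Q -> f ([set q; v] :|: R)) -> ~~ f (v |: R) ->
  (forall q, q \in Q -> ~~ f (Q :\ q :|: R)) -> False.
Proof.
move=> Q1 vQ vW QW RW fQ fq fv fQq.
have [n [n1 cQ]] : exists n, 1 <= n /\ #|Q| = n.+1.
  by exists (#|Q|.-1); case: #|Q| Q1 => [|[|]].
(* The extra point of [bdry_plus_pt n] is its last vertex, so [v] closes the enumeration. *)
set s := rcons (enum Q) v.
have ss : size s = n.+2 by rewrite size_rcons -cardE cQ.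
have nQ k : k <= n -> nth v s k \in Q.
  by move=> kn; rewrite nth_rcons -cardE cQ ltnS kn -mem_enum mem_nth // -cardE cQ ltnS.
have us : uniq s by rewrite rcons_uniq mem_enum vQ enum_uniq.
have nv : nth v s n.+1 = v by rewrite nth_rcons -cardE cQ ltnn eqxx.
apply: (@avoids_seq n.+2 _
  ([:: n.+1] :: [seq [seq j <- iota 0 n.+1 | j != k] | k <- iota 0 n.+1])
  (iota 0 n.+1 :: [seq [:: k; n.+1] | k <- iota 0 n.+1]) v s R (forbBd n1)) => //.
- move=> S; rewrite !inE => SF; apply/hasP.
  (* A non-face with the extra point contains an edge to it; a non-face without it is the whole
     simplex. *)
  case: (boolP (ord_max \in S)) => vS.
    have [k kS kn] : exists2 k, k \in S & k != ord_max.
      apply/exists_inP; apply: contraNT SF => /exists_inPn H; apply/orP; right; apply/orP; right.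
      apply/eqP/setP=> k; rewrite !inE; apply/idP/eqP => [/H|E].
        by rewrite negbK => /eqP->.
      by rewrite (_ : k = ord_max) //; apply: val_inj.
    exists [:: val k; n.+1].
      rewrite in_cons; apply/orP; right; apply/mapP; exists (val k) => //.
      rewrite mem_iota /= add0n ltn_neqAle -[_ <= _]ltnS ltn_ord andbT.
      by apply: contra kn => /eqP E; apply/eqP/val_inj.
    apply/subsetP=> j; rewrite !inE => /orP[]/eqP E.
      by rewrite (val_inj E).
    by rewrite (_ : j = ord_max) //; apply: val_inj.
  exists (iota 0 n.+1); first by rewrite mem_head.
  case: (S =P vs n.+2 (iota 0 n.+1)) SF => [->//|_]; rewrite andbT.
  case/norP => /negP[]; apply/subsetP=> j jS; rewrite inE mem_iota /= add0n.
  rewrite ltn_neqAle -[_ <= _]ltnS ltn_ord andbT.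
  by apply: contraNneq vS => E; rewrite (_ : ord_max = j) //; apply: val_inj.
- move=> S; rewrite !inE => /or3P[/andP[Ss Sn]|/eqP->|/eqP->].
  + have [k kv kS] : exists2 k, k \in vs n.+2 (iota 0 n.+1) & k \notin S.
      by apply/subsetPn; apply: contra Sn => H; rewrite eqEsubset Ss.
    apply/hasP; exists [seq j <- iota 0 n.+1 | j != val k].
      rewrite in_cons; apply/orP; right.
      by apply/mapP; exists (val k) => //; move: kv; rewrite inE.
    apply/subsetP=> j jS; rewrite inE mem_filter; have := subsetP Ss _ jS; rewrite inE => ->.
    by rewrite andbT; apply: contraNneq kS => /val_inj <-.
  + by apply/hasP; exists [:: n.+1]; rewrite ?mem_head ?sub0set.
  + by apply/hasP; exists [:: n.+1]; rewrite ?mem_head.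
- have mI k : (k \in iota 0 n.+1) = (k < n.+1) by rewrite mem_iota.
  move: (iota 0 n.+1) mI => I mI; apply/allP=> l; rewrite mem_cat !in_cons.
  case/orP=> [/orP[/eqP->|/mapP[k _ ->]]|/orP[/eqP->|/mapP[k]]].
  + by rewrite /= ltnSn.
  + by apply/allP=> j; rewrite mem_filter mI => /andP[_ /leq_trans]; apply.
  + by apply/allP=> j; rewrite mI => /leq_trans; apply.
  + by rewrite mI => kn ->; rewrite /= ltnSn !andbT (leq_trans kn).
- rewrite all_rcons /= vW; apply/allP=> q; rewrite mem_enum; exact: subsetP.
- apply/allP=> l; rewrite in_cons => /orP[/eqP->|].
    apply: fm fQ; apply: setSU; apply/subsetP=> q qQ; rewrite inE.
    apply/mapP; exists (index q s); last by rewrite nth_index // mem_rcons inE mem_enum qQ orbT.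
    rewrite mem_iota /= add0n /s -cats1 index_cat mem_enum qQ.
    by rewrite -cQ cardE index_mem mem_enum.
  case/mapP=> k; rewrite mem_iota /= add0n ltnS => kn ->.
  by apply: fm (fq _ (nQ _ kn)); apply: setSU; apply/subsetP=> q; rewrite !inE /= nv.
- have mI k : (k \in iota 0 n.+1) = (k < n.+1) by rewrite mem_iota.
  move: (iota 0 n.+1) mI => I mI; apply/allP=> l; rewrite in_cons => /orP[/eqP->|].
    by apply: contra fv; apply: fm; apply: setSU; apply/subsetP=> q; rewrite !inE /= nv.
  case/mapP=> k; rewrite mI ltnS => kn ->.
  apply: contra (fQq _ (nQ _ kn)); apply: fm; apply: setSU; apply/subsetP=> q; rewrite !inE.
  case/mapP=> j; rewrite mem_filter mI ltnS => /andP[jk jn] ->.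
  by rewrite nQ // andbT nth_uniq // ss !ltnS ?(leq_trans jn) ?(leq_trans kn).
Qed.

(** Three isolated points are the boundary of an edge together with a point: the case of [noBd] in
    which [Q] has two elements. *)
Lemma noTri a b c R :
  uniq [:: a; b; c] -> all (mem (W :\: R)) [:: a; b; c] -> R \subset W ->
  f ([set:: [:: a; b]] :|: R) -> f ([set:: [:: b; c]] :|: R) -> f ([set:: [:: a; c]] :|: R) ->
  ~~ f ([set:: [:: a]] :|: R) -> ~~ f ([set:: [:: b]] :|: R) ->
  ~~ f ([set:: [:: c]] :|: R) -> False.
Proof.
rewrite /= !inE !negb_or !andbT => /andP[/andP[ab ac] bc] /and3P[/andP[aR aW] /andP[bR bW] /andP[cR cW]].
move=> RW fab fbc fac fa fb fc.
apply: (@noBd [set a; b] R c); rewrite ?cards2 ?ab // ?inE ?negb_or ?[c == _]eq_sym ?ac ?bc ?cR //.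
- by apply/subsetP=> x; rewrite !inE => /orP[]/eqP->; apply/andP.
- by apply: fm fab; apply: setSU; apply/subsetP=> x; rewrite !inE.
- move=> q; rewrite !inE => /orP[]/eqP->; [apply: fm fac|apply: fm fbc];
    by apply: setSU; apply/subsetP=> x; rewrite !inE.
- by apply: contra fc; apply: fm; apply: setSU; apply/subsetP=> x; rewrite !inE.
- move=> q; rewrite !inE => /orP[]/eqP->; [apply: contra fb|apply: contra fa];
    apply: fm; apply: setSU; apply/subsetP=> x; rewrite !inE;
    by case/andP=> /negbTE->; rewrite ?orbF.
Qed.
End Patterns.

(** * Critical functions *)

(** Blocks of size one are left out on purpose: a one-element [X] makes its element a ghost under
    [andf] and a Lawrence vertex under [orf]. *)
Definition base (T : finType) (X Y W : {set T}) : Prop :=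
  [/\ X \subset W, Y \subset W, [disjoint X & Y], 1 < #|X| & 1 < #|Y|].

(** Non-faces of a cone over D_{m,n} whose minimal non-faces are [X] and [Y]; [orf] gives those of a
    cone over the disjoint union of the simplices on [X] and [Y]. Vertices outside both blocks are
    the apexes. *)
Definition andf (T : finType) (X Y S : {set T}) : bool := (X \subset S) || (Y \subset S).
Definition orf (T : finType) (X Y S : {set T}) : bool :=
  ~~ [disjoint X & S] && ~~ [disjoint Y & S].

(** One step of the nuclear recursion: [kGhost] and [kLaw] say nothing about what remains after
    removing [x]; that is left to the induction in [avoids_nuclear]. *)
Inductive kind (T : finType) (f : {set T} -> bool) (W : {set T}) : Prop :=
| kFace of f W = false
| kVoid of f set0
| kGhost x of x \in W & f [set x]
| kLaw x of x \in W & f (W :\ x) = false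
| kAnd X Y of base X Y W & (forall S : {set T}, S \subset W -> f S = andf X Y S)
| kOr X Y of base X Y W & (forall S : {set T}, S \subset W -> f S = orf X Y S).

Lemma kind_ext (T : finType) (f g : {set T} -> bool) (W : {set T}) :
  (forall S, f S = g S) -> kind f W -> kind g W.
Proof.
move=> E [H|H|x xW H|x xW H|X Y b H|X Y b H].
- by apply: kFace; rewrite -E.
- by apply: kVoid; rewrite -E.
- by apply: (kGhost xW); rewrite -E.
- by apply: (kLaw xW); rewrite -E.
- by apply: (kAnd b) => S SW; rewrite -E H.
- by apply: (kOr b) => S SW; rewrite -E H.
Qed.

Lemma base_sym (T : finType) (X Y W : {set T}) : base X Y W -> base Y X W.
Proof. by case=> *; split; rewrite // disjoint_sym. Qed.
Lemma andf_sym (T : finType) (X Y S : {set T}) : andf X Y S = andf Y X S.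
Proof. exact: orbC. Qed.
Lemma orf_sym (T : finType) (X Y S : {set T}) : orf X Y S = orf Y X S.
Proof. exact: andbC. Qed.

Lemma card_other (T : finType) (X : {set T}) x : 1 < #|X| -> exists2 y, y \in X & y != x.
Proof.
case/card_gt1P=> y [z [yX zX yz]]; case: (eqVneq y x) => [e|n]; last by exists y.
by exists z; rewrite // eq_sym -e.
Qed.

Lemma meetsP (T : finType) (X S : {set T}) x : x \in X -> x \in S -> ~~ [disjoint X & S].
Proof. by move=> xX xS; apply/negP=> d; rewrite (disjointFr d xX) in xS. Qed.

Lemma nmeetsP (T : finType) (X S : {set T}) : (forall u, u \in X -> u \in S = false) -> [disjoint X & S].
Proof. by move=> H; rewrite disjoint_subset; apply/subsetP=> u /H; rewrite inE => ->. Qed.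

Lemma meetsE (T : finType) (X S : {set T}) : ~~ [disjoint X & S] -> exists2 x, x \in X & x \in S.
Proof.
rewrite disjoint_subset => /subsetPn[x xX]; rewrite !inE negbK => xS; by exists x.
Qed.

(** * Automation for membership, inclusion and evaluation of shapes *)

Ltac known P := match goal with _ : P |- _ => idtac end.
Ltac fresh_fact P tac := tryif known P then fail else (have ? : P by tac).
Ltac sat := repeat match goal with
 | H : is_true (?X \subset ?Y), H1 : is_true (?u \in ?X) |- _ =>
   fresh_fact (is_true (u \in Y)) ltac:(exact: (subsetP H))
 | H : is_true (?X \subset ?Y), H1 : (?u \in ?Y) = false |- _ =>
   fresh_fact ((u \in X) = false) ltac:(exact: (contraFF (subsetP H u) H1))
 | H : is_true [disjoint ?X & ?Y], H1 : is_true (?u \in ?X) |- _ =>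
   fresh_fact ((u \in Y) = false) ltac:(exact: (disjointFr H H1))
 | H : is_true [disjoint ?X & ?Y], H1 : is_true (?u \in ?Y) |- _ =>
   fresh_fact ((u \in X) = false) ltac:(exact: (disjointFl H H1))
 | H : is_true (?x \notin ?X) |- _ => fresh_fact ((x \in X) = false) ltac:(exact/negbTE)
 end.
Lemma mem_neq (T : finType) (X : {set T}) x y : x \in X -> (y \in X) = false -> (x == y) = false.
Proof. by move=> xX yX; apply/eqP=> e; rewrite e yX in xX. Qed.
Lemma mem_neq' (T : finType) (X : {set T}) x y : (x \in X) = false -> y \in X -> (x == y) = false.
Proof. by move=> xX yX; apply/eqP=> e; rewrite e yX in xX. Qed.

Ltac contra_done := match goal with
  | H : is_true ?b, H' : ?b = false |- _ => by rewrite H' in H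
  end.
Ltac bcase := sat; try contra_done; repeat (match goal with
  | |- context [?x == ?x] => rewrite eqxx /=
  | H : is_true ?b |- context [?b] => rewrite H /=
  | H : ?b = false |- context [?b] => rewrite H /=
  | H : is_true (?x \in ?X), H' : (?y \in ?X) = false |- context [?x == ?y] =>
      rewrite (mem_neq H H') /=
  | H : is_true (?y \in ?X), H' : (?x \in ?X) = false |- context [?x == ?y] =>
      rewrite (mem_neq' H' H) /=
  | H : is_true (?x != ?y) |- context [?x == ?y] => rewrite (negbTE H) /=
  | H : is_true (?x != ?y) |- context [?y == ?x] => rewrite [y == x]eq_sym (negbTE H) /=
  | |- context [?x == ?y] => let e := fresh in case: (x =P y) => [e|_] /=;
      [ try subst x; try subst y; try contra_done | ]
  | |- context [?x \in ?X] => let E := fresh "E" in case: (boolP (x \in X)) => [E|/negbTE E] /=; sat; try contra_done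
  end); try done.
Ltac bsolve := rewrite /= ?inE /= ?inE; bcase.
Ltac usolve := let u := fresh "u" in let uH := fresh "uH" in
  apply/subsetP => u; apply/implyP; bsolve.

(** Vocabulary of the case proofs: [fval H] replaces a value of [f] by a shape. The shape is then
    shown true by containing the first or second block ([andl], [andr]) or by meeting both at [x]
    and [y] ([orp x y]), and false by omitting [x] and [y] ([nand x y]) or by missing a whole block
    ([norl], [norr]). *)
Ltac fval H := rewrite H; [ | by usolve | by bsolve].
Ltac andl := apply/orP; left; usolve.
Ltac andr := apply/orP; right; usolve.
Ltac nand x y := rewrite /andf negb_or; apply/andP; split; apply/subsetPn;
  [exists x; bsolve | exists y; bsolve].
Ltac orp x y := apply/andP; split; [apply: (@meetsP _ _ _ x); bsolve | apply: (@meetsP _ _ _ y); bsolve].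
Ltac nmeets := let u := fresh "u" in let uX := fresh "uX" in
  apply: nmeetsP => u uX; apply/negbTE; bsolve.
Ltac norl := rewrite /orf negb_and negbK; apply/orP; left; nmeets.
Ltac norr := rewrite /orf negb_and !negbK; apply/orP; right; nmeets.

(** Whatever of [W] lies outside [W'] and [R] is deleted; with [W' = W :\ z], the choices [R = set0]
    and [R = [set z]] are the deletion and the link of [z]. *)
Record critical (T : finType) (f : {set T} -> bool) (W : {set T}) : Prop := Critical {
  crit_mono : mono f;
  crit_avoids : avoids f W;
  crit_not : ~ kind f W;
  crit_minor : forall W' R : {set T}, W' \proper W -> R \subset W -> [disjoint W' & R] ->
    kind (fun S => f (S :|: R)) W' }.

Section Critical.
Variables (T : finType) (f : {set T} -> bool) (W : {set T}).
Hypothesis C : critical f W.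

Lemma crit_set0 : f set0 = false.
Proof. by apply/negbTE/negP=> H; apply: (crit_not C); apply: kVoid. Qed.
Lemma crit_set1 x : x \in W -> f [set x] = false.
Proof. by move=> xW; apply/negbTE/negP=> H; apply: (crit_not C); apply: kGhost H. Qed.
Lemma crit_setT : f W.
Proof. by apply/negPn/negP=> /negbTE H; apply: (crit_not C); apply: kFace. Qed.
Lemma crit_setD1 x : x \in W -> f (W :\ x).
Proof. by move=> xW; apply/negPn/negP=> /negbTE H; apply: (crit_not C); apply: kLaw xW H. Qed.

Inductive delcase (z : T) : Prop :=
| dLaw w of w \in W & w != z & (forall S : {set T}, S \subset W -> z \notin S -> w \notin S -> f S = false)
| dAnd X Y of base X Y W & (z \in X) = false & (z \in Y) = false &
    (forall S : {set T}, S \subset W -> z \notin S -> f S = andf X Y S)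
| dOr X Y of base X Y W & (z \in X) = false & (z \in Y) = false &
    (forall S : {set T}, S \subset W -> z \notin S -> f S = orf X Y S).

Inductive linkcase (z : T) : Prop :=
| lGhost x of x \in W & x != z & f [set x; z]
| lAnd X Y of base X Y W & (z \in X) = false & (z \in Y) = false &
    (forall S : {set T}, S \subset W -> z \in S -> f S = andf X Y S)
| lOr X Y of base X Y W & (z \in X) = false & (z \in Y) = false &
    (forall S : {set T}, S \subset W -> z \in S -> f S = orf X Y S).

Lemma baseD1 X Y z : base X Y (W :\ z) -> [/\ base X Y W, (z \in X) = false & (z \in Y) = false].
Proof.
case=> XW YW d cX cY; split.
- by split=> //; rewrite ?(subset_trans XW) ?(subset_trans YW) ?subD1set.
- by apply/negbTE/negP=> /(subsetP XW); rewrite !inE eqxx.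
- by apply/negbTE/negP=> /(subsetP YW); rewrite !inE eqxx.
Qed.

(** A deletion that is a simplex would make [z] a Lawrence vertex of [f]; a void deletion or a ghost
    in it would already be one for [f]. *)
Lemma del_cases z : z \in W -> delcase z.
Proof.
move=> zW; have d0 : [disjoint W :\ z & set0] by apply: nmeetsP => u _; rewrite inE.
have k0 := crit_minor C (properD1 zW) (sub0set W) d0.
have {k0} : kind f (W :\ z) by apply: kind_ext k0 => S; rewrite setU0.
case=> [H|H|x xW H|w wW H|X Y b H|X Y b H].
- by rewrite crit_setD1 in H.
- by rewrite crit_set0 in H.
- by move: xW H; rewrite !inE => /andP[_ xW]; rewrite crit_set1.
- move: wW; rewrite !inE => /andP[wz wW]; apply: (@dLaw _ w) => // S SW zS wS.
  by apply: contraFF H; apply: (crit_mono C); rewrite !subsetD1 SW zS.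
- have [b' zX zY] := baseD1 b; apply: (@dAnd _ X Y) => // S SW zS; apply: H; rewrite subsetD1 SW //.
- have [b' zX zY] := baseD1 b; apply: (@dOr _ X Y) => // S SW zS; apply: H; rewrite subsetD1 SW //.
Qed.

Lemma disjointD1 (X S : {set T}) z : (z \in X) = false -> [disjoint X & S :\ z] = [disjoint X & S].
Proof.
move=> zX; apply/idP/idP=> d; apply: nmeetsP => u uX; have := disjointFr d uX; rewrite !inE.
  by case: (u =P z) => [e|_ /= ->//]; rewrite e zX in uX.
by move->; rewrite andbF.
Qed.

(** A Lawrence vertex [w] of the link would be one of [f], since both say that [W :\ w] is a face.
    Unlike for deletions, a ghost of the link survives as a case: it is an edge at [z]. *)
Lemma link_cases z : z \in W -> linkcase z.
Proof.
move=> zW; have d1 : [disjoint W :\ z & [set z]] by apply: nmeetsP => u; rewrite !inE => /andP[/negbTE].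
have zW1 : [set z] \subset W by rewrite sub1set.
have := crit_minor C (properD1 zW) zW1 d1.
have E (S : {set T}) : S \subset W -> z \in S -> f S = f (S :\ z :|: [set z]) by move=> _ zS; rewrite setUC setD1K.
case=> [H|H|x xW H|w wW H|X Y b H|X Y b H].
- by move: H; rewrite setUC setD1K // crit_setT.
- by move: H; rewrite set0U crit_set1.
- by move: xW; rewrite !inE => /andP[xz xW]; apply: (@lGhost _ x).
- move: wW H; rewrite !inE => /andP[wz wW].
  rewrite (_ : _ :|: _ = W :\ w) ?crit_setD1 //; apply/setP=> u; rewrite !inE.
  by case: (u =P z) => [->|]; rewrite ?orbT ?orbF /= ?zW // eq_sym wz.
- have [b' zX zY] := baseD1 b; apply: (@lAnd _ X Y) => // S SW zS.
  rewrite E // H ?setSD // /andf !subsetD1 zX zY !andbT //.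
- have [b' zX zY] := baseD1 b; apply: (@lOr _ X Y) => // S SW zS.
  rewrite E // H ?setSD // /orf; congr (~~ _ && ~~ _).
    by rewrite disjointD1.
  by rewrite disjointD1.
Qed.

Lemma base_two X Y : base X Y W -> exists x x' y y',
  [/\ x \in X, x' \in X, y \in Y, y' \in Y & (x' != x) && (y' != y)].
Proof.
case=> _ _ _ /card_gt1P[x [x' [xX xX' xx]]] /card_gt1P[y [y' [yY yY' yy]]].
by exists x', x, y', y; rewrite xx yy.
Qed.

Lemma subU1 (X S : {set T}) z : (z \in X) = false -> (X \subset z |: S) = (X \subset S).
Proof.
move=> zX; apply/idP/idP=> H; last exact: subset_trans H (subsetUr _ _).
by apply/subsetP=> u uX; have := subsetP H u uX; rewrite !inE; bcase.
Qed.

(** Contracting all of [X] and [Y0] except [x], [x'], [y], [y0] leaves the minimal non-faces {y, z},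
    {y, y0}, {x, x'}, which are those of J_1. *)
Lemma and_and_left z X Y Y0 : z \in W ->
  base X Y W -> (z \in X) = false -> (z \in Y) = false ->
  (forall S : {set T}, S \subset W -> z \in S -> f S = andf X Y S) ->
  base X Y0 W -> (z \in Y0) = false ->
  (forall S : {set T}, S \subset W -> z \notin S -> f S = andf X Y0 S) ->
  Y \subset Y0 -> Y0 != Y -> False.
Proof.
move=> zW b zX zY f1 b0 zY0 f0 YY NY.
have [x [x' [y [y' [xX x'X yY y'Y /andP[xx yy]]]]]] := base_two b.
have [y0 y0Y y0Y'] : exists2 y0, y0 \in Y0 & y0 \notin Y.
  by apply/subsetPn; apply: contra NY => H; rewrite eqEsubset H.
case: b => XW YW d _ _; case: b0 => _ Y0W d0 _ _.
apply: (@noJ1 T f W (crit_mono C) (crit_avoids C) y x z y0 x' ((X :|: Y0) :\: [set:: [:: y; x; z; y0; x']])).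
- by bsolve.
- by bsolve.
- by usolve.
- by fval f1; andr.
- by fval f0; andr.
- by fval f0; andl.
- by fval f0; nand x' y0.
- by fval f0; nand x y0.
- by fval f1; nand x' y.
- by fval f1; nand x y.
Qed.

(** Up to exchange, the blocks of the link lie inside those of the deletion. If both pairs agree,
    [z] is just an apex; one strict inclusion gives J_1, two give P_4. *)
Lemma and_and z X Y X0 Y0 : z \in W ->
  base X Y W -> (z \in X) = false -> (z \in Y) = false ->
  (forall S : {set T}, S \subset W -> z \in S -> f S = andf X Y S) ->
  base X0 Y0 W -> (z \in X0) = false -> (z \in Y0) = false ->
  (forall S : {set T}, S \subset W -> z \notin S -> f S = andf X0 Y0 S) -> False.
Proof.
move=> zW b zX zY f1 b0 zX0 zY0 f0.
have key (A : {set T}) : A \subset W -> z \in A = false -> f A -> andf X Y A.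
  move=> AW zA fA; have : f (z |: A) by apply: (crit_mono C (subsetUr [set z] A)).
  by rewrite f1 ?setU11 ?subUset ?sub1set ?zW // /andf !subU1.
case: (b0) => X0W Y0W d0 _ _; case: (b) => XW YW d _ _.
wlog XX : X Y b zX zY f1 key XW YW d / X \subset X0.
  move=> hw; have /orP[H|H] : andf X Y X0 by apply: key; rewrite ?f0 ?zX0 // /andf subxx.
    exact: (hw X Y).
  apply: (hw Y X) => //; [exact: base_sym| | |by rewrite disjoint_sym].
    by move=> S SW zS; rewrite andf_sym f1.
  by move=> A AW zA fA; rewrite andf_sym key.
have [x [x' [y [y' [xX x'X yY y'Y /andP[xx yy]]]]]] := base_two b.
have YY : Y \subset Y0.
  have /orP[H|//] : andf X Y Y0 by apply: key; rewrite ?f0 ?zY0 // /andf subxx orbT.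
  sat.
  contra_done.
have [EY|NY] := eqVneq Y0 Y; have [EX|NX] := eqVneq X0 X; first 1 last.
- apply: (@and_and_left z Y X X0) => //; rewrite -?EY //; try exact: base_sym.
  by rewrite EY; exact: base_sym.
  by move=> S SW zS; rewrite andf_sym EY f1.
  by move=> S SW zS; rewrite andf_sym f0.
- by apply: (@and_and_left z X Y Y0) => //; rewrite -?EX.
- have [x0 x0X x0X'] : exists2 x0, x0 \in X0 & x0 \notin X.
    by apply/subsetPn; apply: contra NX => H; rewrite eqEsubset H.
  have [y0 y0Y y0Y'] : exists2 y0, y0 \in Y0 & y0 \notin Y.
    by apply/subsetPn; apply: contra NY => H; rewrite eqEsubset H.
  (* The element [y0] is deleted and not contracted, so [Y0] is never contained while [Y] still can
     be. *)
  apply: (@noP4 T f W (crit_mono C) (crit_avoids C) x y x0 z ((X0 :|: Y0) :\: [set:: [:: x; y; x0; z; y0]])).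
  + by bsolve.
  + by bsolve.
  + by usolve.
  + by fval f0; andl.
  + by fval f1; andr.
  + by fval f1; andl.
  + by fval f0; nand x0 y0.
  + by fval f0; nand x y0.
  + by fval f1; nand x y.
- apply: (crit_not C); apply: (kAnd b) => S SW; case: (boolP (z \in S)) => zS; first exact: f1.
  by rewrite f0 // EX EY.
Qed.
End Critical.

Lemma andfU1 (T : finType) (X Y S : {set T}) z :
  (z \in X) = false -> (z \in Y) = false -> andf X Y (z |: S) = andf X Y S.
Proof. by move=> zX zY; rewrite /andf !subU1. Qed.

Lemma orfU1 (T : finType) (X Y S : {set T}) z :
  (z \in X) = false -> (z \in Y) = false -> orf X Y (z |: S) = orf X Y S.
Proof.
have E (Z : {set T}) : (z \in Z) = false -> [disjoint Z & z |: S] = [disjoint Z & S].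
  by move=> zZ; rewrite -(disjointD1 (z |: S) zZ) setDUl setDv set0U disjointD1.
by move=> zX zY; rewrite /orf !E.
Qed.

Ltac fvalL H := rewrite H; [ done | by usolve | by bsolve | by bsolve].

(** * Comparing the shapes of the deletion and the link of a vertex *)

Section VertexCases.
Variables (T : finType) (f : {set T} -> bool) (W : {set T}).
Hypothesis C : critical f W.
Local Notation fm := (crit_mono C).
Local Notation av := (crit_avoids C).

Lemma crit_addz z (A : {set T}) : f A -> f (z |: A).
Proof. exact: (crit_mono C (subsetUr [set z] A)). Qed.

Lemma sub_pair (X : {set T}) a b : 1 < #|X| -> X \subset [set a; b] -> (a \in X) && (b \in X).
Proof.
move=> cX Xs.
have [x xX xa] := card_other a cX; have [y yX yb] := card_other b cX.
have := subsetP Xs _ xX; have := subsetP Xs _ yX; rewrite !inE (negbTE xa) (negbTE yb) orbF /=.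
by move=> /eqP<- /eqP<-; rewrite xX yX.
Qed.

(** A contradiction by counting alone: each cross pair of [A] and [B] is a non-face of the link,
    hence contains [X] or [Y], each of size at least two. The pairs {a, c} and {a, c'} would then be
    the two blocks, which are disjoint. *)
Lemma and_or z X Y A B : z \in W ->
  base X Y W -> (z \in X) = false -> (z \in Y) = false ->
  (forall S : {set T}, S \subset W -> z \in S -> f S = andf X Y S) ->
  base A B W -> (z \in A) = false -> (z \in B) = false ->
  (forall S : {set T}, S \subset W -> z \notin S -> f S = orf A B S) -> False.
Proof.
move=> zW b zX zY f1 b0 zA zB f0.
have [a [a' [c [c' [aA a'A cB c'B /andP[aa cc]]]]]] := base_two b0.
case: b0 => AW BW d0 _ _.
have key p q : p \in A -> q \in B -> andf X Y [set p; q].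
  move=> pA qB; have fpq : f [set p; q].
    by fval f0; orp p q.
  by have := crit_addz z fpq; fval f1; rewrite (andfU1 _ zX zY).
wlog XX : X Y b zX zY f1 key / X \subset [set a; c].
  move=> hw; have /orP[H|H] := key _ _ aA cB; first exact: (hw X Y).
  apply: (hw Y X) => //; first exact: base_sym.
    by move=> S SW zS; rewrite andf_sym f1.
  by move=> p q pA qB; rewrite andf_sym key.
case: b => XW YW d cX cY; have /andP[aX cX'] := sub_pair cX XX.
have /orP[H|H] := key _ _ aA c'B.
  by have := subsetP H _ cX'; bsolve.
have /andP[aY _] := sub_pair cY H; sat; contra_done.
Qed.

(** With [y] in [Y] but not in [B], the pairs {c, x}, {c, x'} and the triples {x, y, z}, {x', y, z}
    are the minimal non-faces of J_1^*. *)
Lemma or_or_left z X Y B : z \in W ->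
  base X Y W -> (z \in X) = false -> (z \in Y) = false ->
  (forall S : {set T}, S \subset W -> z \in S -> f S = orf X Y S) ->
  base X B W -> (z \in B) = false ->
  (forall S : {set T}, S \subset W -> z \notin S -> f S = orf X B S) ->
  B \subset Y -> B != Y -> False.
Proof.
move=> zW b zX zY f1 b0 zB f0 BY NY.
have [x [x' [c [c' [xX x'X cB c'B /andP[xx cc]]]]]] := base_two b0.
have [y yY yB] : exists2 y, y \in Y & y \notin B.
  by apply/subsetPn; apply: contra NY => H; rewrite eqEsubset H BY.
case: b => XW YW d _ _; case: b0 => _ BW d0 _ _.
apply: (@noJ1s T f W fm av c x z y x' set0).
- by bsolve.
- by bsolve.
- by usolve.
- by fval f0; orp x c.
- by fval f0; orp x' c.
- by fval f1; orp x y.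
- by fval f1; orp x' y.
- by fval f1; norl.
- by fval f1; norr.
- by fval f0; norr.
Qed.

(** The complement of a block of the link is a face of the link, hence, without [z], a face of the
    deletion; so it misses [A] or [B], and each block of the link contains a block of the
    deletion. *)
Lemma or_or z X Y A B : z \in W ->
  base X Y W -> (z \in X) = false -> (z \in Y) = false ->
  (forall S : {set T}, S \subset W -> z \in S -> f S = orf X Y S) ->
  base A B W -> (z \in A) = false -> (z \in B) = false ->
  (forall S : {set T}, S \subset W -> z \notin S -> f S = orf A B S) -> False.
Proof.
move=> zW b zX zY f1 b0 zA zB f0.
have key (X' Y' : {set T}) : base X' Y' W -> (z \in X') = false ->
    (forall S : {set T}, S \subset W -> z \in S -> f S = orf X' Y' S) ->
    (A \subset X') || (B \subset X').
  move=> b' zX' f1'; have fS : f (z |: (W :\: X' :\ z)) = false.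
    by apply/negbTE; fval f1'; norl.
  have : ~~ f (W :\: X' :\ z) by apply/negP=> /(crit_addz z); rewrite fS.
  case: b0 => AW BW _ _ _; fval f0; rewrite /orf negb_and !negbK => /orP[] d; apply/orP; [left|right];
    apply/subsetP=> u uA; have := disjointFr d uA; rewrite !inE; bcase.
case: (b0) => AW BW d0 cA cB; case: (b) => XW YW d _ _.
wlog XX : A B b0 zA zB f0 key AW BW d0 cA cB / A \subset X.
  move=> hw; have /orP[H|H] := key X Y b zX f1; first exact: (hw A B).
  apply: (hw B A) => //; [exact: base_sym| | |by rewrite disjoint_sym].
    by move=> S SW zS; rewrite orf_sym f0.
  by move=> X' Y' b' zX' f1'; rewrite orbC (key X' Y').
have [a [a' [c [c' [aA a'A cB' c'B /andP[aa cc]]]]]] := base_two b0.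
have YY : B \subset Y.
  have /orP[H|//] : (A \subset Y) || (B \subset Y).
    apply: (key Y X) => //; first exact: base_sym.
    by move=> S SW zS; rewrite orf_sym f1.
  by sat; contra_done.
have [EY|NY] := eqVneq B Y; have [EX|NX] := eqVneq A X; first 1 last.
- apply: (@or_or_left z Y X A) => //; rewrite -?EY //; try exact: base_sym.
  by rewrite EY; exact: base_sym.
  by move=> S SW zS; rewrite orf_sym EY f1.
  by move=> S SW zS; rewrite orf_sym f0.
- by apply: (@or_or_left z X Y B) => //; rewrite -?EX.
- have [x xX xA] : exists2 x, x \in X & x \notin A.
    by apply/subsetPn; apply: contra NX => H; rewrite eqEsubset H XX.
  have [y yY yB] : exists2 y, y \in Y & y \notin B.
    by apply/subsetPn; apply: contra NY => H; rewrite eqEsubset H YY.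
  (* Contracting [x] meets [X] for free but not [A]; the remaining edges are a c, c z, z y. *)
  apply: (@noP4 T f W fm av c y a z [set x]).
  + by bsolve.
  + by bsolve.
  + by usolve.
  + by fval f0; orp a c.
  + by fval f1; orp x y.
  + by fval f1; orp x c.
  + by fval f0; norl.
  + by fval f0; norr.
  + by fval f1; norr.
- apply: (crit_not C); apply: (kOr b) => S SW; case: (boolP (z \in S)) => zS; first exact: f1.
  by rewrite f0 // EX EY.
Qed.

(** The non-face [X0] of the deletion must meet [X]. If they shared two points, [X :&: X0] would
    carry the boundary of a simplex, with [z] as isolated point. *)
Lemma or_and_single z X Y X0 Y0 : z \in W ->
  base X Y W -> (z \in X) = false -> (z \in Y) = false ->
  (forall S : {set T}, S \subset W -> z \in S -> f S = orf X Y S) ->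
  base X0 Y0 W -> (z \in X0) = false -> (z \in Y0) = false ->
  (forall S : {set T}, S \subset W -> z \notin S -> f S = andf X0 Y0 S) ->
  exists a, [/\ a \in X, a \in X0 & forall u, u \in X -> (u \in X0) = (u == a)].
Proof.
move=> zW b zX zY f1 b0 zX0 zY0 f0.
case: (b0) => X0W Y0W d0 c0 c0'; case: (b) => XW YW d _ _.
have key (A : {set T}) : A \subset W -> z \in A = false -> f A -> orf X Y A.
  move=> AW zA /(crit_addz z); fval f1.
  by rewrite (orfU1 _ zX zY).
have /andP[/meetsE[a aX aX0] _] : orf X Y X0.
  by apply: key; rewrite ?f0 ?zX0 // /andf subxx.
have /andP[_ /meetsE[y yY yY0]] : orf X Y Y0.
  by apply: key; rewrite ?f0 ?zY0 // /andf subxx orbT.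
exists a; split=> // u uX; apply/idP/eqP => [uX0|->//]; apply/eqP/negPn/negP=> ua.
(* The contracted [y] meets [Y], so only [X] remains to be met in the link; [Y0], having a second
   element, stays uncontained. *)
apply: (@noBd T f W fm av (X :&: X0) (X0 :\: X :|: [set y]) z).
- by apply/card_gt1P; exists u, a; rewrite !inE ua uX uX0 aX aX0.
- by bsolve.
- by bsolve.
- by usolve.
- by usolve.
- by fval f0; andl.
- move=> q; rewrite inE => /andP[qX qX0].
  by fval f1; orp q y.
- by fval f1; norl.
- move=> q; rewrite inE => /andP[qX qX0].
  have [v vY0 vy] := card_other y c0'.
  by fval f0; nand q v.
Qed.

Lemma or_and z X Y X0 Y0 : z \in W ->
  base X Y W -> (z \in X) = false -> (z \in Y) = false ->
  (forall S : {set T}, S \subset W -> z \in S -> f S = orf X Y S) ->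
  base X0 Y0 W -> (z \in X0) = false -> (z \in Y0) = false ->
  (forall S : {set T}, S \subset W -> z \notin S -> f S = andf X0 Y0 S) -> False.
Proof.
move=> zW b zX zY f1 b0 zX0 zY0 f0.
have f1' (S : {set T}) : S \subset W -> z \in S -> f S = orf Y X S.
  by move=> SW zS; rewrite orf_sym f1.
have f0' (S : {set T}) : S \subset W -> z \notin S -> f S = andf Y0 X0 S.
  by move=> SW zS; rewrite andf_sym f0.
have [a [aX aX0 aE]] := or_and_single zW b zX zY f1 b0 zX0 zY0 f0.
have [c [cY cX0 cE]] := or_and_single zW (base_sym b) zY zX f1' b0 zX0 zY0 f0.
have [e [eX eY0 eE]] := or_and_single zW b zX zY f1 (base_sym b0) zY0 zX0 f0'.
have [g [gY gY0 gE]] := or_and_single zW (base_sym b) zY zX f1' (base_sym b0) zY0 zX0 f0'.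
case: b0 => X0W Y0W d0 _ _; case: b => XW YW d _ _.
(* All four intersections of a block of the link with one of the deletion are single points, so this
   [R] misses both [X] and [Y]. What is left has the minimal non-faces {a, c}, {g, e}, {a, g, z},
   {c, e, z} of J_2. *)
pose R := (X0 :|: Y0) :\: [set:: [:: a; g; c; e; z]].
have RX u : u \in X -> u \in R = false.
  by move=> uX; rewrite !inE aE // eE //; case: (u == a); case: (u == e); rewrite ?orbT ?andbF.
have RY u : u \in Y -> u \in R = false.
  by move=> uX; rewrite !inE cE // gE //; case: (u == c); case: (u == g); rewrite ?orbT ?andbF.
apply: (@noJ2 T f W fm av a g c e z R); rewrite /R.
- by bsolve.
- by bsolve.
- by usolve.
- by fval f0; andl.
- by fval f0; andr.
- by fval f1; orp a g.
- by fval f1; orp e c.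
- by fval f0; nand c e.
- fval f1; rewrite /orf negb_and !negbK; apply/orP; left.
  by apply: nmeetsP => u uX; rewrite in_setU [_ \in _ :\: _]RX // orbF; apply/negbTE; bsolve.
- by fval f0; nand a g.
- fval f1; rewrite /orf negb_and !negbK; apply/orP; right.
  by apply: nmeetsP => u uX; rewrite in_setU [_ \in _ :\: _]RY // orbF; apply/negbTE; bsolve.
Qed.

(** Sets containing [z] do not see [w]. If sets containing [w] do not see [z] either, {z, w} acts as
    a third block: [f] is the shape on sets meeting it and false elsewhere, which gives O_6^* for
    [orf] and J_1^* for [andf]. The link of [w] provides this symmetry, or else P_4. The boolean
    [or] selects the shape. *)
Lemma lawrence_apart z w X Y (or : bool) : z \in W -> w \in W -> w != z ->
  base X Y W -> (z \in X) = false -> (z \in Y) = false ->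
  (w \in X) = false -> (w \in Y) = false ->
  (forall S : {set T}, S \subset W -> z \in S -> f S = (if or then orf else andf) T X Y S) ->
  (forall x, x \in W -> f [set x; z] = false) ->
  (forall S : {set T}, S \subset W -> z \notin S -> w \notin S -> f S = false) -> False.
Proof.
move=> zW wW wz b zX zY wX wY f1 iso HL.
have Hw (S : {set T}) : S \subset W -> z \in S -> f (w |: S) = f S.
  move=> SW zS; rewrite !f1 ?inE ?zS ?orbT // ?subUset ?sub1set ?wW //.
  by case: or {f1}; rewrite ?andfU1 ?orfU1.
have [x [x' [y [y' [xX x'X yY y'Y /andP[xx yy]]]]]] := base_two b.
case: (b) => XW YW d cX cY.
suff zirr (S : {set T}) : S \subset W -> w \in S -> f (z |: S) = f S.
  have fw (S : {set T}) : S \subset W -> w \in S -> f S = (if or then orf else andf) T X Y S.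
    move=> SW wS; rewrite -zirr // f1 ?setU11 ?subUset ?sub1set ?zW //.
    by case: or {f1}; rewrite ?andfU1 ?orfU1.
  case: or f1 fw => f1 fw.
    apply: (@noO6s T f W fm av x x' y y' w z set0).
    - by bsolve.
    - by bsolve.
    - by usolve.
    - move=> i j k; rewrite !inE => /orP[]/eqP-> /orP[]/eqP-> /orP[]/eqP->;
      first [fval fw | fval f1];
      first [by orp x y | by orp x' y | by orp x y' | by orp x' y'].
    - by fvalL HL.
    - by fval f1; norl.
    - by fval f1; norr.
  apply: (@noJ1s T f W fm av y w x x' z ((X :|: Y) :\: [set:: [:: y; w; x; x'; z]])).
  - by bsolve.
  - by bsolve.
  - by usolve.
  - by fval fw; andr.
  - by fval f1; andr.
  - by fval fw; andl.
  - by fval f1; andl.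
  - by fvalL HL.
  - by fval f1; nand x' y.
  - by fval f1; nand x y.
have fzz (S0 : {set T}) : S0 \subset W -> z \in S0 -> f S0 = f (w |: S0).
  by move=> SW zS; rewrite Hw.
have [u uW uw fu|X2 Y2 b2 wX2 wY2 fw|X2 Y2 b2 wX2 wY2 fw] := link_cases C wW.
- have : f (w |: [set u; z]).
    apply: fm fu; apply/subsetP=> v; rewrite !inE => /orP[]->; rewrite ?orbT //.
  rewrite Hw ?inE ?eqxx ?orbT // ?iso //.
  by usolve.
- case: (b2) => X2W Y2W d2 cX2 cY2.
  wlog zY2 : X2 Y2 b2 wX2 wY2 fw X2W Y2W d2 cX2 cY2 / (z \in Y2) = false.
    move=> hw; case: (boolP (z \in Y2)) => [zY2|/negbTE]; last exact: (hw X2 Y2).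
    apply: (hw Y2 X2) => //; [exact: base_sym|  |by rewrite disjoint_sym|exact: disjointFl zY2].
    by move=> S' SW zS; rewrite andf_sym fw.
  case: (boolP (z \in X2)) => [zX2|/negbTE zX2] SW wS; last first.
    by rewrite !fw ?inE ?wS ?orbT ?subUset ?sub1set ?zW // andfU1.
  exfalso.
  (* If [z] lay in a block of the link of [w], then [q], [p], [w], [z] would span the path w q z
     p. *)
  have [p pX2 pz] := card_other z cX2.
  have [q [_ [qY2 _ _]]] : exists q q', [/\ q \in Y2, q' \in Y2 & q != q'] by exact/card_gt1P.
  pose R := (X2 :|: Y2) :\: [set:: [:: q; p; w; z]].
  apply: (@noP4 T f W fm av q p w z R); rewrite /R.
  + by bsolve.
  + by bsolve.
  + by usolve.
  + by fval fw; andr.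
  + by fval fzz; fval fw; andl.
  + by fval fzz; fval fw; andr.
  + by fvalL HL.
  + by fval fw; nand z q.
  + by fval fw; nand p q.
- move=> SW wS; rewrite !fw ?inE ?wS ?orbT ?subUset ?sub1set ?zW //.
  have nz (X3 Y3 : {set T}) : base X3 Y3 W -> (w \in X3) = false -> (w \in Y3) = false ->
      (forall S0 : {set T}, S0 \subset W -> w \in S0 -> f S0 = orf X3 Y3 S0) -> (z \in X3) = false.
    move=> [X3W Y3W d3 cX3 cY3] wX3 wY3 f3; apply/negbTE/negP=> zX3.
    have [q [_ [qY3 _ _]]] : exists q q', [/\ q \in Y3, q' \in Y3 & q != q'] by exact/card_gt1P.
    have : f (w |: [set q; z]) by fval f3; orp z q.
    by rewrite Hw ?iso ?inE ?eqxx ?orbT //; first [by bsolve | by usolve].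
  rewrite orfU1 //; first exact: (nz X2 Y2).
  by apply: (nz Y2 X2) => //; [exact: base_sym|move=> S0 *; rewrite orf_sym fw].
Qed.
End VertexCases.

(** * The Lawrence vertex of the deletion lies in a block of the link *)

Section LawrenceCases.
Variables (T : finType) (f : {set T} -> bool) (W : {set T}).
Hypothesis C : critical f W.
Local Notation fm := (crit_mono C).
Local Notation av := (crit_avoids C).

(** The link of [x] can only be of shape [orf] with [z] and [y] on opposite sides. Any other vertex
    [u] on the side of [z] makes {x, u, y} a non-face avoiding [z]; it must therefore contain [w],
    so [u] is [w]. *)
Lemma lawrence_or_edge z w X Y x y : z \in W -> w \in W -> w != z ->
  base X Y W -> (z \in X) = false -> (z \in Y) = false ->
  (forall S : {set T}, S \subset W -> z \in S -> f S = orf X Y S) ->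
  (forall x, x \in W -> f [set x; z] = false) ->
  (forall S : {set T}, S \subset W -> z \notin S -> w \notin S -> f S = false) ->
  w \in X -> x \in X -> x != w -> y \in Y -> f [set w; x; y].
Proof.
move=> zW wW wz [XW YW d cX cY] zX zY f1 iso HL wX xX xw yY.
have xW : x \in W by bsolve.
have [u uW ux fu|X2 Y2 b2 xX2 xY2 fx|X2 Y2 b2 xX2 xY2 fx] := link_cases C xW.
- have uz : u != z by apply: contraTneq fu => ->; rewrite setUC iso //.
  have [e|uw] := eqVneq u w.
    have : f (z |: [set u; x]) by exact: (crit_addz C).
    by fval f1; rewrite e /orf [X in _ && ~~ X](_ : _ = true) ?andbF //; nmeets.
  by move: fu; fvalL HL.
- exfalso; have [y' y'Y yy] := card_other y cY.
  have key v : v \in Y -> andf X2 Y2 [set x; z; v].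
    by move=> vY; rewrite -fx; [fval f1; orp x v | by usolve | by bsolve].
  wlog XX : X2 Y2 b2 xX2 xY2 fx key / X2 \subset [set x; z; y].
    move=> hw; have /orP[H|H] := key _ yY; first exact: (hw X2 Y2).
    apply: (hw Y2 X2) => //; first exact: base_sym.
      by move=> S' SW zS; rewrite andf_sym fx.
    by move=> v vY; rewrite andf_sym key.
  case: (b2) => X2W Y2W d2 cX2 cY2.
  have sub2 (X3 : {set T}) v : (x \in X3) = false -> 1 < #|X3| -> X3 \subset [set x; z; v] ->
      (z \in X3) && (v \in X3).
    move=> xX3 cX3 Xs; apply: sub_pair cX3 _; apply/subsetP=> t tX3.
    by have := subsetP Xs _ tX3; rewrite !inE; bcase.
  have /andP[zX2 yX2] := sub2 _ _ xX2 cX2 XX.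
  have /orP[H|H] := key _ y'Y.
    by have := subsetP H _ yX2; bsolve.
  by have /andP[zY2 _] := sub2 _ _ xY2 cY2 H; sat; contra_done.
- have [y' y'Y yy] := card_other y cY.
  wlog zX2 : X2 Y2 b2 xX2 xY2 fx / z \in X2.
    move=> hw; case: (boolP (z \in X2)) => [zX2|/negbTE zX2]; first exact: (hw X2 Y2).
    case: (boolP (z \in Y2)) => [zY2|/negbTE zY2].
      apply: (hw Y2 X2) => //; first exact: base_sym.
      by move=> S' SW zS; rewrite orf_sym fx.
    have : orf X2 Y2 (z |: [set x; y]).
      by rewrite -fx; [fval f1; orp x y | by usolve | by bsolve].
    by rewrite orfU1 // -fx; [fvalL HL | by usolve | by bsolve].
  case: (b2) => X2W Y2W d2 cX2 cY2.
  have yY2 : y \in Y2.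
    have : orf X2 Y2 [set x; z; y].
      by rewrite -fx; [fval f1; orp x y | by usolve | by bsolve].
    by case/andP=> _ /meetsE[v vY2]; rewrite !inE => /orP[/orP[]|] /eqP e; subst v; sat; try contra_done.
  have [u uX2 uz] := card_other z cX2.
  have fxu : f [set x; u; y] by fval fx; orp u y.
  have [<-|uw] := eqVneq u w; first by rewrite [[set u; x]]setUC.
  by move: fxu; fvalL HL.
Qed.

(** If all pairs {w, y} are non-faces, two of them give J_1^*. If some {w, y} is a face, then [w],
    [x], [z] form a triangle of non-faces in the link of [y]. *)
Lemma lawrence_or z w X Y : z \in W -> w \in W -> w != z ->
  base X Y W -> (z \in X) = false -> (z \in Y) = false ->
  (forall S : {set T}, S \subset W -> z \in S -> f S = orf X Y S) ->
  (forall x, x \in W -> f [set x; z] = false) ->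
  (forall S : {set T}, S \subset W -> z \notin S -> w \notin S -> f S = false) ->
  w \in X -> False.
Proof.
move=> zW wW wz b zX zY f1 iso HL wX.
have key x y := lawrence_or_edge zW wW wz b zX zY f1 iso HL wX (x := x) (y := y).
case: (b) => XW YW d cX cY.
have [x xX xw] := card_other w cX.
case: (boolP [forall (y | y \in Y), f [set w; y]]) => [/forall_inP fwy|].
  have [y [y' [yY y'Y yy]]] : exists q q', [/\ q \in Y, q' \in Y & q != q'] by exact/card_gt1P.
  apply: (@noJ1s T f W fm av w y z x y' set0).
  - by bsolve.
  - by bsolve.
  - by usolve.
  - by apply: fm (fwy y yY); usolve.
  - by apply: fm (fwy y' y'Y); usolve.
  - by fval f1; orp x y.
  - by fval f1; orp x y'.
  - by fval f1; norr.
  - by fval f1; norl.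
  - by fvalL HL.
case/forall_inPn=> y yY fwy.
apply: (@noTri T f W fm av w x z [set y]).
- by bsolve.
- by bsolve.
- by usolve.
- by apply: fm (key x y xX xw yY); usolve.
- by fval f1; orp x y.
- by fval f1; orp w y.
- by apply: contra fwy; apply: fm; usolve.
- by fvalL HL.
- have : f [set y; z] = false by apply: iso; bsolve.
  by move/negbT; apply: contra; apply: fm; usolve.
Qed.

(** When sets containing [w] do not see [z], the edges x w, w y, y z form an induced path in a
    suitable link. *)
Lemma lawrence_and_path z w X Y : z \in W -> w \in W -> w != z ->
  base X Y W -> (z \in X) = false -> (z \in Y) = false ->
  (forall S : {set T}, S \subset W -> z \in S -> f S = andf X Y S) ->
  (forall x, x \in W -> f [set x; z] = false) ->
  (forall S : {set T}, S \subset W -> z \notin S -> w \notin S -> f S = false) ->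
  w \in X ->
  (forall S : {set T}, S \subset W -> w \in S -> f (z |: S) = f S) -> False.
Proof.
move=> zW wW wz [XW YW d cX cY] zX zY f1 iso HL wX zirr.
have [x xX xw] := card_other w cX.
have [y [_ [yY _ _]]] : exists q q', [/\ q \in Y, q' \in Y & q != q'] by exact/card_gt1P.
pose R := (X :|: Y) :\: [set:: [:: w; x; y]].
apply: (@noP4 T f W fm av w z x y R); rewrite /R.
- by bsolve.
- by bsolve.
- by usolve.
- by rewrite -zirr; [fval f1; andl | by usolve | by bsolve].
- by fval f1; andr.
- by rewrite -zirr; [fval f1; andr | by usolve | by bsolve].
- by fval f1; nand x y.
- by fval f1; nand w y.
- by fvalL HL.
Qed.

(** The only outcome free of forbidden minors is [f = andf X (z |: Y)]: [z] joins the block that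
    does not contain [w]. Criticality excludes this shape as well. *)
Lemma lawrence_and z w X Y : z \in W -> w \in W -> w != z ->
  base X Y W -> (z \in X) = false -> (z \in Y) = false ->
  (forall S : {set T}, S \subset W -> z \in S -> f S = andf X Y S) ->
  (forall x, x \in W -> f [set x; z] = false) ->
  (forall S : {set T}, S \subset W -> z \notin S -> w \notin S -> f S = false) ->
  w \in X -> False.
Proof.
move=> zW wW wz b zX zY f1 iso HL wX.
case: (b) => XW YW d cX cY.
have [x xX xw] := card_other w cX.
have [y [y' [yY y'Y yy]]] : exists q q', [/\ q \in Y, q' \in Y & q != q'] by exact/card_gt1P.
have bz : base X (z |: Y) W.
  split=> //; first by usolve.
    by apply: nmeetsP => u uX; apply/negbTE; bsolve.
  by apply: leq_trans cY (subset_leq_card (subsetUr _ _)).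
have andfz (S : {set T}) : z \in S -> andf X (z |: Y) S = andf X Y S.
  by move=> zS; rewrite /andf subUset sub1set zS.
have andfz' (S : {set T}) : (z \in S) = false -> andf X (z |: Y) S = (X \subset S).
  by move=> zS; rewrite /andf subUset sub1set zS /= orbF.
have [u uW uw fu|X2 Y2 b2 wX2 wY2 fw|X2 Y2 b2 wX2 wY2 fw] := link_cases C wW.
- have uz : u != z by apply: contraTneq fu => ->; rewrite setUC iso //.
  have EX : X \subset [set u; w].
    have : f (z |: [set u; w]) by exact: (crit_addz C).
    fval f1; rewrite andfU1 // => /orP[//|/(sub_pair cY)/andP[_ wY]].
    by sat; contra_done.
  have /andP[uX _] := sub_pair cX EX.
  (* If [W :\ z :\ u] is a face, every non-face avoiding [z] contains [u], and [w] as well, hence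
     [X]; this is the shape with blocks [X] and [z |: Y]. *)
  case: (boolP (f (W :\ z :\ u))) => [fWu|/negbTE fWu].
    apply: (@noP4 T f W fm av w z u y (W :\: [set:: [:: w; z; u; y]])).
    + by bsolve.
    + by bsolve.
    + by usolve.
    + by apply: fm fu; usolve.
    + by fval f1; andr.
    + by apply: fm fWu; usolve.
    + by fval f1; nand u y.
    + by fval f1; nand w y.
    + by fvalL HL.
  apply: (crit_not C); apply: (kAnd bz) => S SW.
  case: (boolP (z \in S)) => [zS|/negbTE zS]; first by rewrite f1 ?andfz.
  rewrite andfz' //; apply/idP/idP => [fS|H].
    have uS : u \in S.
      apply: contraFT fWu => uS; apply: fm fS; apply/subsetP=> v vS.
      rewrite !inE (subsetP SW) // andbT; apply/andP; split.
        by apply: contraNneq uS => <-.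
      by apply: contraFneq zS => <-.
    have wS : w \in S by apply: contraTT fS => wS; rewrite HL ?zS.
    by apply: subset_trans EX _; usolve.
  by apply: fm fu; apply: subset_trans H; usolve.
- case: (b2) => X2W Y2W d2 cX2 cY2.
  wlog zY2 : X2 Y2 b2 wX2 wY2 fw X2W Y2W d2 cX2 cY2 / (z \in Y2) = false.
    move=> hw; case: (boolP (z \in Y2)) => [zY2|/negbTE]; last exact: (hw X2 Y2).
    apply: (hw Y2 X2) => //; [exact: base_sym|  |by rewrite disjoint_sym|exact: disjointFl zY2].
    by move=> S' SW zS; rewrite andf_sym fw.
  case: (boolP (z \in X2)) => [zX2|/negbTE zX2]; last first.
    apply: (lawrence_and_path zW wW wz b zX zY f1 iso HL wX) => S SW wS.
    by rewrite !fw ?inE ?wS ?orbT ?subUset ?sub1set ?zW // andfU1.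
  have [x2 x2X x2z] := card_other z cX2.
  (* Sets containing both [w] and [z] are described by either link; comparing the descriptions on
     three such sets forces [X = w |: Y2] or [Y = Y2]. *)
  have e1 : andf X Y (w |: (z |: Y2)).
    by rewrite -f1 ?fw; [andr|by usolve|by bsolve|by usolve|by bsolve].
  have e2 : andf X2 Y2 (z |: X) by rewrite -fw ?f1; [andl|by usolve|by bsolve|by usolve|by bsolve].
  have e3 : andf X2 Y2 (w |: (z |: Y)).
    by rewrite -fw ?f1; [andr|by usolve|by bsolve|by usolve|by bsolve].
  case/orP: e1 => [H1|H1].
    have H2 : Y2 \subset X.
      case/orP: e2 => [H2|]; last by rewrite subU1.
      have := subsetP H2 _ x2X; rewrite !inE (negbTE x2z) /= => x2X'.
      have := subsetP H1 _ x2X'; rewrite !inE (negbTE x2z) (disjointFr d2 x2X) !orbF => /eqP e.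
      by subst x2; contra_done.
    apply: (crit_not C); apply: (kAnd bz) => S SW.
    case: (boolP (z \in S)) => [zS|/negbTE zS]; first by rewrite f1 ?andfz.
    rewrite andfz' //; case: (boolP (w \in S)) => [wS|wS]; last first.
      rewrite HL ?zS //; apply/esym/negbTE; apply/subsetPn; by exists w.
    rewrite fw //; apply/orP/idP => [[H|H]|H].
    + by have := subsetP H _ zX2; rewrite zS.
    + apply/subsetP=> v vX; have := subsetP H1 _ vX; rewrite !inE => /or3P[/eqP->//|/eqP e|/(subsetP H)//].
      by subst v; contra_done.
    + by right; apply: subset_trans H2 H.
  have H1' : Y \subset Y2 by apply/subsetP=> v vY; have := subsetP H1 v vY; rewrite !inE; bcase.
  have H2 : Y2 \subset Y.
    case/orP: e3 => [H2|]; last by rewrite !subU1.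
    have := subsetP H2 _ x2X; rewrite !inE (negbTE x2z) /= => /orP[/eqP e|x2Y].
      by subst x2; contra_done.
    by have := subsetP H1' _ x2Y; rewrite (disjointFr d2 x2X).
  apply: (@noTri T f W fm av w y z ((X :|: Y) :\: [set:: [:: w; y]])).
  + by bsolve.
  + by bsolve.
  + by usolve.
  + by fval fw; andr.
  + by fval f1; andr.
  + by fval f1; andl.
  + by fval fw; nand z y.
  + by fvalL HL.
  + by fval f1; nand w y.
- have nz (X3 Y3 : {set T}) : base X3 Y3 W -> (w \in X3) = false -> (w \in Y3) = false ->
      (forall S0 : {set T}, S0 \subset W -> w \in S0 -> f S0 = orf X3 Y3 S0) -> (z \in X3) = false.
    move=> [X3W Y3W d3 cX3 cY3] wX3 wY3 f3; apply/negbTE/negP=> zX3.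
    have : orf X3 Y3 (w |: (z |: Y)) by rewrite -f3 ?f1; [andr|by usolve|by bsolve|by usolve|by bsolve].
    case/andP=> _ /meetsE[v vY3]; rewrite !inE => /or3P[/eqP e|/eqP e|vY].
    + by subst v; sat; contra_done.
    + by subst v; sat; contra_done.
    have : andf X Y (w |: (z |: [set v])).
      by rewrite -f1 ?f3; [orp z v|by usolve|by bsolve|by usolve|by bsolve].
    case/orP=> [H|H].
      by have := subsetP H _ xX; bsolve.
    have [v' v'Y vv] := card_other v cY.
    by have := subsetP H _ v'Y; bsolve.
  apply: (lawrence_and_path zW wW wz b zX zY f1 iso HL wX) => S SW wS.
  rewrite !fw ?inE ?wS ?orbT ?subUset ?sub1set ?zW // orfU1 //; first exact: (nz X2 Y2).
  by apply: (nz Y2 X2) => //; [exact: base_sym|move=> S0 *; rewrite orf_sym fw].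
Qed.

Lemma no_isolated_vertex z : z \in W -> (forall x, x \in W -> f [set x; z] = false) -> False.
Proof.
move=> zW iso.
have [u uW uz fu|X Y b zX zY f1|X Y b zX zY f1] := link_cases C zW; first by rewrite iso in fu.
- have [w wW wz fw|A B b0 zA zB f0|A B b0 zA zB f0] := del_cases C zW.
  + case: (boolP (w \in X)) => [wX|/negbTE wX]; first exact: (lawrence_and zW wW wz b zX zY f1 iso fw wX).
    case: (boolP (w \in Y)) => [wY|/negbTE wY].
      apply: (lawrence_and zW wW wz (base_sym b) zY zX _ iso fw wY) => S *; rewrite andf_sym; exact: f1.
    exact: (@lawrence_apart T f W C z w X Y false).
  + exact: (and_and C zW b zX zY f1 b0 zA zB f0).
  + exact: (and_or C zW b zX zY f1 b0 zA zB f0).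
- have [w wW wz fw|A B b0 zA zB f0|A B b0 zA zB f0] := del_cases C zW.
  + case: (boolP (w \in X)) => [wX|/negbTE wX]; first exact: (lawrence_or zW wW wz b zX zY f1 iso fw wX).
    case: (boolP (w \in Y)) => [wY|/negbTE wY].
      apply: (lawrence_or zW wW wz (base_sym b) zY zX _ iso fw wY) => S *; rewrite orf_sym; exact: f1.
    exact: (@lawrence_apart T f W C z w X Y true).
  + exact: (or_and C zW b zX zY f1 b0 zA zB f0).
  + exact: (or_or C zW b zX zY f1 b0 zA zB f0).
Qed.
End LawrenceCases.

(** * The graph of two-element non-faces *)

Section PairGraph.
Variables (T : finType) (f : {set T} -> bool) (W : {set T}).
Hypothesis C : critical f W.
Local Notation fm := (crit_mono C).
Local Notation av := (crit_avoids C).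

Local Notation E x y := (f [set x; y]).

Lemma edgeC x y : E x y = E y x.
Proof. by rewrite setUC. Qed.

Lemma edge_neq x y : x \in W -> E x y -> x != y.
Proof. by move=> xW; apply: contraTneq => <-; rewrite setUid (crit_set1 C). Qed.

Lemma set2_seq (x y : T) : [set:: [:: x; y]] :|: set0 = [set x; y].
Proof. by apply/setP=> u; rewrite !inE orbF. Qed.

Lemma edge_tri a b c : a \in W -> b \in W -> c \in W -> E a b -> E b c -> E a c -> False.
Proof.
move=> aW bW cW ab bc ac.
have := edge_neq aW ab; have := edge_neq bW bc; have := edge_neq aW ac => nac nbc nab.
have f1 x : x \in W -> ~~ f ([set:: [:: x]] :|: set0).
  by move=> xW; rewrite setU0 (_ : [set:: _] = [set x]) ?(crit_set1 C) //; apply/setP=> u; rewrite !inE.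
apply: (@noTri T f W fm av a b c set0); rewrite ?set2_seq ?f1 //.
- by bsolve.
- by bsolve.
- by usolve.
Qed.

Lemma edge_path p q r s : p \in W -> q \in W -> r \in W -> s \in W ->
  E p q -> E q r -> E r s -> ~~ E p r -> ~~ E q s -> ~~ E p s -> False.
Proof.
move=> pW qW rW sW pq qr rs pr qs ps.
have := edge_neq pW pq; have := edge_neq qW qr; have := edge_neq rW rs => nrs nqr npq.
have npr : p != r by apply: contraNneq ps => ->.
have nqs : q != s by apply: contraNneq ps => <-.
have nps : p != s by apply: contraNneq qs => <-; rewrite edgeC.
apply: (@noP4 T f W fm av q s p r set0); rewrite ?set2_seq //.
- by bsolve.
- by bsolve.
- by usolve.
- by rewrite edgeC.
- by rewrite edgeC.
- by rewrite edgeC.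
Qed.

(** * An induced pair of disjoint edges *)

Section TwoEdges.
Variables a b c d : T.
Hypotheses (aW : a \in W) (bW : b \in W) (cW : c \in W) (dW : d \in W).
Hypotheses (ab : E a b) (cd : E c d) (ac : ~~ E a c) (ad : ~~ E a d) (bc : ~~ E b c) (bd : ~~ E b d).

Lemma two_edges_uniq : uniq [:: a; b; c; d].
Proof.
have nab := edge_neq aW ab; have ncd := edge_neq cW cd.
have nac : a != c by apply: contraNneq bc => <-; rewrite edgeC.
have nad : a != d by apply: contraNneq bd => <-; rewrite edgeC.
have nbc : b != c by apply: contraNneq ac => <-.
have nbd : b != d by apply: contraNneq ad => <-.
by bsolve.
Qed.

(** The absence of triangles and induced paths makes [a] the only neighbour of [v] among the four.
    No triple {v, b, e} with [e] one of [c], [d] is a non-face, or the link of [e] would have a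
    triangle; so the five vertices span J_1. *)
Lemma two_edges_adj v : v \in W -> v \notin [:: a; b; c; d] -> E v a -> False.
Proof.
have := two_edges_uniq; rewrite /= !inE !negb_or => /and4P[/and3P[nab nac nad] /andP[nbc nbd] ncd _].
move=> vW /and4P[nva nvb nvc nvd] va.
have vb : ~~ E v b by apply/negP=> vb; apply: (edge_tri vW aW bW).
have vc : ~~ E v c.
  apply/negP=> vc; apply: (@edge_path b a v c) => //; [by rewrite edgeC|by rewrite edgeC|].
  by rewrite edgeC.
have vd : ~~ E v d.
  apply/negP=> vd; apply: (@edge_path b a v d) => //; [by rewrite edgeC|by rewrite edgeC|].
  by rewrite edgeC.
have key e : e \in W -> e != a -> e != b -> e != v -> ~~ E v e -> ~~ E a e -> ~~ E b e ->
    ~~ f [set:: [:: v; b; e]].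
  move=> eW ea eb ev ve ae be; apply/negP=> H.
  apply: (@noTri T f W fm av v a b [set e]).
  - by bsolve.
  - by bsolve.
  - by usolve.
  - by apply: fm va; usolve.
  - by apply: fm ab; usolve.
  - by apply: fm H; usolve.
  - by apply: contra ve; apply: fm; usolve.
  - by apply: contra ae; apply: fm; usolve.
  - by apply: contra be; apply: fm; usolve.
apply: (@noJ1 T f W fm av a c b v d set0); rewrite ?set2_seq //.
- by bsolve.
- by bsolve.
- by usolve.
- by rewrite edgeC.
- have := key c; rewrite cW ![c == _]eq_sym nac nbc nvc => /(_ isT isT isT isT vc ac bc).
  by apply: contra; apply: fm; usolve.
- have := key d; rewrite dW ![d == _]eq_sym nad nbd nvd => /(_ isT isT isT isT vd ad bd).
  by apply: contra; apply: fm; usolve.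
Qed.

(** A Lawrence vertex of the deletion would lie on both edges, and the shape [orf] would join the
    two edges by a cross pair. Only [andf] remains, with the edges as blocks. *)
Lemma two_edges_del v : v \in W -> v \notin [:: a; b; c; d] ->
  forall S : {set T}, S \subset W -> v \notin S -> f S = andf [set a; b] [set c; d] S.
Proof.
have := two_edges_uniq; rewrite /= !inE !negb_or => /and4P[/and3P[nab nac nad] /andP[nbc nbd] ncd _].
move=> vW /and4P[nva nvb nvc nvd].
have abW : [set a; b] \subset W by usolve.
have cdW : [set c; d] \subset W by usolve.
have vab : v \notin [set a; b] by bsolve.
have vcd : v \notin [set c; d] by bsolve.
have [w wW wv fw|X Y b0 vX vY fv|X Y b0 vX vY fv] := del_cases C vW.
- have : w \in [set a; b] by apply: contraTT ab => wab; rewrite fw.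
  have : w \in [set c; d] by apply: contraTT cd => wab; rewrite fw.
  by rewrite !inE => /orP[]/eqP-> /orP[]/eqP e; subst; rewrite eqxx in nac nad nbc nbd.
- have : andf X Y [set a; b] by rewrite -fv.
  wlog XX : X Y b0 vX vY fv / X \subset [set a; b].
    move=> hw aXY; case/orP: (aXY) => H; first exact: (hw X Y).
    apply: (hw Y X) => //; first exact: base_sym.
      by move=> S' *; rewrite andf_sym fv.
    by rewrite andf_sym.
  case: b0 => XW YW dXY cX cY _; have /andP[aX bX] := sub_pair cX XX.
  have EX : X = [set a; b] by apply/eqP; rewrite eqEsubset XX; usolve.
  have : andf X Y [set c; d] by rewrite -fv.
  case/orP=> [/subsetP/(_ _ aX)|H]; first by rewrite !inE (negbTE nac) (negbTE nad).
  have /andP[cY' dY'] := sub_pair cY H.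
  have EY : Y = [set c; d] by apply/eqP; rewrite eqEsubset H; usolve.
  by move=> S SW vS; rewrite fv // EX EY.
- have H1 : orf X Y [set a; b] by rewrite -fv.
  have H2 : orf X Y [set c; d] by rewrite -fv.
  exfalso; case: b0 => XW YW dXY cX cY.
  have cross x y : x \in X -> y \in Y -> E x y.
    by move=> xX yY; fval fv; orp x y.
  case/andP: H1 => /meetsE[x xX xab] /meetsE[y yY yab].
  case/andP: H2 => /meetsE[x' xX' xcd] /meetsE[y' yY' ycd].
  have := cross x y' xX yY'; apply/negP; move: xab ycd.
  by rewrite !inE => /orP[]/eqP-> /orP[]/eqP->.
Qed.

(** A transversal of the three edges a b, c d, v v' avoids [v] or [v'], so the corresponding
    deletion shows that it is a face: this is O_6. *)
Lemma two_edges_le v v' : v \in W -> v \notin [:: a; b; c; d] ->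
  v' \in W -> v' \notin [:: a; b; c; d] -> E v v' -> False.
Proof.
move=> vW vn v'W v'n vv'; have nvv := edge_neq vW vv'.
have fv := two_edges_del vW vn; have fv' := two_edges_del v'W v'n.
have := two_edges_uniq; move: vn v'n; rewrite /= !inE !negb_or.
move=> /and4P[nva nvb nvc nvd] /and4P[nva' nvb' nvc' nvd'].
move=> /and4P[/and3P[nab nac nad] /andP[nbc nbd] ncd _].
apply: (@noO6 T f W fm av a b c d v v' set0); rewrite ?set2_seq //.
- by bsolve.
- by bsolve.
- by usolve.
have nand2 (S : {set T}) x y : x \in [set a; b] -> x \notin S -> y \in [set c; d] -> y \notin S ->
    ~~ andf [set a; b] [set c; d] S.
  by move=> *; rewrite /andf negb_or; apply/andP; split; apply/subsetPn; [exists x|exists y].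
move=> x y z; rewrite !inE => /orP[]/eqP-> /orP[]/eqP-> /orP[]/eqP->;
  first [fval fv | fval fv'];
  first [by apply: (nand2 _ a c); bsolve | by apply: (nand2 _ a d); bsolve
        | by apply: (nand2 _ b c); bsolve | by apply: (nand2 _ b d); bsolve].
Qed.
End TwoEdges.

Lemma no_two_edges a b c d : a \in W -> b \in W -> c \in W -> d \in W ->
  (forall x, x \in W -> exists2 y, y \in W & E x y) ->
  E a b -> E c d -> ~~ E a c -> ~~ E a d -> ~~ E b c -> ~~ E b d -> False.
Proof.
move=> aW bW cW dW deg ab cd ac ad bc bd.
have U := two_edges_uniq aW cW ab cd ac ad bc bd.
have ba : E b a by rewrite edgeC.
have dc : E d c by rewrite edgeC.
have ca : ~~ E c a by rewrite edgeC.
have cb : ~~ E c b by rewrite edgeC.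
have da : ~~ E d a by rewrite edgeC.
have db : ~~ E d b by rewrite edgeC.
case: (boolP [exists v in W, v \notin [:: a; b; c; d]]) => [/exists_inP[v vW vn]|/exists_inPn nv].
  have [v' v'W vv'] := deg v vW.
  case: (boolP (v' \in [:: a; b; c; d])) => [|v'n].
    move: vn; rewrite !inE !negb_or => /and4P[nva nvb nvc nvd] /or4P[]/eqP e; subst v'.
    - by apply: (two_edges_adj aW bW cW dW ab cd ac ad bc bd vW _ vv'); bsolve.
    - by apply: (two_edges_adj bW aW cW dW ba cd bc bd ac ad vW _ vv'); bsolve.
    - by apply: (two_edges_adj cW dW aW bW cd ab ca cb da db vW _ vv'); bsolve.
    - by apply: (two_edges_adj dW cW aW bW dc ab da db ca cb vW _ vv'); bsolve.
  exact: (two_edges_le aW bW cW dW ab cd ac ad bc bd vW vn v'W v'n vv').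
move: U; rewrite /= !inE !negb_or => /and4P[/and3P[nab nac nad] /andP[nbc nbd] ncd _].
have b0 : base [set a; b] [set c; d] W.
  split; rewrite ?cards2 ?nab ?ncd //; [by usolve|by usolve|].
  by apply: nmeetsP => u; rewrite !inE => /orP[]/eqP->; apply/negbTE; bsolve.
apply: (crit_not C); apply: (kAnd b0) => S SW; apply/idP/orP => [fS|[H|H]]; last 2 first.
- exact: fm ab.
- exact: fm cd.
(* A set containing neither edge omits an end of each, so it lies in a cross pair, which is a
   face. *)
apply/orP; apply/negPn/negP; rewrite /andf negb_or => /andP[/subsetPn[x xab xS] /subsetPn[y ycd yS]].
have no z t : ~~ E z t -> (forall u, u \in S -> (u == z) || (u == t)) -> False.
  move=> /negP H Hu; apply: H; apply: fm fS; apply/subsetP=> u /Hu; by rewrite !inE.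
have Su u : u \in S -> [&& u != x, u != y & u \in [:: a; b; c; d]].
  move=> uS; apply/and3P; split; [by apply: contraNneq xS => <-|by apply: contraNneq yS => <-|].
  by have := nv u (subsetP SW u uS); rewrite negbK.
move: xab ycd; rewrite !inE => /orP[]/eqP e1 /orP[]/eqP e2; subst x y.
- by apply: (no _ _ bd) => u /Su; rewrite !inE; do 4!case: (u == _).
- by apply: (no _ _ bc) => u /Su; rewrite !inE; do 4!case: (u == _).
- by apply: (no _ _ ad) => u /Su; rewrite !inE; do 4!case: (u == _).
- by apply: (no _ _ ac) => u /Su; rewrite !inE; do 4!case: (u == _).
Qed.

(** A minimal non-face among the neighbours of [b], taken together with [b], is the boundary of a
    simplex plus a point. *)
Lemma nbhd_face (A : {set T}) b : b \in W -> A \subset W ->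
  (forall x, x \in A -> E x b) -> f A = false.
Proof.
move=> bW AW Ab; apply/negbTE/negP=> fA.
have [M /minsetP[fM Mmin] MA] := minset_exists fA.
have MD q : q \in M -> ~~ f (M :\ q).
  move=> qM; apply/negP=> H; have := Mmin _ H (subD1set _ _).
  by move/setP/(_ q); rewrite !inE eqxx qM.
have MW := subset_trans MA AW.
have M1 : 1 < #|M|.
  rewrite ltn_neqAle eq_sym card_gt0; apply/andP; split.
    by apply/negP=> /cards1P[x e]; move: fM; rewrite e (crit_set1 C) // (subsetP MW) // e set11.
  by apply: contraTneq fM => ->; rewrite (crit_set0 C).
have nbM : b \notin M.
  by apply/negP=> /(subsetP MA)/Ab; rewrite setUid (crit_set1 C).
apply: (@noBd T f W fm av M set0 b) => //; rewrite ?setU0 ?setD0 ?sub0set //.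
- by move=> q qM; rewrite setU0 Ab // (subsetP MA).
- by rewrite (crit_set1 C).
- by move=> q qM; rewrite setU0 MD.
Qed.

Lemma isolated_vertex_exists : (forall x, x \in W -> exists2 y, y \in W & E x y) -> False.
Proof.
move=> deg.
have [a aW] : exists a, a \in W.
  by apply/set0Pn; apply/negP=> /eqP e; have := crit_setT C; rewrite e (crit_set0 C).
have [b bW ab] := deg a aW.
pose A := [set x in W | E x b]; pose B := [set y in W | E a y].
have AW : A \subset W by apply/subsetP=> x; rewrite !inE => /andP[].
have BW : B \subset W by apply/subsetP=> x; rewrite !inE => /andP[].
have cross p q : p \in A -> q \in B -> E p q.
  rewrite !inE => /andP[pW pb] /andP[qW aq]; apply/negPn/negP=> npq.
  apply: (@edge_path p b a q) => //; first by rewrite edgeC.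
    by apply/negP=> pa; apply: (edge_tri pW aW bW).
  by apply/negP=> bq; apply: (edge_tri aW bW qW).
(* If [v] is adjacent to neither [a] nor [b], a neighbour [u] of [v] that is adjacent to one of them
   gives an induced path; otherwise v u and a b are an induced pair of disjoint edges. *)
have cover v : v \in W -> (v \in A) || (v \in B).
  move=> vW; rewrite !inE vW /=; apply/negPn/negP; rewrite negb_or => /andP[nvb nav].
  have [u uW vu] := deg v vW.
  case: (boolP (E u b)) => [ub|nub].
    apply: (@edge_path v u b a) => //; [by rewrite edgeC| |by rewrite edgeC].
    by apply/negP=> ua; apply: (edge_tri uW aW bW).
  case: (boolP (E a u)) => [au|nau].
    by apply: (@edge_path v u a b) => //; rewrite edgeC.
  by apply: (@no_two_edges a b v u) => //; rewrite edgeC.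
have d : [disjoint A & B].
  apply: nmeetsP => p pA; apply/negP=> pB; have := cross p p pA pB.
  by rewrite setUid (crit_set1 C) // (subsetP AW).
have fA : f A = false by apply: (nbhd_face bW AW) => x; rewrite inE => /andP[].
have fB : f B = false by apply: (nbhd_face aW BW) => x; rewrite inE edgeC => /andP[].
have fE (S : {set T}) : S \subset W -> f S = orf A B S.
  move=> SW; apply/idP/andP=> [fS|[/meetsE[x xA xS] /meetsE[y yB yS]]]; last first.
    by apply: fm (cross x y xA yB); apply/subsetP=> u; rewrite !inE => /orP[]/eqP->.
  split; apply/negP=> dS.
    suff : f B by rewrite fB.
    apply: fm fS; apply/subsetP=> u uS.
    by have := cover u (subsetP SW u uS); rewrite (disjointFl dS uS).
  suff : f A by rewrite fA.
  apply: fm fS; apply/subsetP=> u uS.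
  by have := cover u (subsetP SW u uS); rewrite (disjointFl dS uS) orbF.
have aA : a \in A by rewrite inE aW.
have bB : b \in B by rewrite inE bW.
(* With [A] reduced to {a}, the set [W :\ a] would miss [A] and be a face, making [a] a Lawrence
   vertex. *)
have [A1|A1] := ltnP 1 #|A|; last first.
  have EA : A = [set a].
    by apply/eqP; rewrite eq_sym eqEcard sub1set aA cards1.
  have := crit_setD1 C aW; rewrite fE ?subD1set // /orf EA [X in ~~ X](_ : _ = true) //.
  by apply: nmeetsP => u; rewrite !inE => /eqP->; rewrite eqxx.
have [B1|B1] := ltnP 1 #|B|; last first.
  have EB : B = [set b].
    by apply/eqP; rewrite eq_sym eqEcard sub1set bB cards1.
  have := crit_setD1 C bW; rewrite fE ?subD1set // /orf EB andbC [X in ~~ X](_ : _ = true) //.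
  by apply: nmeetsP => u; rewrite !inE => /eqP->; rewrite eqxx.
by apply: (crit_not C); apply: (@kOr _ _ _ A B).
Qed.
End PairGraph.

Lemma not_critical (T : finType) (f : {set T} -> bool) (W : {set T}) : ~ critical f W.
Proof.
move=> C; apply: (isolated_vertex_exists C) => x xW; apply/exists_inP; apply: contraT => /exists_inPn H.
case: (no_isolated_vertex C xW) => y yW; apply/negbTE; rewrite setUC; exact: (H y yW).
Qed.

(** Every clause of [kind] ranges over finitely many sets, so a boolean test decides it and the
    minimal counterexample argument stays constructive. *)
Lemma kind_dec (T : finType) (f : {set T} -> bool) (W : {set T}) : kind f W \/ ~ kind f W.
Proof.
pose bas (X Y : {set T}) := [&& X \subset W, Y \subset W, [disjoint X & Y], 1 < #|X| & 1 < #|Y|].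
have basP X Y : reflect (base X Y W) (bas X Y) by exact: and5P.
pose test := fun h : {set T} -> {set T} -> {set T} -> bool =>
  [exists p : {set T} * {set T}, bas p.1 p.2 &&
     [forall S : {set T}, (S \subset W) ==> (f S == h p.1 p.2 S)]].
have testP h : reflect (exists X Y, base X Y W /\ forall S : {set T}, S \subset W -> f S = h X Y S) (test h).
  apply: (iffP existsP) => [[[X Y] /andP[/basP b /forallP H]]|[X [Y [b H]]]].
    by exists X, Y; split=> // S SW; apply/eqP; apply: (implyP (H S)).
  exists (X, Y); apply/andP; split; first exact/basP.
  by apply/forallP=> S; apply/implyP=> SW; apply/eqP; apply: H.
case: (boolP (f W)) => [fW|/negbTE]; last by move=> H; left; apply: kFace.
case: (boolP (f set0)) => [|f0]; first by move=> H; left; apply: kVoid.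
case: (boolP [exists x in W, f [set x]]) => [/exists_inP[x xW H]|/exists_inPn g].
  by left; apply: (kGhost xW).
case: (boolP [exists x in W, ~~ f (W :\ x)]) => [/exists_inP[x xW /negbTE H]|/exists_inPn l].
  by left; apply: (kLaw xW).
case: (boolP (test (@andf T))) => [/testP[X [Y [b H]]]|a].
  by left; apply: (kAnd b).
case: (boolP (test (@orf T))) => [/testP[X [Y [b H]]]|o].
  by left; apply: (kOr b).
right=> -[H|H|x xW H|x xW H|X Y b H|X Y b H].
- by rewrite fW in H.
- by rewrite H in f0.
- by have := g x xW; rewrite H.
- by have := l x xW; rewrite H.
- by case/testP: a; exists X, Y.
- by case/testP: o; exists X, Y.
Qed.

Lemma avoids_kind (T : finType) (f : {set T} -> bool) (W : {set T}) :
  mono f -> avoids f W -> kind f W.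
Proof.
have [n] := ubnP #|W|; elim: n f W => // n IHn f W; rewrite ltnS => Wn fm av.
case: (kind_dec f W) => // nk; case: (@not_critical T f W); split=> // W' R W'W RW d.
apply: IHn.
- by apply: leq_trans (proper_card W'W) Wn.
- by move=> A B AB; apply: fm; apply: setSU.
- by apply: avoids_minor av; rewrite ?(proper_sub W'W).
Qed.

(** * From shapes to nuclear complexes *)

Definition scx_of_pred (T : finType) (f : {set T} -> bool) (W : {set T}) : scx :=
  @SCx T W [set S : {set T} | (S \subset W) && ~~ f S].

Lemma iso_scx_of (M : scx) (T : finType) (f : {set T} -> bool) (W : {set T}) (h : sT M -> T) :
  {in sV M &, injective h} -> h @: sV M = W ->
  (forall F : {set sT M}, F \in sF M -> F \subset sV M) ->
  (forall S : {set sT M}, S \subset sV M -> (S \in sF M) = ~~ f (h @: S)) ->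
  iso M (scx_of_pred f W).
Proof.
move=> hi hW MF H; exists h; do !split=> //.
  by move=> G; rewrite inE => /andP[].
by move=> S SV; rewrite H // inE -hW imsetS.
Qed.

Section SumSets.
Variables (A B : finType) (P : {set A}) (Q : {set B}).

Lemma mem_sumsetl u : (inl u \in inl @: P :|: inr @: Q) = (u \in P).
Proof.
rewrite inE mem_imset; last by move=> ? ? [].
by case: imsetP => [[]|] //; rewrite orbF.
Qed.

Lemma mem_sumsetr u : (inr u \in inl @: P :|: inr @: Q) = (u \in Q).
Proof.
rewrite inE orbC mem_imset; last by move=> ? ? [].
by case: imsetP => [[]|] //; rewrite orbF.
Qed.
End SumSets.

Lemma preim_inl (A B : finType) (P : {set A}) (Q : {set B}) :
  inl @^-1: (inl @: P :|: inr @: Q) = P.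
Proof. by apply/setP=> x; rewrite inE mem_sumsetl. Qed.

Lemma preim_inr (A B : finType) (P : {set A}) (Q : {set B}) :
  inr @^-1: (inl @: P :|: inr @: Q) = Q.
Proof. by apply/setP=> x; rewrite inE mem_sumsetr. Qed.

Lemma sumsetK (A B : finType) (S : {set A + B}) : inl @: (inl @^-1: S) :|: inr @: (inr @^-1: S) = S.
Proof. by apply/setP=> -[u|u]; rewrite ?mem_sumsetl ?mem_sumsetr inE. Qed.

Lemma cone_faceE p (K : scx) (S : {set 'I_p + sT K}) :
  (S \in sF (cone p K)) = (inr @^-1: S \in sF K).
Proof.
rewrite inE; apply/existsP/idP => [[U /existsP[G /andP[GF /eqP->]]]|H].
  by rewrite preim_inr.
by exists (inl @^-1: S); apply/existsP; exists (inr @^-1: S); rewrite H /= sumsetK.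
Qed.

Lemma dunion_sV m n : sV (dunion (simplex m) (simplex n)) = setT.
Proof. by apply/setP=> -[u|u]; rewrite /= ?mem_sumsetl ?mem_sumsetr !inE. Qed.

Lemma dunion_faceE m n (S : {set 'I_m.+1 + 'I_n.+1}) :
  (S \in sF (dunion (simplex m) (simplex n))) = (inl @^-1: S == set0) || (inr @^-1: S == set0).
Proof.
rewrite inE orbC; congr (_ || _); apply/imsetP/eqP => [[G _ ->]|H].
- by apply/setP=> x; rewrite !inE; apply/imsetP=> -[].
- by exists (inr @^-1: S); rewrite ?inE // -{1}(sumsetK S) H imset0 set0U.
- by apply/setP=> x; rewrite !inE; apply/imsetP=> -[].
- by exists (inl @^-1: S); rewrite ?inE // -{1}(sumsetK S) H imset0 setU0.
Qed.

Lemma Dmn_sV m n : sV (Dmn m n) = setT.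
Proof. exact: dunion_sV. Qed.

Lemma Dmn_faceE m n (S : {set 'I_m.+1 + 'I_n.+1}) :
  (S \in sF (Dmn m n)) = (inl @^-1: S != setT) && (inr @^-1: S != setT).
Proof.
rewrite /Dmn /adual inE dunion_sV subsetT setTD dunion_faceE negb_or.
by congr (~~ _ && ~~ _); rewrite preimsetC -setCT (inj_eq (can_inj (@setCK _))).
Qed.

Lemma cone_sV p (K : scx) : sV K = setT -> sV (cone p K) = setT.
Proof. by move=> VT; apply/setP=> -[u|u]; rewrite /= ?mem_sumsetl ?mem_sumsetr ?VT !inE. Qed.

(** * Cones over two blocks as isomorphic copies *)

Section Blocks.
Variables (T : finType) (W X Y : {set T}) (p m n : nat).
Hypotheses (b : base X Y W) (cO : #|W :\: (X :|: Y)| = p) (cX : #|X| = m.+1) (cY : #|Y| = n.+1).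

Definition block_map (u : 'I_p + ('I_m.+1 + 'I_n.+1)) : T :=
  match u with
  | inl i => enum_val (cast_ord (esym cO) i)
  | inr (inl i) => enum_val (cast_ord (esym cX) i)
  | inr (inr i) => enum_val (cast_ord (esym cY) i)
  end.

Lemma block_mapX x : x \in X -> exists i, x = block_map (inr (inl i)).
Proof.
move=> xX; exists (cast_ord cX (enum_rank_in xX x)).
by rewrite /block_map cast_ordK enum_rankK_in.
Qed.
Lemma block_mapY x : x \in Y -> exists i, x = block_map (inr (inr i)).
Proof.
move=> xX; exists (cast_ord cY (enum_rank_in xX x)).
by rewrite /block_map cast_ordK enum_rankK_in.
Qed.
Lemma block_mapO x : x \in W :\: (X :|: Y) -> exists i, x = block_map (inl i).
Proof.
move=> xX; exists (cast_ord cO (enum_rank_in xX x)).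
by rewrite /block_map cast_ordK enum_rankK_in.
Qed.

Lemma block_mapP u : match u with
  | inl _ => block_map u \in W :\: (X :|: Y)
  | inr (inl _) => block_map u \in X
  | inr (inr _) => block_map u \in Y end.
Proof. by case: u => [i|[i|i]]; exact: enum_valP. Qed.

Lemma block_map_inj : injective block_map.
Proof.
case: (b) => XW YW d _ _ u v; have := block_mapP v; have := block_mapP u.
case: u => [i|[i|i]]; case: v => [j|[j|j]] hu hv e; rewrite e ?inE in hu; move: hu hv; rewrite ?inE.
all: try by move/cast_ord_inj: (enum_val_inj e) => ->.
- by move=> /andP[/norP[/negbTE-> _] _].
- by move=> /andP[/norP[_ /negbTE->] _].
- by move=> -> .
- by move=> H; rewrite (disjointFr d H).
- by move=> ->; rewrite orbT.
- by move=> H; rewrite (disjointFl d H).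
Qed.

Lemma block_map_im : block_map @: setT = W.
Proof.
case: (b) => XW YW d _ _.
apply/setP=> x; apply/imsetP/idP => [[u _ ->]|xW].
  have := block_mapP u; case: u => [i|[i|i]]; [|exact: (subsetP XW)|exact: (subsetP YW)].
  by rewrite inE => /andP[].
case: (boolP (x \in X)) => [/block_mapX[i ->]|xX]; first by exists (inr (inl i)).
case: (boolP (x \in Y)) => [/block_mapY[i ->]|xY]; first by exists (inr (inr i)).
have /block_mapO[i ->] : x \in W :\: (X :|: Y) by rewrite !inE negb_or xX xY.
by exists (inl i).
Qed.

Lemma block_or (f : {set T} -> bool) : (forall S : {set T}, S \subset W -> f S = orf X Y S) ->
  iso (cone p (dunion (simplex m) (simplex n))) (scx_of_pred f W).
Proof.
move=> fE; apply: (@iso_scx_of (cone p (dunion (simplex m) (simplex n))) T f W block_map).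
- by move=> u v _ _; exact: block_map_inj.
- by rewrite cone_sV ?dunion_sV // block_map_im.
- by move=> F _; rewrite cone_sV ?dunion_sV // subsetT.
move=> S _; rewrite cone_faceE dunion_faceE fE; last by rewrite -block_map_im imsetS ?subsetT.
rewrite /orf negb_and !negbK; congr (_ || _).
  apply/eqP/idP => [E|d].
    apply: nmeetsP => x /block_mapX[i ->]; rewrite mem_imset; last exact: block_map_inj.
    by move/setP/(_ i): E; rewrite !inE.
  apply/setP=> i; rewrite !inE; have := disjointFr d (block_mapP (inr (inl i))).
  by rewrite mem_imset //; exact: block_map_inj.
apply/eqP/idP => [E|d].
  apply: nmeetsP => x /block_mapY[i ->]; rewrite mem_imset; last exact: block_map_inj.
  by move/setP/(_ i): E; rewrite !inE.
apply/setP=> i; rewrite !inE; have := disjointFr d (block_mapP (inr (inr i))).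
by rewrite mem_imset //; exact: block_map_inj.
Qed.

Lemma block_and (f : {set T} -> bool) : (forall S : {set T}, S \subset W -> f S = andf X Y S) ->
  iso (cone p (Dmn m n)) (scx_of_pred f W).
Proof.
move=> fE; apply: (@iso_scx_of (cone p (Dmn m n)) T f W block_map).
- by move=> u v _ _; exact: block_map_inj.
- by rewrite cone_sV ?Dmn_sV // block_map_im.
- by move=> F _; rewrite cone_sV ?Dmn_sV // subsetT.
move=> S _; rewrite cone_faceE Dmn_faceE fE; last by rewrite -block_map_im imsetS ?subsetT.
rewrite /andf negb_or; congr (~~ _ && ~~ _).
  apply/eqP/subsetP => [E x /block_mapX[i ->]|H].
    rewrite mem_imset; last exact: block_map_inj.
    by move/setP/(_ i): E; rewrite !inE.
  apply/setP=> i; rewrite !inE; have := H _ (block_mapP (inr (inl i))).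
  by rewrite mem_imset //; exact: block_map_inj.
apply/eqP/subsetP => [E x /block_mapY[i ->]|H].
  rewrite mem_imset; last exact: block_map_inj.
  by move/setP/(_ i): E; rewrite !inE.
apply/setP=> i; rewrite !inE; have := H _ (block_mapP (inr (inr i))).
by rewrite mem_imset //; exact: block_map_inj.
Qed.
End Blocks.

(** * Ghost and Lawrence vertices as an added point *)

Section Options.
Variables (T : finType) (f : {set T} -> bool) (W : {set T}) (x : T).
Hypotheses (fm : mono f) (xW : x \in W).

Let h (o : option T) : T := odflt x o.

Lemma opt_sV : h @: (Some @: (W :\ x) :|: [set None]) = W.
Proof.
by rewrite imsetU -imset_comp imset_set1 /= setUC (eq_imset (g := id)) // imset_id setD1K.
Qed.

Lemma opt_mem y : (Some y \in Some @: (W :\ x) :|: [set None]) = (y \in W :\ x).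
Proof. by rewrite !inE orbF mem_imset ?inE // => ? ? []. Qed.

Lemma opt_inj : {in Some @: (W :\ x) :|: [set None] &, injective h}.
Proof.
case=> [y|] [z|] //=; rewrite ?opt_mem !inE.
- by move=> _ _ ->.
- by move=> /andP[/negbTE yx _] _ e; rewrite e eqxx in yx.
- by move=> _ /andP[/negbTE yx _] e; rewrite -e eqxx in yx.
Qed.

Lemma opt_im (S : {set option T}) : h @: S = (if None \in S then x |: Some @^-1: S else Some @^-1: S).
Proof.
apply/setP=> y; apply/imsetP/idP => [[[z|] zS ->]|] /=.
- by case: ifP; rewrite !inE zS ?orbT.
- by rewrite zS !inE eqxx.
case: ifP => NS; rewrite !inE.
  by case/orP=> [/eqP->|yS]; [exists None|exists (Some y)].
by move=> yS; exists (Some y).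
Qed.

Lemma opt_sub (S : {set option T}) : S \subset Some @: (W :\ x) :|: [set None] ->
  Some @^-1: S \subset W :\ x.
Proof. by move=> /subsetP H; apply/subsetP=> y; rewrite inE => /H; rewrite opt_mem. Qed.

Lemma opt_face (F : {set {set T}}) (S : {set option T}) :
  (S \in [set Some @: G | G : {set T} in F]) = (None \notin S) && (Some @^-1: S \in F).
Proof.
have K (G : {set T}) : Some @^-1: (Some @: G) = G.
  by apply/setP=> y; rewrite inE mem_imset // => ? ? [].
apply/imsetP/andP => [[G GF ->]|[NS H]].
  by rewrite K; split=> //; apply/imsetP=> -[].
exists (Some @^-1: S) => //; apply/setP=> -[y|]; first by rewrite mem_imset ?inE // => ? ? [].
by rewrite (negbTE NS); apply/esym/imsetP=> -[].
Qed.

Lemma opt_faceU (F : {set {set T}}) (S : {set option T}) :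
  (S \in [set None |: Some @: G | G : {set T} in F]) = (None \in S) && (Some @^-1: S \in F).
Proof.
have K (G : {set T}) : Some @^-1: (None |: Some @: G) = G.
  by apply/setP=> y; rewrite !inE mem_imset // => ? ? [].
apply/imsetP/andP => [[G GF ->]|[NS H]].
  by rewrite K !inE eqxx.
exists (Some @^-1: S) => //; apply/setP=> -[y|]; last by rewrite NS !inE eqxx.
by rewrite !inE /= mem_imset ?inE // => ? ? [].
Qed.

Lemma iso_ghost : f [set x] -> iso (ghost (scx_of_pred f (W :\ x))) (scx_of_pred f W).
Proof.
move=> fx; apply: (@iso_scx_of (ghost (scx_of_pred f (W :\ x))) T f W h).
- exact: opt_inj.
- exact: opt_sV.
- move=> F /=; rewrite opt_face inE => /and3P[NF sF _].
  by apply/subsetP=> -[y yF|]; [rewrite opt_mem (subsetP sF) // inE|rewrite (negbTE NF)].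
- move=> S SV; rewrite /= opt_face inE opt_sub // opt_im; case: ifP => //= _.
  by apply/esym/negbTE; rewrite negbK; apply: fm fx; rewrite sub1set setU11.
Qed.

(** Once [W :\ x] is a face, every set avoiding [x] is one, and the faces through [x] are given by
    the link of [x]: this is the Lawrence lifting of that link. *)
Lemma iso_lawrence : ~~ f (W :\ x) ->
  iso (lawrence (scx_of_pred (fun S => f (S :|: [set x])) (W :\ x))) (scx_of_pred f W).
Proof.
move=> fx; apply: (@iso_scx_of (lawrence (scx_of_pred (fun S => f (S :|: [set x])) (W :\ x))) T f W h).
- exact: opt_inj.
- exact: opt_sV.
- move=> F /=; rewrite inE opt_faceU !inE => /orP[H|/and3P[NF sF _]].
    exact: subset_trans H (subsetUl _ _).
  by apply/subsetP=> -[y yF|_]; [rewrite opt_mem (subsetP sF) // inE|rewrite !inE orbT].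
- move=> S SV; rewrite /= inE opt_faceU !inE opt_sub // opt_im; case: ifP => NS /=.
    rewrite [x |: _]setUC [X in X || _](_ : _ = false) //.
    by apply/negbTE/subsetPn; exists None => //; apply/imsetP=> -[].
  rewrite orbF [X in X = _](_ : _ = true).
    by apply/esym; apply: contra fx; apply: fm; exact: opt_sub.
  apply/subsetP=> -[y yS|]; last by rewrite NS.
  have := subsetP SV _ yS; rewrite opt_mem => yW.
  by rewrite mem_imset // => ? ? [].
Qed.
End Options.

Lemma iso_simplex (T : finType) (f : {set T} -> bool) (W : {set T}) k :
  mono f -> #|W| = k.+1 -> f W = false -> iso (simplex k) (scx_of_pred f W).
Proof.
move=> fm cW fW; have im : (fun i => enum_val (cast_ord (esym cW) i)) @: setT = W.
  apply/setP=> x; apply/imsetP/idP => [[i _ ->]|xW]; first exact: enum_valP.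
  by exists (cast_ord cW (enum_rank_in xW x)); rewrite // cast_ordK enum_rankK_in.
apply: (@iso_scx_of (simplex k) _ _ _ (fun i => enum_val (cast_ord (esym cW) i))) => //=.
- by move=> i j _ _ /enum_val_inj/cast_ord_inj.
- move=> S _; rewrite inE; apply/esym; apply: contraFN fW; apply: fm.
  by apply/subsetP=> x /imsetP[i _ ->]; exact: enum_valP.
Qed.

Lemma avoids_sub (T : finType) (f : {set T} -> bool) (W W' : {set T}) :
  W' \subset W -> avoids f W -> avoids f W'.
Proof.
move=> WW av M FM [h [R [hi hW RW hE]]]; apply: (av M FM); exists h, R; split=> //.
  by move=> i; apply: (subsetP (setSD R WW)).
exact: subset_trans RW WW.
Qed.

Lemma avoids_nuclear (T : finType) (f : {set T} -> bool) (W : {set T}) :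
  mono f -> avoids f W -> nuclear (scx_of_pred f W).
Proof.
have [n] := ubnP #|W|; elim: n f W => // n IHn f W; rewrite ltnS => Wn fm av.
have IHx x : x \in W -> #|W :\ x| < n by move=> xW; apply: leq_trans (proper_card (properD1 xW)) Wn.
have noT (x : T) : x \notin set0 by rewrite inE.
have gh x : x \in W -> f [set x] -> nuclear (scx_of_pred f (W)).
  move=> xW fx; apply: nuc_ghost (iso_ghost fm xW fx); apply: IHn => //; first exact: IHx.
  exact: avoids_sub (subD1set _ _) av.
(* The type [T] may be empty, so the map is built from the absurd bound on elements of 'I_0. *)
have e0 : {f0 : 'I_0 -> T | forall S : {set 'I_0}, f0 @: S = set0}.
  exists (fun i : 'I_0 => False_rect T (notF (ltn_ord i))) => S.
  by apply/setP=> x; rewrite inE; apply/imsetP=> -[[]].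
have all0 (S : {set 'I_0}) : S = set0 by apply/setP=> -[].
case: (avoids_kind fm av) => [fW|f0|x xW fx|x xW fx|X Y b fE|X Y b fE].
- case: (posnP #|W|) => [/eqP|cW]; last first.
    by apply: (@nuc_simplex #|W|.-1); apply: iso_simplex; rewrite ?prednK.
  rewrite cards_eq0 => /eqP W0; apply: nuc_irrelevant; case: e0 => h hE.
  apply: (@iso_scx_of irrelevant _ _ _ h) => //=.
  + by move=> [].
  + by rewrite imset0 W0.
  + by move=> F; rewrite inE => /eqP->.
  + by move=> S _; rewrite (all0 S) hE inE eqxx -W0 fW.
(* In a void complex on a nonempty ground set every vertex is a ghost. *)
- case: (set_0Vmem W) => [W0|[x xW]]; last by apply: (gh x xW); apply: fm f0; rewrite sub0set.
  apply: nuc_void; case: e0 => h hE; apply: (@iso_scx_of Defs.void _ _ _ h) => //=.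
  + by move=> [].
  + by rewrite imset0 W0.
  + by move=> F; rewrite inE.
  + by move=> S _; rewrite (all0 S) hE inE f0.
- exact: gh fx.
- case: (boolP (f [set x])) => [/(gh x xW)//|fx1].
  apply: nuc_lawrence (iso_lawrence fm xW (negbT fx)); apply: IHn; first exact: IHx.
    by move=> A B AB; apply: fm; apply: setSU.
  apply: avoids_minor av; rewrite ?sub1set ?subD1set //.
  by apply: nmeetsP => u; rewrite !inE => /andP[/negbTE].
- case: (b) => _ _ _ cX cY.
  apply: (@nuc_cone_D #|W :\: (X :|: Y)| #|X|.-1 #|Y|.-1); rewrite ?ltn_predRL //.
  by apply: block_and fE => //; rewrite prednK // ltnW.
- case: (b) => _ _ _ cX cY.
  apply: (@nuc_cone_disj #|W :\: (X :|: Y)| #|X|.-1 #|Y|.-1).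
  by apply: block_or fE => //; rewrite prednK // ltnW.
Qed.

(** * Kernels and unimodularity *)

Local Open Scope ring_scope.

Definition marg (T : finType) (u : {set T} -> int) (F E : {set T}) : int :=
  \sum_(I : {set T}) (if I :&: F == E then u I else 0).

(** Rows for all faces instead of facets: the kernel is the same by [kernE], since a marginal is a
    sum of marginals on a larger face, and the constructions below need not track facets. *)
Definition kern (K : scx) (u : {set sT K} -> int) : Prop :=
  (forall I : {set sT K}, ~~ (I \subset sV K) -> u I = 0) /\
  (forall F : {set sT K}, F \in sF K -> forall E, marg u F E = 0).

Definition unit_valued (S : Type) (w : S -> int) : Prop := forall I, w I \in [:: 0; 1; -1].

Definition good (K : scx) : Prop := forall u : {set sT K} -> int, kern u -> (exists I, u I != 0) ->
  exists w : {set sT K} -> int, [/\ kern w, exists I, w I != 0,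
    forall I, u I = 0 -> w I = 0 & unit_valued w].

(** The failure of [good] with an explicit witness, the form in which it is certified and carried
    from a minor to the complex. *)
Definition bad (K : scx) : Prop := exists u : {set sT K} -> int, [/\ kern u, exists I, u I != 0
  & forall w : {set sT K} -> int, kern w -> (forall I, u I = 0 -> w I = 0) -> unit_valued w ->
    forall I, w I = 0].

Lemma Amul_marg (K : scx) (u : {set sT K} -> int) F E :
  (forall I : {set sT K}, ~~ (I \subset sV K) -> u I = 0) -> Amul K u F E = marg u F E.
Proof.
move=> u0; rewrite /Amul /marg [in RHS](bigID (fun I : {set sT K} => I \subset sV K)) /=.
by rewrite [X in _ + X]big1 ?addr0 // => I /u0->; case: ifP.
Qed.

Lemma marg_sub (T : finType) (u : {set T} -> int) (F G E : {set T}) : F \subset G ->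
  marg u F E = \sum_(E' : {set T} | E' :&: F == E) marg u G E'.
Proof.
move=> FG; rewrite /marg exchange_big /=; apply: eq_bigr => I _.
rewrite -big_mkcondr /= (eq_bigl (fun E' => (I :&: F == E) && (E' == I :&: G))).
  by case: (I :&: F =P E) => _ /=; rewrite ?big_pred0_eq // big_pred1_eq.
move=> E' /=; rewrite [I :&: G == _]eq_sym andbC [RHS]andbC; case: (E' =P I :&: G) => // ->.
by rewrite /= -setIA (setIidPr FG).
Qed.

Lemma facet_above (K : scx) F : F \in sF K -> exists2 G, facet K G & F \subset G.
Proof.
move=> FK; have [G /maxsetP[GK Gmax] FG] := maxset_exists (P := fun S => S \in sF K) FK.
exists G => //; rewrite /facet GK /=; apply/forallP=> H; apply/implyP=> HK; apply/implyP=> GH.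
by rewrite (Gmax _ HK GH).
Qed.

Lemma marg_out (T : finType) (u : {set T} -> int) (F E : {set T}) : ~~ (E \subset F) -> marg u F E = 0.
Proof.
move=> EF; apply: big1 => I _; case: eqP => // e; move: EF.
by rewrite -e subsetIr.
Qed.

Lemma kernE (K : scx) (u : {set sT K} -> int) : in_ker K u <-> kern u.
Proof.
split=> -[u0 H]; split=> //; last by move=> F E /andP[FK _] _; rewrite Amul_marg ?H.
move=> F FK E; have [G GK FG] := facet_above FK; rewrite (marg_sub _ _ FG) big1 // => E' _.
case: (boolP (E' \subset G)) => [E'G|/marg_out->//].
by rewrite -Amul_marg // H.
Qed.

Lemma margD (T : finType) (u v : {set T} -> int) (F E : {set T}) :
  marg (fun I => u I + v I) F E = marg u F E + marg v F E.
Proof. by rewrite -big_split; apply: eq_bigr => I _; case: ifP; rewrite ?addr0. Qed.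

Lemma margZ (T : finType) (u : {set T} -> int) a (F E : {set T}) :
  marg (fun I => a * u I) F E = a * marg u F E.
Proof. by rewrite mulr_sumr; apply: eq_bigr => I _; case: ifP; rewrite ?mulr0. Qed.

Lemma eq_marg (T : finType) (u v : {set T} -> int) (F E : {set T}) :
  (forall I, u I = v I) -> marg u F E = marg v F E.
Proof. by move=> H; apply: eq_bigr => I _; rewrite H. Qed.

Lemma kern_comb (K : scx) (u v : {set sT K} -> int) a b :
  kern u -> kern v -> kern (fun I => a * u I + b * v I).
Proof.
move=> [u0 uF] [v0 vF]; split=> [I IV|F FK E]; first by rewrite u0 ?v0 // !mulr0 addr0.
by rewrite margD !margZ uF ?vF // !mulr0 addr0.
Qed.

Lemma dvd_gcd_support (T : finType) (V : {set T}) (u : {set T} -> int) d :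
  (forall I, (d %| absz (u I))%N) -> (d %| \big[gcdn/0%N]_(I : {set T} | I \subset V) absz (u I))%N.
Proof.
by move=> H; apply: (big_ind (fun n => (d %| n)%N)) => // m n dm dn; rewrite dvdn_gcd dm.
Qed.

Lemma unit_valuedP (x : int) : reflect (absz x <= 1)%N (x \in [:: 0; 1; -1]).
Proof. by apply: (iffP idP); rewrite !inE; lia. Qed.

(** A unit-valued [w] below a circuit [u] has the same support, and eliminating one entry shows that
    the two are proportional. So [u I0] divides every entry of [u], and the gcd condition makes it a
    unit. *)
Lemma good_unimodular (K : scx) : good K -> unimodular K.
Proof.
move=> gK u [/kernE ku [J uJ] gu nmin].
have [w [kw [I0 wI0] wu w1]] := gK u ku (ex_intro _ J uJ).
have sup I : w I = 0 -> u I = 0.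
  move=> wI; apply/eqP/negPn/negP=> uI; apply: nmin; exists w; split=> //; last by exists I.
    exact/kernE.
  by exists I0.
have prop I : w I0 * u I = u I0 * w I.
  apply/eqP; rewrite -subr_eq0 -mulNr; apply/negPn/negP=> nz; apply: nmin.
  exists (fun I => w I0 * u I + (- u I0) * w I); split.
  - by apply/kernE/kern_comb.
  - by exists I.
  - by move=> I' uI'; rewrite uI' (wu I' uI') !mulr0 addr0.
  - exists I0; split; last by ring.
    by apply: contra wI0 => /eqP/wu->.
have /unit_valuedP w01 := w1 I0.
have wabs : absz (w I0) = 1%N by move: wI0 w01; lia.
have uE I : absz (u I) = (absz (u I0) * absz (w I))%N.
  by have := congr1 absz (prop I); rewrite !abszM wabs mul1n.
have u01 : absz (u I0) = 1%N.
  apply/eqP; rewrite -dvdn1 -gu; apply: dvd_gcd_support => I; rewrite (uE I); exact: dvdn_mulr.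
by move=> I; apply/unit_valuedP; rewrite uE u01 mul1n; apply/unit_valuedP.
Qed.

Definition supp (T : finType) (u : {set T} -> int) : {set {set T}} := [set I | u I != 0].

(** Descent on the support. Divided by its gcd, the witness either is a circuit, which unimodularity
    would make unit-valued, or has a witness of smaller support below it. *)
Lemma bad_not_unimodular (K : scx) : bad K -> ~ unimodular K.
Proof.
move=> [u [ku nu H]] uni.
have [n] := ubnP #|supp u|; elim: n u ku nu H => // n IHn u ku [J uJ] H; rewrite ltnS => Sn.
set g := (\big[gcdn/0%N]_(I : {set sT K} | I \subset sV K) absz (u I))%N.
have gJ I : (g %| absz (u I))%N.
  case: (boolP (I \subset sV K)) => [IV|/(proj1 ku)->//].
  by rewrite /g (bigD1 I) //= dvdn_gcdl.
have g0 : (0 < g)%N.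
  by rewrite lt0n; apply/eqP=> g0; have := gJ J; rewrite g0 dvd0n absz_eq0 (negbTE uJ).
have uE I : u I = g%:Z * (u I %/ g)%Z by rewrite mulrC divzK // dvdzE.
have g0' : g%:Z != 0 by rewrite -lt0n.
set v := fun I => (u I %/ g)%Z.
have u_v I : (u I == 0) = (v I == 0) by rewrite uE mulf_eq0 (negbTE g0').
have kv : kern v.
  split=> [I IV|F FK E]; first by apply/eqP; rewrite -u_v (proj1 ku).
  apply/eqP; rewrite -(mulrI_eq0 _ (mulfI g0')) -margZ (eq_marg (v := u)) ?(proj2 ku) //.
have vJ : v J != 0 by rewrite -u_v.
suff cv : circuit K v.
  have v1 : unit_valued v by move=> I; apply: uni cv I.
  have := H v kv _ v1 J; move/(_ _)/eqP; rewrite (negbTE vJ) => F; apply: notF; apply: F => I /eqP.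
  by rewrite u_v => /eqP.
split; [exact/kernE|by exists J| |].
  apply/eqP; rewrite -(eqn_pmul2l g0) muln1; apply/eqP.
  rewrite (big_morph (muln g) (muln_gcdr g) (muln0 g)).
  by apply: eq_bigr => I _; rewrite [in RHS]uE abszM.
(* Whatever lies below [w] lies below [u], so [w] inherits the property of [u]. *)
case=> w [/kernE kw nw wv [I [vI wI]]].
apply: (IHn w) => //.
  move=> w' kw' ww'; apply: H => // I' /eqP; rewrite u_v => /eqP/wv; exact: ww'.
apply: leq_trans Sn; apply: proper_card; apply/properP; split.
  by apply/subsetP=> I'; rewrite !inE u_v; apply: contra => /eqP/wv->.
by exists I; rewrite !inE ?u_v // wI.
Qed.

(** * Reindexing and sign-reversing involutions *)

Lemma sum_on (A B : finType) (D : {set A}) (phi : A -> B) (G : B -> int) :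
  {in D &, injective phi} -> (forall j, G j != 0 -> j \in phi @: D) ->
  \sum_j G j = \sum_(i in D) G (phi i).
Proof.
move=> inj H; rewrite (bigID (fun j => j \in phi @: D)) /= [X in _ + X]big1 ?addr0 ?big_imset //.
by move=> j /negP nj; apply/eqP/negPn/negP=> /H.
Qed.

Lemma sum_invol (A : finType) (s : A -> A) (G : A -> int) :
  involutive s -> (forall i, G (s i) = - G i) -> \sum_i G i = 0.
Proof.
move=> sK H; have e : \sum_i G i = - \sum_i G i.
  by rewrite {1}(reindex_inj (inv_inj sK)) -sumrN; apply: eq_bigr => i _.
lia.
Qed.

(** Symmetric difference with {x}. It preserves the trace on every [F] avoiding [x] and flips [sgs],
    so signed row sums over such [F] cancel in pairs. *)
Definition toggle (T : finType) (x : T) (I : {set T}) : {set T} :=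
  if x \in I then I :\ x else x |: I.

Lemma in_toggle (T : finType) (x y : T) (I : {set T}) :
  (y \in toggle x I) = if y == x then x \notin I else y \in I.
Proof. by rewrite /toggle; case: ifP => xI; rewrite !inE; case: eqP => // _; rewrite ?xI. Qed.

Lemma toggleK (T : finType) (x : T) : involutive (toggle x).
Proof.
move=> I; apply/setP=> y; rewrite !in_toggle eqxx; case: eqP => [->|//].
by rewrite negbK.
Qed.

Lemma toggleI (T : finType) (x : T) (I F : {set T}) : x \notin F -> toggle x I :&: F = I :&: F.
Proof.
move=> xF; apply/setP=> y; rewrite !inE in_toggle; case: eqP => // ->.
by rewrite (negbTE xF) !andbF.
Qed.

Definition sgs (T : finType) (I : {set T}) : int := (-1) ^+ #|I|.

Lemma sgs_toggle (T : finType) (x : T) (I : {set T}) : sgs (toggle x I) = - sgs I.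
Proof.
rewrite /sgs /toggle; case: ifP => xI; last by rewrite cardsU1 xI exprS mulN1r.
by rewrite [in RHS](cardsD1 x) xI exprS mulN1r opprK.
Qed.

Lemma sgs_sqr (T : finType) (I : {set T}) : sgs I * sgs I = 1.
Proof. by rewrite -expr2 sqrr_sign. Qed.

(** * Subsets of the image of h and R as pairs (J, r) *)

Section Embedding.
Variables (A T : finType) (h : A -> T) (R : {set T}).
Hypotheses (hi : injective h) (hR : forall i, h i \notin R).

Definition emb (J : {set A}) (r : {set T}) : {set T} := h @: J :|: r.

Lemma emb_preim (J : {set A}) (r : {set T}) : r \subset R -> h @^-1: emb J r = J.
Proof.
move=> rR; apply/setP=> i; rewrite !inE mem_imset // orbC.
by case: (boolP (h i \in r)) => // /(subsetP rR); rewrite (negbTE (hR i)).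
Qed.

Lemma emb_R (J : {set A}) (r : {set T}) : r \subset R -> emb J r :&: R = r.
Proof.
move=> rR; rewrite setIUl (setIidPl rR) [X in X :|: _](_ : _ = set0) ?set0U //.
by apply/setP=> x; rewrite !inE; apply/negP=> /andP[/imsetP[i _ ->]]; apply/negP.
Qed.

Lemma emb_inj (r : {set T}) : r \subset R -> injective (emb^~ r).
Proof. by move=> rR J J' e; rewrite -(emb_preim J rR) e emb_preim. Qed.

Lemma embE (I : {set T}) : I \subset emb setT R -> I = emb (h @^-1: I) (I :&: R).
Proof.
move=> /subsetP IB; apply/setP=> x; rewrite !inE; apply/idP/orP => [xI|[/imsetP[i]|/andP[]//]].
  have := IB x xI; rewrite inE => /orP[/imsetP[i _ e]|xR]; last by right; rewrite xI.
  by left; apply/imsetP; exists i; rewrite // inE -e.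
by rewrite inE => hI ->.
Qed.

Lemma embI (J F : {set A}) (r : {set T}) : r \subset R -> emb J r :&: emb F R = emb (J :&: F) r.
Proof.
move=> rR; apply/setP=> x; rewrite !inE; case: (boolP (x \in h @: setT)) => [/imsetP[i _ ->]|xn].
  have hr : h i \notin r by apply: contra (hR i); apply: (subsetP rR).
  by rewrite !mem_imset // (negbTE hr) (negbTE (hR i)) !orbF inE.
have nx (J' : {set A}) : x \in h @: J' = false.
  by apply: contraNF xn => /imsetP[i _ ->]; rewrite imset_f.
by rewrite !nx /= andb_idr //; apply: (subsetP rR).
Qed.

Lemma emb_sub (J : {set A}) (r : {set T}) : r \subset R -> emb J r \subset emb setT R.
Proof. by move=> rR; apply: setUSS rR; apply: imsetS; apply: subsetT. Qed.
End Embedding.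

(** The converse half is a slicing: a kernel vector below the extended one is cut by the trace [r]
    on [R], and each slice is a kernel vector of [M] below [u], hence zero if its entries are
    units. *)
Lemma bad_realizes (K M : scx) : wf K -> sV M = setT ->
  realizes (fun S : {set sT K} => S \notin sF K) (sV K) M -> bad M -> bad K.
Proof.
move=> [KV Kd] MV [h [R [hi hVR RV hE]]] [u [ku [J0 uJ0] uH]].
have hR i : h i \notin R by have := hVR i; rewrite inE => /andP[].
have hM S : (emb h S R \in sF K) = (S \in sF M) by apply: negb_inj; exact: hE.
pose B := emb h setT R.
have BV : B \subset sV K.
  rewrite subUset RV andbT; apply/subsetP=> x /imsetP[i _ ->].
  by have := hVR i; rewrite inE => /andP[].
pose u' (I : {set sT K}) := if I \subset B then sgs (I :&: R) * u (h @^-1: I) else 0.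
exists u'; split.
- split=> [I IV|F FK E].
    by rewrite /u'; case: ifP => // /subset_trans/(_ BV); rewrite (negbTE IV).
  (* A row whose face omits some [r] in [R] cancels by toggling [r]. If [F] contains [R], the row
     fixes the trace on [R], so the sign is constant and a row of [M] remains. *)
  case: (boolP (R \subset F)) => [RF|/subsetPn[r rR rF]]; last first.
    apply: (sum_invol (@toggleK _ r)) => I; rewrite toggleI //.
    case: ifP => _; rewrite ?oppr0 // /u'.
    have -> : (toggle r I \subset B) = (I \subset B).
      apply/subsetP/subsetP => H x; have := H x; rewrite in_toggle;
        by case: eqP => [->|_ //]; rewrite inE rR orbT.
    case: ifP => _; rewrite ?oppr0 //.
    have -> : toggle r I :&: R = toggle r (I :&: R).
      by apply/setP=> x; rewrite !inE !in_toggle !inE rR andbT; case: eqP => [->|//]; rewrite rR andbT.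
    rewrite sgs_toggle mulNr; congr (- (_ * u _)).
    apply/setP=> i; rewrite !inE in_toggle; case: eqP => // e.
    by have := hR i; rewrite e rR.
  case: (boolP (E \subset F)) => [EF|/marg_out->//].
  case: (boolP (E \subset B)) => [EB|EB]; last first.
    apply: big1 => I _; case: eqP => // e; rewrite /u'; case: ifP => // IB.
    by move: EB; rewrite -e (subset_trans (subsetIl _ _) IB).
  have ER : E :&: R \subset R by exact: subsetIr.
  rewrite /marg (sum_on (D := setT) (phi := fun J => emb h J (E :&: R))); first last.
  - move=> I; case: (I :&: F =P E) => [e|]; rewrite ?eqxx // /u'; case: ifP => [IB _|]; rewrite ?eqxx //.
    apply/imsetP; exists (h @^-1: I); rewrite ?inE // {1}(embE IB); congr (emb _ _ _).
    by rewrite -e -setIA (setIidPr RF).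
  - by move=> J J' _ _; apply: emb_inj.
  rewrite (eq_bigr (fun J => sgs (E :&: R) * (if J :&: h @^-1: F == h @^-1: E then u J else 0))); last first.
    move=> J _; rewrite /u' emb_sub // (emb_preim hi hR) // (emb_R hR) //.
    have -> : (emb h J (E :&: R) :&: F == E) = (J :&: h @^-1: F == h @^-1: E).
      apply/eqP/eqP => [e|/setP e].
        by rewrite -e preimsetI (emb_preim hi hR).
      apply/setP=> x; case: (boolP (x \in B)) => [|xB]; last first.
        rewrite inE [x \in E](contraNF _ xB); last exact: (subsetP EB).
        by rewrite [x \in emb _ _ _](contraNF _ xB) //; apply/subsetP/emb_sub.
      rewrite inE => /orP[/imsetP[i _ ->]|xR].
        by have := e i; rewrite !inE mem_imset // => <-; rewrite (negbTE (hR i)) andbF orbF.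
      rewrite !inE xR andbT (subsetP RF) // andbT orbC; case: (boolP (x \in E)) => //= _.
      by apply/imsetP=> -[i _ xe]; have := hR i; rewrite -xe xR.
    by case: ifP; rewrite ?mulr0.
  rewrite -mulr_sumr big_mkcond /= (eq_bigr (fun J => if J :&: h @^-1: F == h @^-1: E then u J else 0)).
    have := (proj2 ku) (h @^-1: F) _ (h @^-1: E); rewrite /marg => ->; first by rewrite mulr0.
    rewrite -hM; apply: Kd FK _; rewrite subUset RF andbT.
    by apply/subsetP=> x /imsetP[i]; rewrite inE => iF ->.
  by move=> J _; rewrite inE.
- exists (emb h J0 set0); rewrite /u' emb_sub ?sub0set // (emb_preim hi hR) ?sub0set // (emb_R hR) ?sub0set //.
  by rewrite /sgs cards0 mul1r.
move=> w' kw' ww' w1 I0; apply/eqP/negPn/negP=> wI0.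
have wB (I : {set sT K}) : w' I != 0 -> I \subset B.
  by apply: contraNT => IB; rewrite ww' // /u' (negbTE IB).
(* The rows of the faces [emb h F R] at [emb h E r] see only this slice, so they are exactly its
   kernel conditions over [M]. *)
pose r := I0 :&: R; have rR : r \subset R by exact: subsetIr.
have := uH (fun J => w' (emb h J r)) _ _ (fun J => w1 _) (h @^-1: I0).
rewrite -embE ?wB // => H; move: wI0; rewrite H ?eqxx //.
- split=> [I|F FM E]; first by rewrite MV subsetT.
  rewrite -[RHS](proj2 kw' (emb h F R) _ (emb h E r)) ?hM //.
  rewrite /marg [RHS](sum_on (D := setT) (phi := fun J => emb h J r)).
  + rewrite [RHS]big_mkcond; apply: eq_bigr => J _; rewrite inE embI //.
    by rewrite (inj_eq (emb_inj hi hR rR)).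
  + by move=> J J' _ _; apply: emb_inj.
  + move=> I; case: (I :&: _ =P _) => [e|]; rewrite ?eqxx // => /wB IB.
    apply/imsetP; exists (h @^-1: I); rewrite ?inE // {1}(embE IB); congr (emb _ _ _).
    have := congr1 (fun X => X :&: R) e; rewrite /= (emb_R hR) // -setIA.
    by rewrite (setIidPr (subsetUr _ _ : R \subset emb h F R)).
- move=> J uJ; apply: ww'; rewrite /u' emb_sub // (emb_preim hi hR) // uJ mulr0 //.
Qed.

(** * Kernels of nuclear complexes *)

(** The bijection is one only between the ground sets, so vectors are pulled back along images and
    pushed forward along [psi], with value zero on sets leaving the ground set. *)
Lemma good_iso (K L : scx) : iso K L -> good K -> good L.
Proof.
move=> [g [gi [gV [KV [LV gF]]]]] gK u ku [J0 uJ0].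
have gE (I J : {set sT K}) : I \subset sV K -> J \subset sV K -> (g @: I == g @: J) = (I == J).
  move=> IV JV; apply/eqP/eqP => [/setP e|->//]; apply/setP=> x.
  have := e (g x); case: (boolP (x \in sV K)) => [xV|xV]; last first.
    have nx (A : {set sT K}) : A \subset sV K -> x \in A = false.
      by move=> /subsetP AV; apply: contraNF xV; apply: AV.
    by rewrite !nx.
  have im (A : {set sT K}) : A \subset sV K -> (g x \in g @: A) = (x \in A).
    move=> AV; apply/imsetP/idP => [[y yA gxy]|xA]; last by exists x.
    by rewrite (gi _ _ xV (subsetP AV _ yA) gxy).
  by rewrite !im.
pose psi (J : {set sT L}) := [set x in sV K | g x \in J].
have psiV J : psi J \subset sV K by apply/subsetP=> x; rewrite inE => /andP[].
have psiK (J : {set sT L}) : J \subset sV L -> g @: psi J = J.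
  rewrite -gV => /subsetP JV; apply/setP=> y; apply/imsetP/idP => [[x]|yJ].
    by rewrite inE => /andP[_ gJ] ->.
  by have /imsetP[x xV e] := JV y yJ; exists x; rewrite // inE xV -e.
have gpsi (I : {set sT K}) : I \subset sV K -> psi (g @: I) = I.
  move=> IV; apply/eqP; rewrite -gE ?psiV // psiK // -gV; exact: imsetS.
pose pull (w : {set sT L} -> int) (I : {set sT K}) := if I \subset sV K then w (g @: I) else 0.
have margE (w : {set sT L} -> int) (F E : {set sT K}) :
    (forall I : {set sT L}, ~~ (I \subset sV L) -> w I = 0) ->
    F \subset sV K -> E \subset sV K -> marg w (g @: F) (g @: E) = marg (pull w) F E.
  move=> w0 FV EV; rewrite /marg (sum_on (D := powerset (sV K)) (phi := fun I => g @: I)).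
  - rewrite big_mkcond; apply: eq_bigr => I _; rewrite powersetE /pull; case: ifP => IV; last by case: ifP.
    rewrite -imsetI; last by move=> x y xI yF; apply: gi; [apply: (subsetP IV)|apply: (subsetP FV)].
    by rewrite gE // subIset // IV.
  - by move=> I J; rewrite !powersetE => IV JV /eqP; rewrite gE // => /eqP.
  - move=> J; case: (boolP (J \subset sV L)) => [JV _|/w0->]; last by case: ifP; rewrite eqxx.
    by apply/imsetP; exists (psi J); rewrite ?powersetE ?psiV // psiK.
have kpull w : kern w -> kern (pull w).
  move=> [w0 wF]; split=> [I IV|F FK E]; first by rewrite /pull (negbTE IV).
  case: (boolP (E \subset F)) => [EF|/marg_out->//].
  have FV := KV F FK; rewrite -margE // ?(subset_trans EF) // wF // -gF //.
have [|w [kw [I0 wI0] ww w1]] := gK (pull u) (kpull u ku).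
  exists (psi J0); rewrite /pull psiV psiK //.
  by apply: contraNT uJ0 => /(proj1 ku)->.
pose w' (J : {set sT L}) := if J \subset sV L then w (psi J) else 0.
have pw (I : {set sT K}) : pull w' I = w I.
  rewrite /pull; case: ifP => IV; last by rewrite (proj1 kw) ?IV.
  by rewrite /w' -gV imsetS // gpsi.
have w'0 (J : {set sT L}) : ~~ (J \subset sV L) -> w' J = 0 by rewrite /w' => /negbTE->.
exists w'; split.
- split=> // F FL E; case: (boolP (E \subset F)) => [EF|/marg_out->//].
  have FV := LV F FL; rewrite -(psiK F) // -(psiK E) ?(subset_trans EF) // margE //.
  by rewrite (eq_marg _ _ pw) (proj2 kw) // gF // psiK.
- exists (g @: I0); rewrite /w'.
  have IV : I0 \subset sV K by apply: contraNT wI0 => /(proj1 kw)->.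
  by rewrite -gV imsetS // gpsi.
- move=> J uJ; rewrite /w'; case: ifP => // JV; apply: ww.
  by rewrite /pull psiV psiK.
- by move=> J; rewrite /w'; case: ifP.
Qed.

(* Subsets of [option T] as pairs of a subset of [T] and a bit. *)
Definition osome (T : finType) (J : {set T}) : {set option T} := Some @: J.
Definition onone (T : finType) (J : {set T}) : {set option T} := None |: Some @: J.

Lemma in_osome (T : finType) (J : {set T}) o :
  (o \in osome J) = if o is Some x then x \in J else false.
Proof.
case: o => [x|]; first by rewrite mem_imset // => ? ? [].
by apply/imsetP=> -[].
Qed.

Lemma in_onone (T : finType) (J : {set T}) o :
  (o \in onone J) = if o is Some x then x \in J else true.
Proof. by rewrite in_setU1 -/(osome J) in_osome; case: o. Qed.

Lemma preim_osome (T : finType) (J : {set T}) : Some @^-1: osome J = J.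
Proof. by apply/setP=> x; rewrite inE in_osome. Qed.
Lemma preim_onone (T : finType) (J : {set T}) : Some @^-1: onone J = J.
Proof. by apply/setP=> x; rewrite inE in_onone. Qed.
Lemma oset_cases (T : finType) (I : {set option T}) :
  I = if None \in I then onone (Some @^-1: I) else osome (Some @^-1: I).
Proof.
case: ifP => NI; apply/setP=> -[x|]; rewrite ?in_onone ?in_osome ?inE //.
Qed.

Lemma sum_oset (T : finType) (G : {set option T} -> int) :
  \sum_I G I = \sum_J (G (osome J) + G (onone J)).
Proof.
rewrite (bigID (fun I : {set option T} => None \in I)) /= addrC big_split /=; congr (_ + _).
  rewrite (reindex_onto (@osome T) (fun I => Some @^-1: I)) /=.
    by apply: eq_bigl => J; rewrite in_osome preim_osome eqxx.
  by move=> I NI; rewrite [RHS]oset_cases (negbTE NI).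
rewrite (reindex_onto (@onone T) (fun I => Some @^-1: I)) /=.
  by apply: eq_bigl => J; rewrite in_onone preim_onone eqxx.
by move=> I NI; rewrite [RHS]oset_cases NI.
Qed.

Lemma oset_eqI (T : finType) (I F E : {set option T}) : (I :&: F == E) =
  (Some @^-1: I :&: Some @^-1: F == Some @^-1: E) && ((None \in I) && (None \in F) == (None \in E)).
Proof.
apply/eqP/andP => [<-|[/eqP e1 /eqP e2]]; first by rewrite -preimsetI inE !eqxx.
apply/setP=> -[x|]; last by rewrite inE e2.
by have := congr1 (fun S : {set T} => x \in S) e1; rewrite !inE.
Qed.

Lemma marg_oset (T : finType) (u : {set option T} -> int) (F E : {set option T}) :
  marg u F E = if None \in F then
     (if None \in E then marg (fun J => u (onone J)) (Some @^-1: F) (Some @^-1: E)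
      else marg (fun J => u (osome J)) (Some @^-1: F) (Some @^-1: E))
   else if None \in E then 0 else marg (fun J => u (osome J) + u (onone J)) (Some @^-1: F) (Some @^-1: E).
Proof.
rewrite /marg sum_oset.
rewrite (eq_bigr (fun J => (if (J :&: Some @^-1: F == Some @^-1: E) && ~~ (None \in E) then u (osome J) else 0) +
   (if (J :&: Some @^-1: F == Some @^-1: E) && ((None \in F) == (None \in E)) then u (onone J) else 0))); last first.
  by move=> J _; rewrite !oset_eqI !preim_osome !preim_onone in_osome in_onone /= [false == _]eq_sym eqbF_neg.
case: (None \in F); case: (None \in E) => /=.
- by apply: eq_bigr => J _; rewrite andbF andbT add0r.
- by apply: eq_bigr => J _; rewrite andbF andbT addr0.
- by apply: big1 => J _; rewrite andbF addr0.
- by apply: eq_bigr => J _; rewrite andbT; case: ifP; rewrite ?addr0.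
Qed.

Lemma sub_osome (T : finType) (V J : {set T}) : (osome J \subset Some @: V :|: [set None]) = (J \subset V).
Proof.
have mV x : (Some x \in Some @: V :|: [set None]) = (x \in V).
  by rewrite !inE orbF -/(osome V) in_osome.
apply/subsetP/subsetP => H; first by move=> x xJ; rewrite -mV H // in_osome.
by case=> [x|]; rewrite in_osome // mV; apply: H.
Qed.

Lemma sub_onone (T : finType) (V J : {set T}) : (onone J \subset Some @: V :|: [set None]) = (J \subset V).
Proof. by rewrite subUset -/(osome J) sub_osome sub1set !inE orbT. Qed.

(** Faces do not see the ghost, so only the sums over the two lifts of each set matter. If these
    sums are not all zero, a vector for [D] is lifted; otherwise two opposite entries suffice. *)
Lemma good_ghost (D : scx) : good D -> good (ghost D).
Proof.
move=> gD u [u0 uF] [I0 uI0].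
pose v (J : {set sT D}) := u (osome J) + u (onone J).
have supV (J : {set sT D}) : ~~ (J \subset sV D) -> u (osome J) = 0 /\ u (onone J) = 0.
  by move=> JV; rewrite !u0 /= ?sub_osome ?sub_onone.
have kv : kern v.
  split=> [J /supV[a b]|F FD E]; first by rewrite /v a b.
  have := uF (osome F) _ (osome E); rewrite marg_oset !in_osome !preim_osome; apply.
  by rewrite /= imset_f.
have kw (w : {set option (sT D)} -> int) : (forall J : {set sT D}, ~~ (J \subset sV D) -> w (osome J) = 0 /\ w (onone J) = 0) ->
    @kern D (fun J : {set sT D} => w (osome J) + w (onone J)) -> @kern (ghost D) w.
  move=> w0 [_ wF]; split=> [I|F /imsetP[G GD ->] E].
    rewrite (oset_cases I); case: ifP => _; rewrite /= ?sub_onone ?sub_osome;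
      by move=> /w0[].
  rewrite -/(osome G) marg_oset in_osome preim_osome; case: ifP => // _; exact: wF.
case: (boolP [exists J, v J != 0]) => [/existsP[J vJ]|/existsPn v0].
  have [w [kw' [J1 wJ1] ww w1]] := gD v kv (ex_intro _ J vJ).
  (* Each value of [w] is placed on one lift lying in the support of [u], the lift without the ghost
     if possible. Such a lift exists because [w J != 0] forces [v J != 0]. *)
  pose w' (I : {set option (sT D)}) := if (u (osome (Some @^-1: I)) != 0) == (None \notin I)
     then w (Some @^-1: I) else 0.
  have ws (J' : {set sT D}) : w' (osome J') = if u (osome J') != 0 then w J' else 0.
    by rewrite /w' preim_osome in_osome eqb_id.
  have wn (J' : {set sT D}) : w' (onone J') = if u (osome J') != 0 then 0 else w J'.
    by rewrite /w' preim_onone in_onone /= eqbF_neg; case: (u (osome J') != 0).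
  have wsum (J' : {set sT D}) : w' (osome J') + w' (onone J') = w J'.
    by rewrite ws wn; case: ifP; rewrite ?addr0 ?add0r.
  exists w'; split.
  - apply: kw => [J' J'V|].
      by rewrite ws wn (proj1 kw') //; case: ifP.
    split=> [I IV|F FD E]; first by rewrite wsum (proj1 kw').
    by rewrite (eq_marg _ _ wsum) (proj2 kw').
  - case: (boolP (u (osome J1) != 0)) => uJ1.
      by exists (osome J1); rewrite ws uJ1.
    by exists (onone J1); rewrite wn (negbTE uJ1).
  - move=> I uI; rewrite (oset_cases I); move: uI; rewrite {1}(oset_cases I); case: ifP => _ uI.
      rewrite wn; case: ifP => // /negbT; rewrite negbK => /eqP uo; apply: ww.
      by rewrite /v uI uo.
    by rewrite ws uI eqxx.
  - by move=> I; rewrite /w'; case: ifP.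
have vE (J : {set sT D}) : u (onone J) = - u (osome J).
  by have := v0 J; rewrite negbK /v addrC addr_eq0 => /eqP.
pose J0 := Some @^-1: I0.
have uJ0 : u (osome J0) != 0.
  by move: uI0; rewrite (oset_cases I0); case: ifP; rewrite ?vE ?oppr_eq0.
have J0V : J0 \subset sV D by apply: contraNT uJ0 => /supV[-> _].
have so (J : {set sT D}) : (osome J == osome J0) = (J == J0).
  by apply/eqP/eqP => [e|->//]; rewrite -(preim_osome J) e preim_osome.
have sn (J : {set sT D}) : (onone J == onone J0) = (J == J0).
  by apply/eqP/eqP => [e|->//]; rewrite -(preim_onone J) e preim_onone.
have son (J J' : {set sT D}) : (osome J == onone J') = false.
  by apply/eqP=> /setP/(_ None); rewrite in_osome in_onone.
pose w (I : {set option (sT D)}) : int := if I == osome J0 then 1 else if I == onone J0 then -1 else 0.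
have ws (J : {set sT D}) : w (osome J) = if J == J0 then 1 else 0 by rewrite /w so son.
have wn (J : {set sT D}) : w (onone J) = if J == J0 then -1 else 0 by rewrite /w sn [onone J == _]eq_sym son.
have wsum (J : {set sT D}) : w (osome J) + w (onone J) = 0 by rewrite ws wn; case: ifP.
exists w; split.
- apply: kw => [J JV|]; first by rewrite ws wn; case: eqP => // e; rewrite e J0V in JV.
  split=> [I IV|F FD E]; first by rewrite wsum.
  by rewrite (eq_marg _ _ wsum) /marg big1 // => I _; case: ifP.
- by exists (osome J0); rewrite ws eqxx.
- by move=> I; rewrite /w; case: eqP => [->|_]; [|case: eqP => [->|//]]; rewrite ?vE => /eqP;
    rewrite ?oppr_eq0 (negbTE uJ0).
- by move=> I; rewrite /w; case: ifP => // _; case: ifP.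
Qed.

(** The facet consisting of the old vertices forces opposite values on the two lifts of a set, so a
    kernel vector is determined by its half containing the new vertex, which is a kernel vector of
    [D]. *)
Lemma good_lawrence (D : scx) : good D -> good (lawrence D).
Proof.
move=> gD u [u0 uF] [I0 uI0].
have supV (J : {set sT D}) : ~~ (J \subset sV D) -> u (osome J) = 0 /\ u (onone J) = 0.
  by move=> JV; rewrite !u0 /= ?sub_osome ?sub_onone.
have vE (J : {set sT D}) : u (onone J) = - u (osome J).
  case: (boolP (J \subset sV D)) => [JV|/supV[-> ->]]; last by rewrite oppr0.
  have := uF (osome (sV D)) _ (osome J); rewrite marg_oset !in_osome !preim_osome.
  rewrite /= !inE subxx /= => /(_ isT); rewrite /marg (bigD1 J) //= (setIidPl JV) eqxx big1 ?addr0.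
    by move/eqP; rewrite addrC addr_eq0 => /eqP.
  move=> I IJ; case: eqP => // e; case: (boolP (I \subset sV D)) => [IV|/supV[-> ->]]; rewrite ?addr0 //.
  by move: IJ; rewrite -e (setIidPl IV) eqxx.
have kv : @kern D (fun J : {set sT D} => u (onone J)).
  split=> [J /supV[_ ->]//|F FD E].
  have := uF (onone F) _ (onone E); rewrite marg_oset !in_onone !preim_onone; apply.
  by rewrite /= inE [X in _ || X]imset_f ?orbT.
have [|w [kw [J1 wJ1] ww w1]] := gD _ kv.
  exists (Some @^-1: I0); move: uI0; rewrite {1}(oset_cases I0); case: ifP => // _.
  by rewrite vE oppr_eq0.
pose w' (I : {set option (sT D)}) := if None \in I then w (Some @^-1: I) else - w (Some @^-1: I).
have ws (J : {set sT D}) : w' (osome J) = - w J by rewrite /w' in_osome preim_osome.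
have wn (J : {set sT D}) : w' (onone J) = w J by rewrite /w' in_onone preim_onone.
exists w'; split.
- split=> [I|F].
    rewrite (oset_cases I); case: ifP => _; rewrite /= ?sub_onone ?sub_osome ?ws ?wn;
    by move=> /(proj1 kw) ->; rewrite ?oppr0.
  rewrite !inE => /orP[FV|/imsetP[G GD ->]] E.
    rewrite marg_oset.
    have -> : None \in F = false by apply/negbTE/negP=> /(subsetP FV)/imsetP[].
    case: ifP => // _; apply: big1 => J _; rewrite ws wn addNr; by case: ifP.
  rewrite -/(onone G) marg_oset in_onone preim_onone; case: ifP => _.
    by rewrite (eq_marg _ _ wn) (proj2 kw).
  have e (J : {set sT D}) : w' (osome J) = -1 * w J by rewrite ws mulN1r.
  by rewrite (eq_marg _ _ e) margZ (proj2 kw) // mulr0.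
- by exists (onone J1); rewrite wn.
- move=> I uI; rewrite (oset_cases I); move: uI; rewrite {1}(oset_cases I); case: ifP => _ uI.
    by rewrite wn ww.
  by rewrite ws ww ?oppr0 // vE uI oppr0.
- move=> I; apply/unit_valuedP; rewrite /w'; have /unit_valuedP := w1 (Some @^-1: I).
  by case: ifP; rewrite ?abszN.
Qed.

(** * Cones, disjoint unions and D_{m,n} *)

Definition sset (A B : finType) (P : {set A}) (Q : {set B}) : {set A + B} := inl @: P :|: inr @: Q.

Lemma sset_eq (A B : finType) (S : {set A + B}) (P : {set A}) (Q : {set B}) :
  (S == sset P Q) = (inl @^-1: S == P) && (inr @^-1: S == Q).
Proof.
apply/eqP/andP => [->|[/eqP<- /eqP<-]]; last by rewrite /sset sumsetK.
by rewrite preim_inl preim_inr !eqxx.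
Qed.

Lemma ssetI (A B : finType) (P : {set A}) (Q : {set B}) (F : {set A + B}) :
  sset P Q :&: F = sset (P :&: inl @^-1: F) (Q :&: inr @^-1: F).
Proof. by apply/eqP; rewrite sset_eq !preimsetI preim_inl preim_inr !eqxx. Qed.

Lemma sum_sset (A B : finType) (G : {set A + B} -> int) :
  \sum_I G I = \sum_P \sum_Q G (sset P Q).
Proof.
rewrite pair_big /= (reindex (fun p : {set A} * {set B} => sset p.1 p.2)) //=.
exists (fun S : {set A + B} => (inl @^-1: S, inr @^-1: S)) => [[P Q]|S] _ /=.
  by rewrite preim_inl preim_inr.
by rewrite /sset sumsetK.
Qed.

Lemma marg_sset (A B : finType) (u : {set A + B} -> int) (F E : {set A + B}) :
  marg u F E = \sum_P (if P :&: inl @^-1: F == inl @^-1: E then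
    marg (fun Q => u (sset P Q)) (inr @^-1: F) (inr @^-1: E) else 0).
Proof.
rewrite /marg sum_sset; apply: eq_bigr => P _; rewrite -(sumsetK E) -/(sset _ _).
case: ifP => PE.
  apply: eq_bigr => Q _; rewrite ssetI sset_eq !preim_inl !preim_inr.
  by move: PE; rewrite preim_inl => ->.
apply: big1 => Q _; rewrite ssetI sset_eq !preim_inl.
by move: PE; rewrite preim_inl => ->.
Qed.

(** All apexes lie in every facet, so the kernel splits over the traces on them; one slice with a
    nonzero entry is enough. *)
Lemma good_cone p (D : scx) : good D -> good (cone p D).
Proof.
move=> gD u [u0 uF] [I0 uI0].
pose P0 : {set 'I_p} := inl @^-1: I0; pose Q0 : {set sT D} := inr @^-1: I0.
have subV (P : {set 'I_p}) (Q : {set sT D}) : (sset P Q \subset sV (cone p D)) = (Q \subset sV D).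
  apply/subsetP/subsetP => H x.
    by move=> xQ; have := H (inr x); rewrite !mem_sumsetr => /(_ xQ).
  by case: x => x; rewrite /= ?mem_sumsetl ?mem_sumsetr ?inE //; apply: H.
have [||w [kw [J1 wJ1] ww w1]] := gD (fun Q => u (sset P0 Q)).
- split=> [Q QV|F FD E]; first by rewrite u0 ?subV.
  have := uF (sset setT F) _ (sset P0 E); rewrite cone_faceE preim_inr => /(_ FD).
  rewrite marg_sset !preim_inl !preim_inr (bigD1 P0) //= setIT eqxx big1 ?addr0 // => P PP.
  by rewrite setIT (negbTE PP).
- by exists Q0; rewrite /sset sumsetK.
pose w' (I : {set 'I_p + sT D}) := if inl @^-1: I == P0 then w (inr @^-1: I) else 0.
have wE P Q : w' (sset P Q) = if P == P0 then w Q else 0 by rewrite /w' preim_inl preim_inr.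
exists w'; split.
- split=> [I|F FD E].
    rewrite -(sumsetK I) -/(sset _ _) subV wE => /(proj1 kw)->; by case: ifP.
  rewrite marg_sset big1 // => P _; case: ifP => // _; rewrite (eq_marg (v := fun Q => (P == P0)%:R * w Q)).
    by rewrite margZ (proj2 kw) ?mulr0 // -cone_faceE.
  by move=> Q; rewrite wE; case: ifP; rewrite ?mul1r ?mul0r.
- by exists (sset P0 J1); rewrite wE eqxx.
- move=> I uI; rewrite /w'; case: eqP => // e; apply: ww.
  by rewrite -e /sset sumsetK.
- by move=> I; rewrite /w'; case: ifP.
Qed.

(* A cycle of alternating signs: from a row go to a column with a negative entry, then to a
   row with a positive entry in that column; a minimal nonempty set of rows stable under
   this map is permuted by it. *)
Lemma alternating_cycle (X Y : finType) (M : X -> Y -> int) :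
  (forall x, \sum_y M x y = 0) -> (forall y, \sum_x M x y = 0) ->
  (exists x y, M x y != 0) ->
  exists N : X -> Y -> int, [/\ forall x, \sum_y N x y = 0, forall y, \sum_x N x y = 0,
    exists x y, N x y != 0, forall x y, M x y = 0 -> N x y = 0
    & forall x y, N x y \in [:: 0; 1; -1]].
Proof.
move=> rows cols [x0 [y0 M0]].
pose nz x := [exists y, M x y < 0].
have neg (I : finType) (g : I -> int) i : \sum_j g j = 0 -> g i > 0 -> exists j, g j < 0.
  move=> s0 gi; apply/existsP; apply: contraLR gi => /existsPn H.
  have g0 j : 0 <= g j by rewrite leNgt H.
  have := s0; rewrite (bigD1 i) //= => s1.
  have : 0 <= \sum_(j | j != i) g j by apply: sumr_ge0.
  by move=> s2; rewrite -leNgt -[leRHS]s1 lerDl.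
have pos (I : finType) (g : I -> int) i : \sum_j g j = 0 -> g i < 0 -> exists j, 0 < g j.
  move=> s0 gi; have [||j] := @neg _ (fun j => - g j) i; [by rewrite sumrN s0 oppr0|by rewrite oppr_gt0|].
  by rewrite oppr_lt0 => gj; exists j.
have nzP x : nz x -> exists2 y, M x y < 0 & exists2 x', 0 < M x' y & nz x'.
  case/existsP=> y xy; exists y => //; have [x' x'y] := pos _ _ _ (cols y) xy.
  exists x' => //; apply/existsP; exact: neg (rows x') x'y.
have x0nz : nz x0.
  have [lt|gt|e] := ltrgtP (M x0 y0) 0; last by rewrite e in M0.
    by apply/existsP; exists y0.
  by apply/existsP; apply: neg (rows x0) gt.
(* The defaults of [phi] and [b] carry no meaning; [phiP] speaks only of rows with a negative
   entry. *)
pose phi x := odflt x [pick x' | nz x' & [exists y, (M x y < 0) && (0 < M x' y)]].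
pose b x := odflt y0 [pick y | (M x y < 0) && (0 < M (phi x) y)].
have phiP x : nz x -> nz (phi x) /\ (M x (b x) < 0) && (0 < M (phi x) (b x)).
  move=> /nzP[y xy [x' x'y nx']].
  have [n1 n2] : nz (phi x) /\ [exists y, (M x y < 0) && (0 < M (phi x) y)].
    rewrite /phi; case: pickP => [z /andP[]//|/(_ x')]; rewrite nx' /= => /existsPn/(_ y).
    by rewrite xy x'y.
  split=> //; rewrite /b; case: pickP => [//|H]; case/existsP: n2 => z; by rewrite H.
pose stable (S : {set X}) := (S != set0) && [forall x in S, nz x && (phi x \in S)].
have st0 : stable [set x | nz x].
  rewrite /stable; apply/andP; split; first by apply/set0Pn; exists x0; rewrite inE.
  by apply/forall_inP=> x; rewrite !inE => nx; rewrite nx (proj1 (phiP x nx)).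
have [S /minsetP[/andP[S0 /forall_inP St] Smin] _] := minset_exists st0.
have Snz x : x \in S -> nz x by move=> /St/andP[].
have im : phi @: S = S.
  apply: Smin; last by apply/subsetP=> x /imsetP[z /St/andP[_ zS] ->].
  apply/andP; split; first by rewrite -card_gt0 card_gt0 imset_eq0.
  apply/forall_inP=> x /imsetP[z /St/andP[_ zS] ->]; have /andP[-> _] := St _ zS.
  by apply: imset_f.
have inj : {in S &, injective phi} by apply/imset_injP; rewrite im.
(* Each [z] adds +1 at (phi z, b z) and -1 at (z, b z), in the same column, so columns cancel term
   by term; rows cancel because [phi] permutes [S]. *)
pose N x y : int := \sum_(z in S) (((phi z == x) && (b z == y))%:R - ((z == x) && (b z == y))%:R).
have MN x y z : z \in S -> phi z = x -> b z = y -> 0 < M x y.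
  by move=> /Snz/phiP[_ /andP[_ H]] <- <-.
have MN' x y : x \in S -> b x = y -> M x y < 0.
  by move=> /Snz/phiP[_ /andP[H _]] <-.
(* As [phi] is injective on [S], each entry receives at most one +1 and at most one -1. *)
have cnt (Q : pred X) : {in S &, forall z z', Q z -> Q z' -> z = z'} ->
    \sum_(z in S) (Q z)%:R = [exists z in S, Q z]%:R :> int.
  move=> uq; case: (boolP [exists z in S, Q z]) => [/exists_inP[z zS Qz]|/exists_inPn nQ].
    rewrite (bigD1 z) //= Qz big1 ?addr0 // => z' /andP[z'S zz]; case Qz' : (Q z') => //.
    by rewrite (uq _ _ z'S zS Qz' Qz) eqxx in zz.
  by rewrite big1 // => z /nQ/negbTE->.
have NE x y : N x y = [exists z in S, (phi z == x) && (b z == y)]%:R - ((x \in S) && (b x == y))%:R.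
  rewrite /N sumrB cnt; last by move=> z z' zS z'S /andP[/eqP<- _] /andP[/eqP/inj e _]; rewrite e.
  congr (_ - _); rewrite cnt; last by move=> z z' _ _ /andP[/eqP-> _] /andP[/eqP-> _].
  congr (_%:R); congr (nat_of_bool _); apply/exists_inP/andP => [[z zS /andP[/eqP<- e]]//|[xS e]].
  by exists x; rewrite ?eqxx.
exists N; split.
- move=> x; rewrite /N exchange_big /=; rewrite (eq_bigr (fun z => (phi z == x)%:R - (z == x)%:R)).
    rewrite sumrB -(big_imset (fun z => (z == x)%:R) inj) im subrr //.
  move=> z zS; rewrite sumrB; congr (_ - _).
    rewrite (bigD1 (b z)) //= eqxx andbT big1 ?addr0 // => y /negbTE ybz.
    by rewrite [b z == y]eq_sym ybz andbF.
  rewrite (bigD1 (b z)) //= eqxx andbT big1 ?addr0 // => y /negbTE ybz.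
  by rewrite [b z == y]eq_sym ybz andbF.
- move=> y; rewrite /N exchange_big /= big1 // => z zS; rewrite sumrB.
  rewrite (bigD1 (phi z)) //= eqxx big1 ?addr0; last by move=> x /negbTE; rewrite eq_sym => ->.
  rewrite (bigD1 z) //= eqxx big1 ?addr0 ?subrr //.
  by move=> x /negbTE; rewrite eq_sym => ->.
- have /set0Pn[z zS] := S0; exists z, (b z); rewrite NE zS eqxx /=.
  case: exists_inP => // -[z' z'S /andP[/eqP e1 /eqP e2]].
  by have := MN _ _ _ z'S e1 e2; have := MN' z (b z) zS erefl; lia.
- move=> x y M0'; rewrite NE; case: exists_inP => [[z zS /andP[/eqP e1 /eqP e2]]|_].
    by have := MN _ _ _ zS e1 e2; rewrite M0' ltxx.
  case: andP => [[xS /eqP e]|_]; last by [].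
  by have := MN' _ _ xS e; rewrite M0' ltxx.
- by move=> x y; rewrite NE; case: ([exists z in S, _]); case: (_ && _).
Qed.

(** The two facets turn a kernel vector into a matrix indexed by pairs of subsets, all of whose row
    and column sums vanish. *)
Lemma good_dunion m n : good (dunion (simplex m) (simplex n)).
Proof.
move=> u [_ uF] [I0 uI0].
pose M (P : {set 'I_m.+1}) (Q : {set 'I_n.+1}) := u (sset P Q).
have Fl : sset (setT : {set 'I_m.+1}) (set0 : {set 'I_n.+1}) \in sF (dunion (simplex m) (simplex n)).
  by rewrite dunion_faceE preim_inr eqxx orbT.
have Fr : sset (set0 : {set 'I_m.+1}) (setT : {set 'I_n.+1}) \in sF (dunion (simplex m) (simplex n)).
  by rewrite dunion_faceE preim_inl eqxx.
have rows P : \sum_Q M P Q = 0.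
  have := uF _ Fl (sset P set0); rewrite marg_sset !preim_inl !preim_inr (bigD1 P) //= setIT eqxx.
  rewrite [X in _ + X]big1 ?addr0.
    by rewrite /marg => e; rewrite -[RHS]e; apply: eq_bigr => Q _; rewrite setI0 eqxx.
  by move=> P' PP; rewrite setIT (negbTE PP).
have cols Q : \sum_P M P Q = 0.
  have := uF _ Fr (sset set0 Q); rewrite marg_sset !preim_inl !preim_inr => e.
  rewrite -[RHS]e; apply: eq_bigr => P _; rewrite setI0 eqxx /marg (bigD1 Q) //= setIT eqxx big1 ?addr0 //.
  by move=> Q' QQ; rewrite setIT (negbTE QQ).
have [|N [Nr Nc [P [Q NPQ]] NM N1]] := alternating_cycle rows cols.
  by exists (inl @^-1: I0), (inr @^-1: I0); rewrite /M /sset sumsetK.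
pose w (I : {set 'I_m.+1 + 'I_n.+1}) := N (inl @^-1: I) (inr @^-1: I).
have wE P' Q' : w (sset P' Q') = N P' Q' by rewrite /w preim_inl preim_inr.
exists w; split.
- split=> [I|F]; first by rewrite dunion_sV subsetT.
  rewrite dunion_faceE => /orP[]/eqP F0 E; rewrite marg_sset F0.
    rewrite (eq_bigr (fun P' => \sum_(Q' | (Q' :&: inr @^-1: F == inr @^-1: E) && (set0 == inl @^-1: E)) N P' Q')).
      by rewrite exchange_big /= big1.
    move=> P' _; rewrite setI0 big_mkcond /=; case: (set0 == _).
      by apply: eq_bigr => Q' _; rewrite wE andbT.
    by rewrite big1 // => Q' _; rewrite andbF.
  apply: big1 => P' _; case: ifP => // _; rewrite /marg.
  case: (set0 =P inr @^-1: E) => E0; last first.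
    by apply: big1 => Q' _; rewrite setI0; case: eqP.
  by rewrite -[RHS](Nr P'); apply: eq_bigr => Q' _; rewrite setI0 -E0 eqxx wE.
- by exists (sset P Q); rewrite wE.
- by move=> I uI; apply: NM; rewrite /M /sset sumsetK.
- by move=> I; apply: N1.
Qed.

Lemma toggle_ind (T : finType) (g : {set T} -> int) :
  (forall x I, g (toggle x I) = g I) -> forall I, g I = g set0.
Proof.
move=> H I; have [n] := ubnP #|I|; elim: n I => // n IHn I; rewrite ltnS => In.
case: (set_0Vmem I) => [->//|[x xI]]; rewrite -(H x I) IHn //.
by rewrite /toggle xI; apply: leq_trans In; rewrite [in X in (_ < X)%N](cardsD1 x) xI.
Qed.

(** A facet omits one vertex [a] of the first block and one vertex [b] of the second, so its rows
    are sums over four sets. After the sign change [s] they say that every mixed difference of [v]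
    is zero, whence [v] splits into a function of [P] plus a function of [Q]. *)
Lemma good_Dmn m n : good (Dmn m n).
Proof.
move=> u [_ uF] [I0 uI0].
pose A := 'I_m.+1; pose B := 'I_n.+1.
pose s (P : {set A}) (Q : {set B}) : int := sgs P * sgs Q.
have ss P Q : s P Q * s P Q = 1 by rewrite /s mulrACA !sgs_sqr mulr1.
pose v (P : {set A}) (Q : {set B}) : int := s P Q * u (sset P Q).
have uv (P : {set A}) (Q : {set B}) : u (sset P Q) = s P Q * v P Q by rewrite /v mulrA ss mul1r.
have vsq a b P Q : v P Q - v (toggle a P) Q - v P (toggle b Q) + v (toggle a P) (toggle b Q) = 0.
  have FD : sset (setT :\ a) (setT :\ b) \in sF (Dmn m n).
    rewrite Dmn_faceE preim_inl preim_inr; apply/andP; split; apply/eqP=> /setP.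
      by move/(_ a); rewrite !inE eqxx.
    by move/(_ b); rewrite !inE eqxx.
  have tog (T : finType) (x : T) (I J : {set T}) :
      (J :&: (setT :\ x) == I :&: (setT :\ x)) = (J == I) || (J == toggle x I).
    apply/eqP/orP => [/setP e|[]/eqP->]; rewrite ?toggleI ?inE ?eqxx //.
    case: (boolP ((x \in J) == (x \in I))) => xJ; [left|right]; apply/eqP/setP=> y;
      have := e y; rewrite ?in_toggle !inE andbT; case: (y =P x) => [->|]; rewrite ?andbT //=.
    - by move=> _; apply/eqP.
    - by move=> _; move: xJ; case: (x \in J); case: (x \in I).
  have tx (T : finType) (x : T) (I : {set T}) : toggle x I != I.
    by apply/eqP=> /setP/(_ x); rewrite in_toggle eqxx; case: (x \in I).
  have sum2 (T : finType) (x : T) (I : {set T}) (G : {set T} -> int) :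
      \sum_J (if J :&: (setT :\ x) == I :&: (setT :\ x) then G J else 0) = G I + G (toggle x I).
    rewrite (bigD1 I) //= eqxx (bigD1 (toggle x I)) /=; last exact: tx.
    rewrite tog eqxx orbT big1 ?addr0 // => J /andP[/negbTE J1 /negbTE J2].
    by rewrite tog J1 J2.
  have := uF _ FD (sset (P :&: (setT :\ a)) (Q :&: (setT :\ b))).
  rewrite marg_sset !preim_inl !preim_inr (sum2 _ a P (fun P' => marg (fun Q => u (sset P' Q)) _ _)).
  rewrite /marg !sum2 !uv /s !sgs_toggle.
  move=> e0; have : (sgs P * sgs Q) * (v P Q - v (toggle a P) Q - v P (toggle b Q) +
      v (toggle a P) (toggle b Q)) = 0 by rewrite -[RHS]e0; ring.
  by move/eqP; rewrite !mulf_eq0 !signr_eq0 /= => /eqP.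
have vrow a P Q : v (toggle a P) Q - v P Q = v (toggle a P) set0 - v P set0.
  apply: (toggle_ind (g := fun Q => v (toggle a P) Q - v P Q)) => b Q'.
  by have := vsq a b P Q'; lia.
have vadd P Q : v P Q = v P set0 + (v set0 Q - v set0 set0).
  suff <- : v P Q - v P set0 = v set0 Q - v set0 set0 by rewrite addrC subrK.
  apply: (toggle_ind (g := fun P => v P Q - v P set0)) => a P'.
  by have := vrow a P' Q; lia.
pose f (P : {set A}) : int := v P set0; pose g (Q : {set B}) : int := v set0 Q - v set0 set0.
(* The converse: a face omits some [a] and some [b]; toggling [b] cancels the summand depending on
   [P], and toggling [a] the one depending on [Q]. *)
have kw (f' : {set A} -> int) (g' : {set B} -> int) (w : {set A + B} -> int) :
    (forall P Q, w (sset P Q) = s P Q * (f' P + g' Q)) -> @kern (Dmn m n) w.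
  move=> wE; split=> [I|F]; first by rewrite Dmn_sV subsetT.
  rewrite Dmn_faceE => /andP[Fa Fb] E.
  have mis (T : finType) (S : {set T}) : S != setT -> exists x, x \notin S.
    rewrite -subTset => /subsetPn[x _ xS]; by exists x.
  have [a aF] := mis _ _ Fa; have [b bF] := mis _ _ Fb.
  pose w1 (I : {set A + B}) : int := s (inl @^-1: I) (inr @^-1: I) * f' (inl @^-1: I).
  pose w2 (I : {set A + B}) : int := s (inl @^-1: I) (inr @^-1: I) * g' (inr @^-1: I).
  have w12 (I : {set A + B}) : w I = w1 I + w2 I by rewrite -{1}(sumsetK I) -/(sset _ _) wE mulrDr.
  rewrite (eq_marg _ _ w12) margD [marg w1 _ _](sum_invol (@toggleK _ (inr b))).
    rewrite [marg w2 _ _](sum_invol (@toggleK _ (inl a))) // => I.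
    rewrite toggleI; last by rewrite inE in aF.
    case: ifP; rewrite ?oppr0 // => _; rewrite /w2.
    have -> : inl @^-1: toggle (inl a) I = toggle a (inl @^-1: I).
      by apply/setP=> x; rewrite !(inE, in_toggle).
    have -> : inr @^-1: toggle (inl a) I = inr @^-1: I :> {set B}.
      by apply/setP=> x; rewrite !(inE, in_toggle).
    by rewrite /s sgs_toggle !mulNr.
  move=> I; rewrite toggleI; last by rewrite inE in bF.
  case: ifP; rewrite ?oppr0 // => _; rewrite /w1.
  have -> : inr @^-1: toggle (inr b) I = toggle b (inr @^-1: I).
    by apply/setP=> x; rewrite !(inE, in_toggle).
  have -> : inl @^-1: toggle (inr b) I = inl @^-1: I :> {set A}.
    by apply/setP=> x; rewrite !(inE, in_toggle).
  by rewrite /s sgs_toggle mulrN !mulNr.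
have v0 : exists P Q, v P Q != 0.
  exists (inl @^-1: I0), (inr @^-1: I0); apply: contra uI0 => /eqP v0.
  by rewrite -(sumsetK I0) -/(sset _ _) uv v0 mulr0.
(* A nonzero [v P Q] means that [f P] and [- g Q] differ; the larger of them is a threshold
   separating them. *)
have [t [P [Q tPQ]]] : exists t P Q, (t <= f P) != (t <= - g Q).
  have [P [Q vPQ]] := v0; rewrite vadd -/(f P) -/(g Q) in vPQ.
  have [lt|gt|e] := ltrgtP (f P) (- g Q).
  - by exists (- g Q), P, Q; lia.
  - by exists (f P), P, Q; lia.
  - by move: vPQ; rewrite e addNr eqxx.
(* Up to the sign s, kernel vectors are f P + g Q; thresholding both summands at level t gives
   entries 0, 1, -1 without enlarging the support. *)
pose c (P : {set A}) (Q : {set B}) : int := (t <= f P)%R%:R - (t <= - g Q)%R%:R.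
pose w (I : {set A + B}) := s (inl @^-1: I) (inr @^-1: I) * c (inl @^-1: I) (inr @^-1: I).
have wE P' Q' : w (sset P' Q') = s P' Q' * c P' Q' by rewrite /w preim_inl preim_inr.
exists w; split.
- by apply: (kw (fun P => (t <= f P)%R%:R) (fun Q => - (t <= - g Q)%R%:R)) => P' Q'; rewrite wE.
- exists (sset P Q); rewrite wE mulf_eq0 !mulf_eq0 !signr_eq0 /= /c.
  by move: tPQ; case: (t <= f P); case: (t <= - g Q).
- move=> I uI; have : v (inl @^-1: I) (inr @^-1: I) = 0 by rewrite /v /sset sumsetK uI mulr0.
  rewrite vadd -/(f _) -/(g _) => e; rewrite /w /c.
  by move/eqP: e; rewrite addr_eq0 => /eqP ->; rewrite subrr mulr0.
- move=> I; apply/unit_valuedP; rewrite /w /c /s !abszM !abszX !exp1n.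
  by do 2!case: (t <= _).
Qed.

Lemma good_simplex k : good (simplex k).
Proof.
move=> u [_ uF] [I uI]; have := uF setT; rewrite inE => /(_ isT I).
rewrite /marg (bigD1 I) //= setIT eqxx big1 ?addr0 => [e|J JI]; first by rewrite e in uI.
by rewrite setIT (negbTE JI).
Qed.

Lemma good_irrelevant : good irrelevant.
Proof.
have all0 (S : {set 'I_0}) : S = set0 by apply/setP=> -[].
move=> u [_ uF] [I uI]; have := uF set0; rewrite inE eqxx => /(_ isT set0).
rewrite /marg (bigD1 I) //= setI0 eqxx big1 ?addr0 => [e|J JI]; first by rewrite e in uI.
by rewrite (all0 J) (all0 I) eqxx in JI.
Qed.

Lemma good_void : good Defs.void.
Proof.
have all0 (S : {set 'I_0}) : S = set0 by apply/setP=> -[].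
move=> u _ [I uI]; exists (fun=> 1); split.
- by split=> [J|F]; [rewrite (all0 J) sub0set|rewrite inE].
- by exists set0.
- by move=> J uJ; move: uI; rewrite (all0 I) -(all0 J) uJ eqxx.
- by [].
Qed.

Lemma nuclear_good (K : scx) : nuclear K -> good K.
Proof.
elim=> [D L _ gD i|D L _ gD i|p m n L i|p m n L _ _ i|k L i|L i|L i].
- exact: good_iso i (good_lawrence gD).
- exact: good_iso i (good_ghost gD).
- exact: good_iso i (good_cone (@good_dunion m n)).
- exact: good_iso i (good_cone (@good_Dmn m n)).
- exact: good_iso i (@good_simplex k).
- exact: good_iso i good_irrelevant.
- exact: good_iso i good_void.
Qed.

(** * Kernel vectors of the forbidden complexes *)

Definition trace_on (n : nat) (f l : seq nat) : seq nat := [seq i <- iota 0 n | (i \in f) && (i \in l)].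

Lemma trace_onP n f l l' :
  (vs n l :&: vs n f == vs n l' :&: vs n f) = (trace_on n f l == trace_on n f l').
Proof.
apply/eqP/eqP => [/setP e|e].
  apply: eq_in_filter => i; rewrite mem_iota add0n => /andP[_ lin].
  by have := e (Ordinal lin); rewrite !inE /= andbC => ->; rewrite andbC.
apply/setP=> i; have := congr1 (fun s : seq nat => val i \in s) e.
by rewrite !mem_filter mem_iota add0n ltn_ord !andbT !inE andbC => ->; rewrite andbC.
Qed.

(* One mask for each matrix row (f, e) met by the columns ls: the entries of that row on ls. *)
Definition masks (n : nat) (fs : seq (seq nat)) (ls : seq (seq nat)) : seq bitseq :=
  flatten [seq [seq [seq trace_on n f l == k | l <- ls] | k <- undup [seq trace_on n f l | l <- ls]] | f <- fs].

Definition masked_sum (m : bitseq) (x : seq int) : int := foldr (fun y z => y + z) 0 (mask m x).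

(** A recursive proposition, like [all_unit] and [all_zero], so that simplification on explicit
    lists yields a conjunction of linear constraints. *)
Fixpoint masked_sums (ms : seq bitseq) (x : seq int) : Prop :=
  if ms is m :: ms' then masked_sum m x = 0 /\ masked_sums ms' x else True.

Lemma masked_sumsP ms x : masked_sums ms x <-> forall m, m \in ms -> masked_sum m x = 0.
Proof.
elim: ms => [|m ms IH] /=; first by split.
split=> [[mx /IH H] m'|H]; first by rewrite inE => /orP[/eqP->|/H].
split; first by apply: H; rewrite mem_head.
by apply/IH=> m' m'm; apply: H; rewrite inE m'm orbT.
Qed.

Fixpoint all_unit (x : seq int) : Prop :=
  if x is c :: x' then (-1 <= c /\ c <= 1) /\ all_unit x' else True.

Fixpoint all_zero (x : seq int) : Prop :=
  if x is c :: x' then c = 0 /\ all_zero x' else True.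

Lemma all_unitP x : (forall c, c \in x -> c \in [:: 0; 1; -1]) -> all_unit x.
Proof.
elim: x => //= c x IH H; split; last by apply: IH => d dx; apply: H; rewrite inE dx orbT.
by have := H c (mem_head _ _); rewrite !inE => /or3P[]/eqP->.
Qed.

Lemma all_zeroP x : all_zero x -> forall c, c \in x -> c = 0.
Proof. by elim: x => //= c x IH [c0 /IH H] d; rewrite inE => /orP[/eqP->|/H]. Qed.

Section Certificate.
Variables (n : nat) (fs ls : seq (seq nat)).

Lemma masked_sumE (w : {set 'I_n} -> int) f k :
  masked_sum [seq trace_on n f l == k | l <- ls] [seq w (vs n l) | l <- ls] =
  \sum_(l <- ls) (if trace_on n f l == k then w (vs n l) else 0).
Proof.
rewrite /masked_sum; elim: ls => [|l s IH] /=; first by rewrite big_nil.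
by rewrite big_cons -IH; case: ifP => //= _; rewrite add0r.
Qed.

Hypothesis uls : uniq [seq trace_on n (iota 0 n) l | l <- ls].

Lemma uniq_vs : uniq [seq vs n l | l <- ls].
Proof.
have H l : vs n l :&: vs n (iota 0 n) = vs n l.
  by apply/setP=> i; rewrite !inE /= mem_iota leq0n add0n ltn_ord !andbT.
elim: ls uls => //= l s IH /andP[ls' us]; rewrite IH // andbT.
apply: contra ls' => /mapP[l' l's e]; apply/mapP; exists l' => //.
by apply/eqP; rewrite -trace_onP !H e.
Qed.

Lemma marg_supported (w : {set 'I_n} -> int) f l :
  (forall I, w I != 0 -> I \in [seq vs n l | l <- ls]) ->
  marg w (vs n f) (vs n l :&: vs n f) =
  \sum_(l' <- ls) (if trace_on n f l' == trace_on n f l then w (vs n l') else 0).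
Proof.
move=> wl; rewrite /marg (bigID (fun I => I \in [seq vs n l | l <- ls])) /= [X in _ + X]big1 ?addr0.
  rewrite -big_uniq ?uniq_vs //= big_map; apply: eq_bigr => l' _; by rewrite trace_onP.
move=> I nI; case: ifP => // _; apply/eqP/negPn/negP=> /wl; exact/negP.
Qed.

(* idx selects rows that already force a kernel vector supported on ls to be a multiple of cs. *)
Lemma bad_certificate (F : {set {set 'I_n}}) (cs : seq int) (idx : seq nat) :
  (forall S, S \in F -> has (fun l => S \subset vs n l) fs) ->
  all (fun l => vs n l \in F) fs ->
  size cs = size ls -> has (fun c => c != 0) cs ->
  all (fun m => masked_sum m cs == 0) (masks n fs ls) ->
  all (fun i => (i < size (masks n fs ls))%N) idx ->
  (forall x : seq int, size x = size ls ->
     masked_sums [seq nth [::] (masks n fs ls) i | i <- idx] x ->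
     all_unit x -> all_zero x) ->
  bad (@SCx 'I_n setT F).
Proof.
move=> Ffs fsF scs ncs csm idxm H.
have mE (w : {set 'I_n} -> int) f l : f \in fs -> l \in ls ->
    (forall I, w I != 0 -> I \in [seq vs n l | l <- ls]) ->
    [seq trace_on n f l' == trace_on n f l | l' <- ls] \in masks n fs ls /\
    masked_sum [seq trace_on n f l' == trace_on n f l | l' <- ls] [seq w (vs n l) | l <- ls] =
    marg w (vs n f) (vs n l :&: vs n f).
  move=> ffs lls wl; split; last by rewrite masked_sumE marg_supported.
  apply/flatten_mapP; exists f => //; apply/mapP; exists (trace_on n f l) => //.
  by rewrite mem_undup; apply/mapP; exists l.
(* Sets outside [ls] have index [size ls], so the default 0 extends [cs] by zero. *)
pose u (I : {set 'I_n}) := nth 0 cs (index I [seq vs n l | l <- ls]).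
have ul : [seq u (vs n l) | l <- ls] = cs.
  apply: (@eq_from_nth _ 0); rewrite size_map // => i il.
  rewrite (nth_map [::]) // /u -(nth_map [::] set0 (vs n)) // index_uniq ?size_map //.
  exact: uniq_vs.
have supu I : u I != 0 -> I \in [seq vs n l | l <- ls].
  apply: contraNT => nI; rewrite /u nth_default // scs memNindex // size_map //.
have kernF (w : {set 'I_n} -> int) :
    (forall f E, f \in fs -> marg w (vs n f) E = 0) -> @kern (@SCx 'I_n setT F) w.
  move=> wF; split=> [I|S SF E]; first by rewrite subsetT.
  have /hasP[f ffs Sf] := Ffs S SF; rewrite (marg_sub _ _ Sf) big1 // => E' _; exact: wF.
exists u; split.
- apply: kernF => f E ffs.
  case: (boolP (has (fun l => vs n l :&: vs n f == E) ls)) => [/hasP[l lls /eqP<-]|/hasPn nE].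
    have [mm <-] := mE u f l ffs lls supu.
    by rewrite ul; apply/eqP/(allP csm).
  apply: big1 => I _; case: eqP => // e; apply/eqP/negPn/negP=> /supu/mapP[l lls E'].
  by have := nE l lls; rewrite -E' e eqxx.
- move: ncs; rewrite -{1}ul has_map => /hasP[l lls ul0]; by exists (vs n l).
move=> w kw wu w1 I; apply/eqP/negPn/negP=> wI.
have supw J : w J != 0 -> J \in [seq vs n l | l <- ls].
  by move=> wJ; apply: supu; apply: contra wJ => /eqP/wu->.
have /all_zeroP az : all_zero [seq w (vs n l) | l <- ls].
  apply: H; first by rewrite size_map.
    apply/masked_sumsP=> m /mapP[i /(allP idxm) /(mem_nth [::])]; set m' := nth _ _ _ => m'm ->.
    move: m'm => /flatten_mapP[f ffs /mapP[k]]; rewrite mem_undup => /mapP[l lls ->] ->.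
    have [_ ->] := mE w f l ffs lls supw.
    by apply: (proj2 kw); apply: (allP fsF).
  by apply: all_unitP => c /mapP[l _ ->].
have /mapP[l lls e] := supw I wI.
by move: wI; rewrite e (az _ (map_f _ lls)) eqxx.
Qed.
End Certificate.

(** [fs] lists the facets, [ls] the support and [cs] the entries of the vector; [idx] has one row
    fewer than there are columns. In the last goal the entries are integer unknowns with the chosen
    rows and bounds of absolute value 1; an entry 2 or -2 in [cs] leaves only zero. *)
Ltac certify n fs ls cs idx :=
  apply: (@bad_certificate n fs ls _ _ cs idx);
  [by vm_compute | | | by [] | by vm_compute | by vm_compute | by vm_compute | ];
  [ | | let m := eval vm_compute in [seq nth [::] (masks n fs ls) i | i <- idx] in
    change [seq nth [::] (masks n fs ls) i | i <- idx] with m;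
    let x := fresh "x" in move=> x;
    do ?[let c := fresh "c" in case: x => [|c x]; first by []]; case: x => // _;
    rewrite /masked_sums /masked_sum /=; intros;
    repeat match goal with H : _ /\ _ |- _ => destruct H end; repeat split; lia ].

Lemma vs_sub_vs n l l' : (vs n l \subset vs n l') = all (fun i => (i \in l) ==> (i \in l')) (iota 0 n).
Proof.
rewrite sub_vsE; apply: eq_in_all => i; rewrite mem_iota => /andP[_ lin].
by rewrite (memnE _ (Ordinal lin)) inE.
Qed.

Lemma vs_compl n l : ~: vs n l = vs n [seq i <- iota 0 n | i \notin l].
Proof. by apply/setP=> i; rewrite !inE mem_filter /= mem_iota leq0n add0n ltn_ord !andbT. Qed.

Ltac in_facets := let S := fresh "S" in
  move=> S; rewrite !inE /= ?subsetT ?setTD ?sub_vsE ?vs_subE //= ?memnC //;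
  repeat match goal with |- context [memn ?S ?i] => case: (memn S i) => //= end.
Ltac facets_in := rewrite /= !inE ?subsetT ?setTD ?vs_compl ?vs_sub_vs.

Lemma bad_P4 : bad P4.
Proof.
certify 4%N [:: [:: 0; 1]; [:: 1; 2]; [:: 2; 3]]%N
  [:: [::]; [:: 1]; [:: 0; 1]; [:: 2]; [:: 1; 2]; [:: 0; 3]; [:: 1; 3]; [:: 0; 2; 3]; [:: 0; 1; 2; 3]]%N
  [:: -1 : int; 2; -1; 1; -1; 1; -1; -1; 1]
  [:: 0; 2; 3; 4; 7; 9; 10; 1]%N.
- by in_facets.
- by facets_in.
Qed.

Lemma bad_O6 : bad O6.
Proof.
certify 6%N [:: [:: 0; 2; 4]; [:: 0; 2; 5]; [:: 0; 3; 4]; [:: 0; 3; 5]; [:: 1; 2; 4]; [:: 1; 2; 5]; [:: 1; 3; 4]; [:: 1; 3; 5]]%N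
  [:: [:: 2]; [:: 1; 3]; [:: 2; 3]; [:: 4]; [:: 3; 4]; [:: 0; 3; 4]; [:: 0; 1; 3; 4]; [:: 2; 5]; [:: 1; 3; 5]; [:: 2; 3; 5]; [:: 0; 4; 5]; [:: 0; 1; 4; 5]; [:: 1; 2; 4; 5]; [:: 3; 4; 5]; [:: 1; 2; 3; 4; 5]]%N
  [:: -1 : int; 1; 1; 1; -2; 1; -1; 1; -1; -1; -1; 1; -1; 1; 1]
  [:: 0; 4; 5; 7; 8; 9; 12; 15; 17; 25; 30; 31; 38; 3]%N.
- by in_facets.
- by facets_in.
Qed.

Lemma bad_O6s : bad (adual O6).
Proof.
certify 6%N [:: [:: 0; 1; 2; 3]; [:: 0; 1; 4; 5]; [:: 2; 3; 4; 5]]%N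
  [:: [:: 0; 3]; [:: 1; 3]; [:: 0; 2; 3]; [:: 1; 2; 3]; [:: 0; 2; 5]; [:: 1; 2; 5]; [:: 3; 5]; [:: 0; 3; 5]; [:: 2; 3; 5]; [:: 0; 2; 3; 5]; [:: 1; 2; 3; 5]; [:: 0; 2; 4; 5]; [:: 1; 2; 4; 5]; [:: 3; 4; 5]; [:: 1; 3; 4; 5]; [:: 2; 3; 4; 5]; [:: 0; 2; 3; 4; 5]]%N
  [:: -1 : int; 1; 1; -1; 1; -1; -1; 1; 1; -2; 1; -1; 1; 1; -1; -1; 1]
  [:: 0; 1; 2; 3; 4; 5; 6; 8; 9; 10; 12; 15; 16; 18; 19; 7]%N.
- by in_facets.
- by facets_in.
Qed.

Lemma bad_J1 : bad J1.
Proof.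
certify 5%N [:: [:: 0; 1]; [:: 0; 4]; [:: 1; 2; 3]; [:: 2; 3; 4]]%N
  [:: [:: 2]; [:: 1; 2]; [:: 3]; [:: 0; 1; 3]; [:: 0; 2; 3]; [:: 1; 2; 3]; [:: 0; 2; 4]; [:: 1; 2; 4]; [:: 0; 1; 2; 4]; [:: 3; 4]; [:: 0; 1; 3; 4]; [:: 2; 3; 4]; [:: 0; 1; 2; 3; 4]]%N
  [:: -1 : int; 1; -1; 1; -1; 1; 1; -2; 1; 1; -1; 1; -1]
  [:: 0; 4; 8; 10; 11; 12; 13; 14; 15; 16; 1; 9]%N.
- by in_facets.
- by facets_in.
Qed.

Lemma bad_J1s : bad J1s.
Proof.
certify 5%N [:: [:: 0; 2; 3]; [:: 1; 2; 4]; [:: 1; 3; 4]]%N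
  [:: [::]; [:: 1]; [:: 0; 2]; [:: 0; 1; 2]; [:: 0; 3]; [:: 1; 3]; [:: 0; 2; 3]; [:: 1; 2; 3]; [:: 0; 4]; [:: 0; 1; 4]; [:: 0; 2; 4]; [:: 0; 1; 2; 4]; [:: 0; 3; 4]; [:: 1; 3; 4]; [:: 2; 3; 4]; [:: 0; 2; 3; 4]; [:: 0; 1; 2; 3; 4]]%N
  [:: 1 : int; -1; -1; 1; -1; 1; 1; -1; -1; 1; 1; -1; 1; -1; 1; -2; 1]
  [:: 0; 1; 3; 4; 5; 7; 8; 9; 10; 11; 14; 15; 16; 19; 20; 6]%N.
- by in_facets.
- by facets_in.
Qed.

Lemma bad_J2 : bad J2.
Proof.
certify 5%N [:: [:: 0; 1]; [:: 1; 2; 4]; [:: 2; 3]; [:: 0; 3; 4]]%N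
  [:: [:: 0; 1]; [:: 0; 2]; [:: 0; 1; 2]; [:: 1; 3]; [:: 2; 3]; [:: 1; 2; 3]; [:: 1; 4]; [:: 2; 4]; [:: 0; 1; 3; 4]; [:: 0; 2; 3; 4]]%N
  [:: -1 : int; -1; 2; 1; 1; -2; 1; -1; -1; 1]
  [:: 1; 3; 4; 5; 6; 7; 9; 15; 0]%N.
- by in_facets.
- by facets_in.
Qed.

(** Applied to the facets of the boundary of a simplex, seen as complements of {v, x}. *)
Lemma marg_square (T : finType) (w : {set T} -> int) (x y : T) (F I : {set T}) : x != y ->
  F = ~: [set x; y] ->
  marg w F (I :&: F) = w I + w (toggle x I) + (w (toggle y I) + w (toggle x (toggle y I))).
Proof.
move=> xy ->; have yx : (y == x) = false by rewrite eq_sym (negbTE xy).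
have tE (J : {set T}) : (J :&: ~: [set x; y] == I :&: ~: [set x; y]) =
    (J \in [:: I; toggle x I; toggle y I; toggle x (toggle y I)]).
  apply/eqP/idP => [/setP e|]; last first.
    by rewrite !inE => /or4P[]/eqP->; rewrite ?toggleI // !inE ?eqxx ?orbT.
  have eq (K : {set T}) : (x \in K) = (x \in J) -> (y \in K) = (y \in J) ->
      (forall z, z != x -> z != y -> (z \in K) = (z \in I)) -> J = K.
    move=> xK yK zK; apply/setP=> z; case: (eqVneq z x) => [->//|zx]; case: (eqVneq z y) => [->//|zy].
    by rewrite zK //; have := e z; rewrite !inE (negbTE zx) (negbTE zy) !andbT.
  rewrite !inE; have [xJ|xJ] := eqVneq (x \in J) (x \in I); have [yJ|yJ] := eqVneq (y \in J) (y \in I).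
  - by rewrite (eq I) ?eqxx.
  - rewrite (_ : J = toggle y I) ?eqxx ?orbT //; apply: eq => [||z zx zy]; rewrite !in_toggle ?(negbTE xy) //.
      by rewrite eqxx; move: yJ; case: (y \in I); case: (y \in J).
    by rewrite (negbTE zy).
  - rewrite (_ : J = toggle x I) ?eqxx ?orbT //; apply: eq => [||z zx zy]; rewrite !in_toggle ?yx //.
      by rewrite eqxx; move: xJ; case: (x \in I); case: (x \in J).
    by rewrite (negbTE zx).
  - rewrite (_ : J = toggle x (toggle y I)) ?eqxx ?orbT //.
    apply: eq => [||z zx zy]; rewrite !in_toggle ?yx ?(negbTE xy) ?eqxx.
    + by move: xJ; case: (x \in I); case: (x \in J).
    + by move: yJ; case: (y \in I); case: (y \in J).
    + by rewrite (negbTE zx) (negbTE zy).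
have ux : uniq [:: I; toggle x I; toggle y I; toggle x (toggle y I)].
  have ne z (A B : {set T}) : (z \in A) = ~~ (z \in B) -> (A == B) = false.
    by move=> e; apply/eqP=> AB; move: e; rewrite AB; case: (z \in B).
  rewrite /= !inE (ne x I (toggle x I)) ?(ne y I (toggle y I)) ?(ne x I (toggle x (toggle y I))) //=.
  - rewrite (ne x (toggle x I) (toggle y I)) ?(ne y (toggle x I)) ?(ne x (toggle y I)) //;
      by rewrite !in_toggle ?eqxx ?yx ?(negbTE xy) ?negbK.
  - by rewrite !in_toggle ?eqxx ?yx ?(negbTE xy) ?negbK.
  - by rewrite !in_toggle ?eqxx ?yx ?(negbTE xy) ?negbK.
  - by rewrite !in_toggle ?eqxx ?yx ?(negbTE xy) ?negbK.
rewrite /marg (eq_bigr (fun J => if J \in [:: I; toggle x I; toggle y I; toggle x (toggle y I)] then w J else 0)).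
  by rewrite -big_mkcond -big_uniq //= !big_cons big_nil addr0 !addrA.
by move=> J _; rewrite tE.
Qed.

(** * The boundary of a simplex with an isolated point *)

Section BdryPlusPoint.
Variable n : nat.
Hypothesis n1 : (1 <= n)%N.

Let T := 'I_n.+2.
Let v : T := ord_max.
Let a : T := ord0.
Let b : T := Ordinal (leqW n1 : 1 < n.+2)%N.

Lemma bdry_faceE (F : {set T}) : (F \in sF (bdry_plus_pt n)) =
  (v \notin F) && (F != [set~ v]) || (F == [set v]).
Proof.
have E1 : vs n.+2 (iota 0 n.+1) = [set~ v].
  apply/setP=> i; rewrite [RHS]in_setC1 [LHS]in_set mem_iota leq0n add0n ltn_neqAle.
  by rewrite (_ : (val i <= n.+1)%N = true) ?andbT // -ltnS ltn_ord.
have E2 : vs n.+2 [:: n.+1] = [set v].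
  by apply/setP=> i; rewrite !inE -(inj_eq val_inj).
rewrite !inE E1 E2 subsetC sub1set inE.
case: (F =P set0) => [->|_] /=; last by [].
rewrite inE /= orbT; apply/esym/orP; left; apply/eqP=> /setP/(_ a).
by rewrite !inE -(inj_eq val_inj).
Qed.

Let av : a != v. Proof. by rewrite -(inj_eq val_inj). Qed.
Let bv : b != v. Proof. by rewrite -(inj_eq val_inj) /= eqSS eq_sym -lt0n. Qed.
Let ba : b != a. Proof. by rewrite -(inj_eq val_inj). Qed.

(* A kernel vector u satisfies u(J) + u(v |: J) = c * chi(J) and has sum 0 on each side of v.  With
   c = 1 the v-side is chosen supported on three sets, with values 1, 1 and -2. *)
Let D (J : {set T}) : int := (J == set0)%:R + (J == [set a; b])%:R - 2 * (J == [set a])%:R.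
Let chi (J : {set T}) : int := sgs (J :\ v).
Let u (I : {set T}) : int := if v \in I then D (I :\ v) else chi I - D I.

Lemma D_out (J : {set T}) : v \in J -> D J = 0.
Proof.
move=> vJ; rewrite /D.
have ne (K : {set T}) : v \notin K -> (J == K) = false by move=> vK; apply: contraNF vK => /eqP<-.
by rewrite !ne ?mulr0 ?subr0 ?addr0 // !inE // ?negb_or ![v == _]eq_sym ?av.
Qed.

Lemma chi_toggle x (J : {set T}) : x != v -> chi (toggle x J) = - chi J.
Proof.
move=> xv; rewrite /chi -(sgs_toggle x); congr sgs; apply/setP=> z; rewrite !(inE, in_toggle).
by case: (z =P x) => [->|//]; rewrite xv.
Qed.

Lemma chi_togglev (J : {set T}) : chi (toggle v J) = chi J.
Proof. by rewrite /chi; congr sgs; apply/setP=> z; rewrite !(inE, in_toggle); case: eqP. Qed.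

Lemma toggle_in (J : {set T}) : v \in J -> toggle v J = J :\ v.
Proof. by rewrite /toggle => ->. Qed.
Lemma toggle_out (J : {set T}) : v \notin J -> toggle v J = v |: J.
Proof. by rewrite /toggle => /negbTE->. Qed.

Lemma u_toggle (J : {set T}) : u J + u (toggle v J) = chi J.
Proof.
rewrite /u in_toggle eqxx; case: (boolP (v \in J)) => vJ /=.
  by rewrite toggle_in // addrC -[chi (_ :\ _)](_ : chi J = _) ?subrK // /chi setDDl setUid.
by rewrite toggle_out // setU1K // subrK.
Qed.

Lemma sum_toggle (w : {set T} -> int) :
  \sum_(I : {set T}) (if v \in I then w I else 0) = \sum_(I : {set T}) (if v \in I then 0 else w (v |: I)).
Proof.
rewrite (reindex_inj (inv_inj (@toggleK _ v))); apply: eq_bigr => I _.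
by rewrite in_toggle eqxx; case: (boolP (v \in I)) => //= vI; rewrite toggle_out.
Qed.

Lemma sum_D : \sum_(J : {set T}) D J = 0.
Proof.
have delta (K : {set T}) : \sum_(J : {set T}) (J == K)%:R = 1 :> int.
  by rewrite (bigD1 K) //= eqxx big1 ?addr0 // => J /negbTE->.
by rewrite /D sumrB big_split /= -mulr_sumr !delta.
Qed.

Lemma marg_v (w : {set T} -> int) :
  marg w [set v] [set v] = \sum_(I : {set T}) (if v \in I then w I else 0).
Proof.
apply: eq_bigr => I _; congr (if _ then _ else _).
apply/eqP/idP => [/setP/(_ v)|vI]; first by rewrite !inE eqxx andbT.
by apply/setP=> z; rewrite !inE; case: eqP => [->|]; rewrite ?andbT ?andbF.
Qed.

Lemma bad_bdry : bad (bdry_plus_pt n).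
Proof.
exists u; split.
- split=> [I|F]; first by rewrite subsetT.
  rewrite bdry_faceE => /orP[/andP[vF FT] E|/eqP-> E].
    have [x xF xv] : exists2 x, x \notin F & x != v.
      have : ~~ ([set~ v] \subset F).
        by apply: contra FT => H; rewrite eqEsubset H andbT subsetC sub1set inE.
      by case/subsetPn=> x; rewrite !inE => xv xF; exists x.
    (* As [F] avoids [v], doubling the row sum replaces [u] by [chi], which cancels by toggling a
       vertex missing from [F]. *)
    have e : marg u F E = marg (fun I => u (toggle v I)) F E.
      rewrite {1}/marg (reindex_inj (inv_inj (@toggleK _ v))); apply: eq_bigr => I _.
      by rewrite toggleI.
    have : marg u F E + marg u F E = 0.
      rewrite {2}e -margD (eq_marg _ _ u_toggle).
      apply: (sum_invol (@toggleK _ x)) => I; rewrite toggleI //.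
      by case: ifP; rewrite ?oppr0 // chi_toggle.
    by move/eqP; rewrite -mulr2n mulrn_eq0 => /eqP.
  case: (boolP (E \subset [set v])) => [|/marg_out->//].
  rewrite subset1 => /orP[]/eqP->.
    rewrite marg_v sum_toggle -[RHS]sum_D; apply: eq_bigr => I _.
    case: (boolP (v \in I)) => vI; first by rewrite D_out.
    by rewrite /u setU11 setU1K.
  rewrite /marg (eq_bigr (fun I : {set T} => (if v \in I then 0 else chi I) - D I)).
    rewrite sumrB sum_D subr0; apply: (sum_invol (@toggleK _ a)) => I.
    by rewrite in_toggle eq_sym (negbTE av); case: ifP; rewrite ?oppr0 // chi_toggle.
  move=> I _; rewrite setI_eq0 disjoint_sym disjoints1 /u.
  by case: (boolP (v \in I)) => vI //=; rewrite D_out // subr0.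
- exists [set v]; rewrite /u set11 setDv /D eqxx.
  have s0 (K : {set T}) : a \in K -> (set0 == K) = false.
    by move=> aK; apply/eqP=> e; rewrite -e inE in aK.
  by rewrite !s0 ?set11 ?set21.
move=> w [_ wF] wu w1.
(* The facets avoiding [v] make [S] change sign when any other vertex is toggled, so [S] is [chi]
   times its value at the empty set. *)
pose S (I : {set T}) := w I + w (toggle v I).
have SF x (I : {set T}) : x != v -> S I + S (toggle x I) = 0.
  move=> xv; have := wF (~: [set v; x]) _ (I :&: ~: [set v; x]).
  rewrite (@marg_square _ w v x) // 1?eq_sym // => <- //.
  rewrite bdry_faceE !inE eqxx /= orbC; apply/orP; right; apply/eqP=> /setP/(_ x).
  by rewrite !inE eqxx orbT xv.
have Sg (I : {set T}) : chi I * S I = S set0.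
  have -> : S set0 = chi set0 * S set0 by rewrite /chi set0D /sgs cards0 mul1r.
  apply: (toggle_ind (g := fun I => chi I * S I)) => x J.
  have [->|xv] := eqVneq x v; first by rewrite chi_togglev /S toggleK [w J + _]addrC.
  by rewrite chi_toggle //; have := SF x J xv; move/eqP; rewrite addr_eq0 => /eqP ->; rewrite mulrN mulNr.
have SE (I : {set T}) : S I = chi I * S set0 by rewrite -(Sg I) mulrA sgs_sqr mul1r.
have nav : v \notin [set a] by rewrite inE eq_sym.
have nabv : v \notin [set a; b] by rewrite !inE negb_or ![v == _]eq_sym av.
have n0v : v \notin set0 by rewrite inE.
have ch0 : chi set0 = 1 by rewrite /chi set0D /sgs cards0.
have chab : chi [set a; b] = 1.
  rewrite /chi (_ : _ :\ v = [set a; b]); last by apply/setDidPl; rewrite disjoint_sym disjoints1.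
  by rewrite /sgs cards2 eq_sym ba sqrrN expr1n.
have a0 : ([set a] == set0) = false by apply/eqP=> /setP/(_ a); rewrite !inE eqxx.
have ab0 : ([set a; b] == set0) = false by apply/eqP=> /setP/(_ a); rewrite !inE eqxx.
have aab : ([set a; b] == [set a]) = false.
  by apply/eqP=> /setP/(_ b); rewrite !inE eqxx orbT (negbTE ba).
(* The function [D] equals [chi] at the even sets [set0] and [[set a; b]], so [u] and [w] vanish
   there and [w] takes the value [c] once [v] is added. The zero sum on the [v]-side then forces -2c
   at [v |: [set a]]; unit entries leave [c = 0]. *)
have w0 : w set0 = 0.
  apply: wu; rewrite /u inE ch0 /D eqxx ![set0 == _]eq_sym ab0 a0; by [].
have wab : w [set a; b] = 0.
  by apply: wu; rewrite /u (negbTE nabv) chab /D eqxx ab0 aab.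
pose c := S set0.
have wv : w (v |: set0) = c by rewrite /c /S w0 add0r toggle_out.
have wvab : w (v |: [set a; b]) = c.
  by rewrite -[c]mul1r -chab -SE /S wab add0r toggle_out.
have wout (J : {set T}) : v \notin J -> D J = 0 -> w (v |: J) = 0.
  by move=> vJ DJ; apply: wu; rewrite /u setU11 setU1K.
have wva : w (v |: [set a]) = - (2 * c).
  have := wF [set v] _ [set v]; rewrite bdry_faceE eqxx orbT => /(_ isT).
  rewrite marg_v sum_toggle (bigD1 set0) //= (bigD1 [set a; b]) ?ab0 //= (bigD1 [set a]) /=; last first.
    by rewrite a0 eq_sym aab.
  rewrite !ifN // big1 ?addr0 => [|J /andP[/andP[J1 J2] J3]]; first by rewrite wv wvab; lia.
  case: ifP => // /negbT vJ; apply: wout => //.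
  by rewrite /D (negbTE J1) (negbTE J2) (negbTE J3).
have c0 : c = 0.
  by have := w1 (v |: [set a]); rewrite wva; move/unit_valuedP; lia.
have wvJ (J : {set T}) : v \notin J -> w (v |: J) = 0.
  move=> vJ; case: (eqVneq J set0) => [->|J1]; first by rewrite wv.
  case: (eqVneq J [set a; b]) => [->|J2]; first by rewrite wvab.
  case: (eqVneq J [set a]) => [->|J3]; first by rewrite wva c0 mulr0 oppr0.
  by apply: wout; rewrite // /D (negbTE J1) (negbTE J2) (negbTE J3).
move=> I; case: (boolP (v \in I)) => vI.
  by rewrite -(setD1K vI) wvJ // !inE eqxx.
by have := SE I; rewrite -/c c0 mulr0 /S toggle_out // wvJ // addr0.
Qed.
End BdryPlusPoint.

(** * Minors *)

Local Close Scope ring_scope.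

Lemma minor_faceE (K : scx) (S R A : {set sT K}) : wf K -> [disjoint S & R] ->
  A \subset sV K :\: S :\: R -> (A \in sF (minor K S R)) = (A :|: R \in sF K).
Proof.
move=> [KV _] dSR AG; apply/imsetP/idP => [[F]|AR].
  rewrite inE => /andP[/andP[FK RF] _] ->.
  rewrite (_ : _ :|: R = F) //; apply/setP=> x; rewrite !inE.
  by case: (boolP (x \in R)) => [/(subsetP RF)->|_]; rewrite ?orbT ?orbF.
exists (A :|: R).
  rewrite inE AR subsetUr /=; apply: nmeetsP => x; rewrite inE => /orP[/(subsetP AG)|xR].
    by rewrite !inE => /and3P[_ /negbTE].
  exact: disjointFl dSR xR.
apply/setP=> x; rewrite !inE; case: (boolP (x \in A)) => [/(subsetP AG)|_] /=.
  by rewrite !inE => /andP[-> _].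
by case: (x \in R).
Qed.

Lemma minor_realizes (K M : scx) : wf K -> sV M = setT -> is_minor_of M K ->
  realizes (fun S : {set sT K} => S \notin sF K) (sV K) M.
Proof.
move=> wK MV [S [R [SV RV dSR _ [g [gi [gV [_ [_ gF]]]]]]]].
have hP i : exists x, (x \in sV (minor K S R)) && (g x == i).
  have : i \in g @: sV (minor K S R) by rewrite gV MV inE.
  by case/imsetP=> x xG ->; exists x; rewrite xG eqxx.
pose h i := xchoose (hP i).
have hG i : h i \in sV K :\: S :\: R by have /andP[] := xchooseP (hP i).
have gh i : g (h i) = i by have /andP[_ /eqP] := xchooseP (hP i).
exists h, R; split=> //.
- by move=> i j e; rewrite -(gh i) e gh.
- by move=> i; have := hG i; rewrite !inE => /and3P[-> _ ->].
move=> A /=; have AG : h @: A \subset sV (minor K S R).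
  by apply/subsetP=> x /imsetP[i _ ->]; exact: hG.
rewrite -(minor_faceE wK dSR AG) gF //.
have -> : g @: (h @: A) = A by rewrite -imset_comp (eq_imset (g := id)) ?imset_id.
by [].
Qed.

(** The deleted set is everything outside [R] and the image of [h]; the isomorphism is a left
    inverse of [h], with [i0] as value off the image. *)
Lemma realizes_minor (K M : scx) : wf K -> sV M = setT -> set0 \in sF M -> sT M ->
  realizes (fun S : {set sT K} => S \notin sF K) (sV K) M -> is_minor_of M K.
Proof.
move=> wK MV M0 i0 [h [R [hi hVR RV hE]]].
have GE : sV K :\: (sV K :\: h @: setT :\: R) :\: R = h @: setT.
  apply/setP=> x; rewrite !inE; case: (boolP (x \in h @: setT)) => [/imsetP[i _ ->]|_].
    by have := hVR i; rewrite inE => /andP[-> ->].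
  by case: (x \in sV K); case: (x \in R).
have dR : [disjoint sV K :\: h @: setT :\: R & R].
  by apply: nmeetsP => x; rewrite !inE => /andP[/negbTE].
exists (sV K :\: h @: setT :\: R), R; split=> //.
- exact: subset_trans (subsetDl _ _) (subsetDl _ _).
- by have := hE set0; rewrite imset0 set0U M0 => /negbFE.
pose g x := odflt i0 [pick i | h i == x].
have gh i : g (h i) = i by rewrite /g; case: pickP => [j /eqP/hi//|/(_ i)]; rewrite eqxx.
have hg x : x \in h @: setT -> h (g x) = x by case/imsetP=> i _ ->; rewrite gh.
have ghA (A : {set sT M}) : g @: (h @: A) = A.
  by rewrite -imset_comp (eq_imset (g := id)) ?imset_id.
have hgA (A : {set sT K}) : A \subset h @: setT -> h @: (g @: A) = A.
  move=> /subsetP AG; rewrite -imset_comp; apply/setP=> x; apply/imsetP/idP => [[y yA ->]|xA].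
    by rewrite /= hg // AG.
  by exists x; rewrite //= hg ?AG.
have GE' : sV (minor K (sV K :\: h @: setT :\: R) R) = h @: setT by exact: GE.
exists g; rewrite GE'; do !split.
- by move=> x y xG yG e; rewrite -(hg x) // e hg.
- by rewrite ghA MV.
- move=> F /imsetP[F']; rewrite inE => /andP[/andP[FK _] dF] ->; apply/subsetP=> x.
  rewrite inE => /andP[xR xF']; have xV := subsetP (proj1 wK _ FK) _ xF'.
  by move: (disjointFr dF xF'); rewrite !inE xR xV andbT /= => /negbFE.
- by move=> G _; rewrite MV subsetT.
- move=> A AG; have AG' : A \subset sV K :\: (sV K :\: h @: setT :\: R) :\: R by rewrite GE.
  rewrite (minor_faceE wK dR AG') -{1}(hgA A AG).
  by apply: negb_inj; exact: hE.
Qed.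

Lemma forbidden_full (M : scx) : forbidden M -> [/\ sV M = setT, set0 \in sF M & inhabited (sT M)].
Proof.
have vs0 n (l : seq nat) i : i \in l -> (i < n)%N -> vs n l \subset set0 = false.
  by move=> il lin; apply/negbTE/subsetPn; exists (Ordinal lin); rewrite !inE.
case=> [||||||n n1]; split; rewrite ?inE //=; try exact: (inhabits ord0).
all: rewrite ?sub0set ?subsetT ?setD0 //.
- by rewrite (vs0 6%N [:: 0; 1]%N 0%N) // (vs0 6%N [:: 2; 3]%N 2%N) // (vs0 6%N [:: 4; 5]%N 4%N).
- by rewrite !subsetT.
- by rewrite eqxx orbT.
Qed.

Lemma forbidden_bad (M : scx) : forbidden M -> bad M.
Proof.
case=> [||||||n n1]; [exact: bad_P4|exact: bad_O6|exact: bad_O6s|exact: bad_J1|exact: bad_J1s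
  |exact: bad_J2|exact: bad_bdry].
Qed.

Lemma beta_avoidingP (K : scx) :
  beta_avoiding K <-> forall M, forbidden M -> ~ is_minor_of M K.
Proof.
split=> [[h1 [h2 [h3 [h4 [h5 [h6 h7]]]]]] M|H].
  by case=> [||||||n n1] //; apply: h7.
by do 6![split; first by apply: H; constructor]; move=> n n1; apply: H; constructor.
Qed.

Lemma avoids_beta (K : scx) : wf K ->
  (beta_avoiding K <-> avoids (fun S : {set sT K} => S \notin sF K) (sV K)).
Proof.
move=> wK; rewrite beta_avoidingP; split=> H M FM; have [MV M0 [i0]] := forbidden_full FM.
  by move/(realizes_minor wK MV M0 i0); exact: H.
by move/(minor_realizes wK MV); exact: H.
Qed.

Theorem theorem6p3 (K : scx) : wf K ->
  (unimodular K <-> beta_avoiding K) /\ (beta_avoiding K <-> nuclear K).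
Proof.
move=> wK.
have ub : unimodular K -> beta_avoiding K.
  move=> uK; apply/(avoids_beta wK) => M FM rM.
  have [MV _ _] := forbidden_full FM.
  exact: bad_not_unimodular (bad_realizes wK MV rM (forbidden_bad FM)) uK.
have nu : nuclear K -> unimodular K by move=> /nuclear_good; exact: good_unimodular.
have bn : beta_avoiding K -> nuclear K.
  move/(avoids_beta wK) => av.
  have fm : mono (fun S : {set sT K} => S \notin sF K).
    by move=> A B AB; apply: contra => BK; apply: (proj2 wK) BK AB.
  (* Since faces lie in the ground set, [K] is equal to, and not merely isomorphic to, the complex
     built from its own non-face predicate. *)
  have := avoids_nuclear fm av; congr nuclear.
  case: K wK {ub nu av fm} => T V F [/= FV _]; congr (@SCx T V _).
  apply/setP=> S; rewrite inE negbK andbC andb_idr //; exact: FV.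
by split; split=> // H; [apply/nu/bn|apply/ub/nu].
Qed.
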